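(* Let $(X,\mu)$ be a $\sigma$-finite measure space and let $h:X\to\mathbb{R}^{d+1}$ be measurable with $\operatorname{essran}(h)\subseteq\overline{D_\omega}$ for some $\omega\in(0,\frac{\pi}{2})$ and $h(x)\neq0$ for a.e. $x\in X$ (i.e. the multiplication operator $M_h$ on $L^2(X)$ is injective). Then for every $\theta\in(\omega,\frac{\pi}{2})$ and every $f\in\mathcal{SH}_L^{\mathrm{poly}}(D_\theta)$ or $f\in\mathcal{SH}_R^{\mathrm{poly}}(D_\theta)$, $$f(M_h)=M_{f\circ h},$$ where $f(M_h)$ is the left $H^\infty$-functional calculus of $M_h$ if $f\in\mathcal{SH}_L^{\mathrm{poly}}(D_\theta)$, and the right $H^\infty$-functional calculus of $M_h$ if $f\in\mathcal{SH}_R^{\mathrm{poly}}(D_\theta)$.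
   Context: Clifford algebra: for $d\in\mathbb{N}$, $d\ge1$, $\mathbb{R}_d$ is the real Clifford algebra generated by $e_1,\dots,e_d$ with $e_i^2=-1$, $e_ie_j=-e_je_i$ for $i\neq j$, with real basis $e_A=e_{i_1}\cdots e_{i_r}$, $A=(i_1,\dots,i_r)$, $1\le i_1<\dots<i_r\le d$, $e_\emptyset=1$. For $s=\sum_As_Ae_A$: $\overline{s}=\sum_A(-1)^{|A|(|A|+1)/2}s_Ae_A$, $|s|^2=\sum_As_A^2$. Paravectors: $\mathbb{R}^{d+1}=\{s_0+s_1e_1+\dots+s_de_d\}$, $\operatorname{Im}(s)=s_1e_1+\dots+s_de_d$. $\mathbb{S}=\{J\in\mathbb{R}^{d+1}\mid J_0=0,|J|=1\}$, $\mathbb{C}_J=\{x+Jy\mid x,y\in\mathbb{R}\}$, $[s]=\{s_0+J|\operatorname{Im}(s)|\mid J\in\mathbb{S}\}$; $U\subseteq\mathbb{R}^{d+1}$ is axially symmetric if $[s]\subseteq U$ for all $s\in U$. Slice hyperholomorphic functions: for $U$ open, axially symmetric, let $\mathcal{U}=\{(x,y)\in\mathbb{R}^2\mid x+\mathbb{S}y\subseteq U\}$. $f:U\to\mathbb{R}_d$ is in $\mathcal{SH}_L(U)$ (resp. $\mathcal{SH}_R(U)$) if there are $C^1$ functions $f_0,f_1:\mathcal{U}\to\mathbb{R}_d$ with $f(x+Jy)=f_0(x,y)+Jf_1(x,y)$ (resp. $f(x+Jy)=f_0(x,y)+f_1(x,y)J$) for all $J\in\mathbb{S}$, $f_0(x,-y)=f_0(x,y)$,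 $f_1(x,-y)=-f_1(x,y)$, $\partial_xf_0=\partial_yf_1$, $\partial_yf_0=-\partial_xf_1$. If $f_0,f_1$ are real valued, $f$ is intrinsic, $f\in\mathcal{N}(U)$. Hilbert module and operators: $V=L^2(X)$ is the space of (classes of) measurable $u:X\to\mathbb{R}_d$ with $\int_X|u|^2d\mu<\infty$, with pointwise left and right multiplication by Clifford numbers. $\mathcal{B}(V)$: bounded everywhere defined right-linear operators; $\mathcal{K}(V)$: closed right-linear operators $T:\operatorname{dom}(T)\subseteq V\to V$. Clifford numbers act on operators by left multiplication: $(sT)v=s(Tv)$, $(Ts)v=T(sv)$. Multivalued operators are right-linear subspaces of $V\times V$; an operator is identified with its graph, and the closure of a multivalued operator is its closure in $V\times V$. For measurable $g:X\to\mathbb{R}_d$ (defined a.e.), $(M_gu)(x)=g(x)u(x)$ with $\operatorname{dom}(M_g)=\{u\in L^2(X)\mid gu\in L^2(X)\}$, a closed densely defined operator. $\operatorname{essran}(h)=\{s\in\mathbb{R}^{d+1}\mid\forall\varepsilon>0:\mu\{x\in X\mid|h(x)-s|<\varepsilon\}>0\}$. $S$-spectrum: $Q_s[T]=T^2-2s_0T+|s|^2$ on $\operatorname{dom}(T^2)$, $\rho_S(T)=\{s\in\mathbb{R}^{d+1}\mid Q_s[T]^{-1}\in\mathcal{B}(V)\}$, $\sigma_S(T)=\mathbb{R}^{d+1}\setminus\rho_S(T)$; $S_L^{-1}(s,T)=Q_s[T]^{-1}\overline{s}-TQ_s[T]^{-1}$, $S_R^{-1}(s,T)=(\overline{s}-T)Q_s[T]^{-1}$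 for $s\in\rho_S(T)$. Double sector: $D_\omega=\{s\in\mathbb{R}^{d+1}\setminus\{0\}\mid\operatorname{Arg}(s)\in I_\omega\}$, $I_\omega=(-\omega,\omega)\cup(\pi-\omega,\pi+\omega)$, $\operatorname{Arg}(s)=\arccos(s_0/|s|)\in[0,\pi]$. Bisectorial: $T\in\mathcal{K}(V)$ is bisectorial of angle $\omega\in(0,\frac{\pi}{2})$ if $\sigma_S(T)\subseteq\overline{D_\omega}$ and for every $\varphi\in(\omega,\frac{\pi}{2})$ there is $C_\varphi\ge0$ with $\|S_L^{-1}(s,T)\|\le C_\varphi/|s|$ for all $s\in\mathbb{R}^{d+1}\setminus(D_\varphi\cup\{0\})$. (If $\operatorname{essran}(h)\subseteq\overline{D_\omega}$, then $M_h$ is bisectorial of angle $\omega$.) Function spaces: $\mathcal{SH}_L^0(D_\theta)$, $\mathcal{SH}_R^0(D_\theta)$, $\mathcal{N}^0(D_\theta)$ are the sets of bounded $f$ in $\mathcal{SH}_L(D_\theta)$, $\mathcal{SH}_R(D_\theta)$, $\mathcal{N}(D_\theta)$ with $\int_0^\infty|f(te^{J\phi})|\frac{dt}{t}<\infty$ for all $J\in\mathbb{S}$, $\phi\in I_\theta$ ($e^{J\phi}=\cos\phi+J\sin\phi$). $\mathcal{SH}_L^{\mathrm{poly}}(D_\theta)$ (resp. $\mathcal{SH}_R^{\mathrm{poly}}(D_\theta)$) is the set of $f\in\mathcal{SH}_L(D_\theta)$ (resp. $\mathcal{SH}_R(D_\theta)$) for which there are $C,\alpha\ge0$ with $|f(s)|\le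 C(|s|^\alpha+|s|^{-\alpha})$ for all $s\in D_\theta$. $\omega$-functional calculus: for $T$ bisectorial of angle $\omega$, $\theta\in(\omega,\frac\pi2)$, $g\in\mathcal{SH}_L^0(D_\theta)$ (resp. $\mathcal{SH}_R^0(D_\theta)$), $$g(T):=\frac{1}{2\pi}\int_{\partial D_\varphi\cap\mathbb{C}_J}S_L^{-1}(s,T)\,ds_J\,g(s)\qquad\Big(\text{resp. }g(T):=\frac{1}{2\pi}\int_{\partial D_\varphi\cap\mathbb{C}_J}g(s)\,ds_J\,S_R^{-1}(s,T)\Big),$$ with arbitrary $J\in\mathbb{S}$, $\varphi\in(\omega,\theta)$ (the value is independent of them, and for intrinsic $g$ both versions coincide). Here $ds_J:=-J\,ds$ and the path is positively oriented: the rays $\{te^{J\varphi}\}$, $\{te^{J(\pi+\varphi)}\}$ are traversed from $\infty$ to $0$, the rays $\{te^{-J\varphi}\}$, $\{te^{J(\pi-\varphi)}\}$ from $0$ to $\infty$. $H^\infty$-functional calculus: let $T\in\mathcal{K}(V)$ be injective and bisectorial of angle $\omega$, $\theta\in(\omega,\frac{\pi}{2})$. For $f\in\mathcal{SH}_L^{\mathrm{poly}}(D_\theta)$ the left $H^\infty$-functional calculus is $f(T):=e(T)^{-1}(ef)(T)$; for $f\in\mathcal{SH}_R^{\mathrm{poly}}(D_\theta)$ the right $H^\infty$-functional calculus is $f(T):=\overline{(fe)(T)e(T)^{-1}}$ (closure in the sense of multivalued operators). Here $e(s)=\frac{s^m}{(1+s^2)^m}\in\mathcal{N}^0(D_\theta)$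 with $m\in\mathbb{N}$, $m>\alpha$, where $\alpha$ is the exponent in the growth bound of $f$; $e(T)$, $(ef)(T)$, $(fe)(T)$ are defined by the $\omega$-functional calculus, and $e(T)=T^m(1+T^2)^{-m}$ is injective. The result does not depend on $m$. *)

(* Defs.v *)
From HB Require Import structures.
From mathcomp Require Import all_boot all_order all_algebra.
From mathcomp Require Import ring.
From mathcomp Require Import all_classical all_reals all_analysis.
From mathcomp Require Import measurable_realfun.

Set Implicit Arguments.
Unset Strict Implicit.
Unset Printing Implicit Defensive.

Import Order.TTheory GRing.Theory Num.Theory.
Import numFieldNormedType.Exports.

Local Open Scope classical_set_scope.
Local Open Scope ring_scope.

(** * The Clifford algebra R_d *)

Section clifford_sign.
Variable d : nat.
Implicit Types A B C : {set 'I_d}.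

Definition symdiff A B : {set 'I_d} := (A :\: B) :|: (B :\: A).

Lemma in_symdiff A B i : (i \in symdiff A B) = (i \in A) (+) (i \in B).
Proof. by rewrite !inE; case: (i \in A); case: (i \in B). Qed.

Lemma symdiffC : commutative symdiff.
Proof. by move=> A B; apply/setP => i; rewrite !in_symdiff addbC. Qed.

Lemma symdiffA : associative symdiff.
Proof. by move=> A B C; apply/setP => i; rewrite !in_symdiff addbA. Qed.

Lemma symdiffK A : cancel (symdiff A) (symdiff A).
Proof.
by move=> B; apply/setP => i; rewrite !in_symdiff addbA addbb.
Qed.

Lemma symdiff0 A : symdiff A finset.set0 = A.
Proof. by apply/setP => i; rewrite in_symdiff inE addbF. Qed.

Lemma symdiff_eq A B C : (symdiff A B == C) = (B == symdiff A C).
Proof. by apply/eqP/eqP => [<-|->]; rewrite symdiffK. Qed.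

(* [e_A e_B = csgn A B *: e_(symdiff A B)]: moving e_i (i in A) past e_j (j in B)
   costs a factor -1 when j < i, and e_i e_i = -1 when j = i. *)
Definition csgn (R : pzRingType) A B : R :=
  \prod_(i in A) \prod_(j in B | (j <= i)%N) -1.

Variable R : comPzRingType.

Let prod_symdiff (g : 'I_d -> R) A B : (forall i, g i * g i = 1) ->
  \prod_(i in symdiff A B) g i = \prod_(i in A) g i * \prod_(i in B) g i.
Proof.
move=> g2; rewrite big_mkcond [X in X * _]big_mkcond [X in _ * X]big_mkcond.
rewrite -big_split; apply: eq_bigr => i _ /=; rewrite in_symdiff.
by case: (i \in A); case: (i \in B); rewrite /= ?mulr1 ?mul1r ?g2.
Qed.

Lemma csgnDl A B C : csgn R (symdiff A B) C = csgn R A C * csgn R B C.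
Proof.
apply: prod_symdiff => i; rewrite -big_split /=.
by apply: big1 => j _; rewrite mulrNN mulr1.
Qed.

Lemma csgnDr A B C : csgn R A (symdiff B C) = csgn R A B * csgn R A C.
Proof.
rewrite /csgn -big_split; apply: eq_bigr => i _ /=.
rewrite 3![\prod_(_ in _ | _) _]big_mkcondr; apply: prod_symdiff => j.
by case: ifP; rewrite ?mulrNN mulr1.
Qed.

Lemma csgn0l A : csgn R finset.set0 A = 1.
Proof. by rewrite /csgn big_set0. Qed.

Lemma csgn0r A : csgn R A finset.set0 = 1.
Proof. by apply: big1 => i _; apply: big1 => j; rewrite inE. Qed.

End clifford_sign.

(* s : clifford R d is the family of its coordinates on the basis e_A; the sets A
   stand for increasing tuples of indices, see [basis_elt_cons]. *)
Definition clifford (R : realType) (d : nat) : Type := {ffun {set 'I_d} -> R}.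

Section clifford_ring.
Context {R : realType} {d : nat}.
Local Notation cliff := (clifford R d).
Implicit Types s t u : cliff.

HB.instance Definition _ := GRing.Lmodule.copy cliff {ffun {set 'I_d} -> R}.

Definition coef (s : cliff) (A : {set 'I_d}) : R :=
  (s : {ffun {set 'I_d} -> R}) A.

Definition cmul s t : cliff := [ffun C =>
  \sum_A \sum_(B | symdiff A B == C) csgn R A B * coef s A * coef t B].

Definition cone : cliff := [ffun A => (A == finset.set0)%:R].

Lemma coefP s t : (forall A, coef s A = coef t A) -> s = t.
Proof. by move=> st; apply/ffunP. Qed.

Lemma coefD s t A : coef (s + t) A = coef s A + coef t A.
Proof. exact: ffunE. Qed.

Lemma coefN s A : coef (- s) A = - coef s A.
Proof. exact: ffunE. Qed.

Lemma coef0 A : coef 0 A = 0.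
Proof. exact: ffunE. Qed.

Lemma coefZ (k : R) s A : coef (k *: s) A = k * coef s A.
Proof. exact: ffunE. Qed.

Lemma coef_cmul s t C : coef (cmul s t) C =
  \sum_A csgn R A (symdiff A C) * coef s A * coef t (symdiff A C).
Proof.
rewrite /coef ffunE; apply: eq_bigr => A _.
by rewrite (eq_bigl _ _ (fun B => symdiff_eq A B C)) big_pred1_eq.
Qed.

Let cmulA : associative cmul.
Proof.
move=> s t u; apply: coefP => D; rewrite !coef_cmul.
under eq_bigr => A _ do rewrite coef_cmul mulr_sumr.
under [RHS]eq_bigr => C _ do rewrite coef_cmul mulr_sumr mulr_suml.
rewrite [RHS]exchange_big /=; apply: eq_bigr => A _.
rewrite [RHS](reindex_inj (can_inj (symdiffK A))) /=.
apply: eq_bigr => B _; rewrite symdiffK.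
have -> : symdiff (symdiff A B) D = symdiff B (symdiff A D).
  by rewrite [symdiff A B]symdiffC symdiffA.
set E := symdiff B _.
have -> : symdiff A D = symdiff B E by rewrite /E symdiffK.
rewrite csgnDl csgnDr; ring.
Qed.

Let coef_cone A : coef cone A = (A == finset.set0)%:R.
Proof. exact: ffunE. Qed.

Let cmul1r : left_id cone cmul.
Proof.
move=> s; apply: coefP => C; rewrite coef_cmul (bigD1 finset.set0) //= big1.
  by rewrite addr0 coef_cone eqxx csgn0l symdiffC symdiff0 !mul1r.
by move=> A /negbTE A0; rewrite coef_cone A0 mulr0 mul0r.
Qed.

Let cmulr1 : right_id cone cmul.
Proof.
move=> s; apply: coefP => C; rewrite coef_cmul (bigD1 C) //= big1.
  have -> : symdiff C C = finset.set0.
    by apply/setP => i; rewrite in_symdiff addbb inE.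
  by rewrite addr0 coef_cone eqxx csgn0r mulr1 mul1r.
move=> A neqAC; rewrite coef_cone symdiff_eq symdiff0 eq_sym (negbTE neqAC).
by rewrite mulr0.
Qed.

Let cmulDl : left_distributive cmul +%R.
Proof.
move=> s t u; apply: coefP => C; rewrite coefD !coef_cmul -big_split.
by apply: eq_bigr => A _; rewrite coefD mulrDr mulrDl.
Qed.

Let cmulDr : right_distributive cmul +%R.
Proof.
move=> s t u; apply: coefP => C; rewrite coefD !coef_cmul -big_split.
by apply: eq_bigr => A _; rewrite coefD mulrDr.
Qed.

Let cone_neq0 : cone != 0.
Proof.
by apply/eqP => /ffunP /(_ finset.set0) /eqP; rewrite !ffunE eqxx oner_eq0.
Qed.

HB.instance Definition _ := GRing.Zmodule_isNzRing.Build cliff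
  cmulA cmul1r cmulr1 cmulDl cmulDr cone_neq0.

Lemma coefM s t C : coef (s * t) C =
  \sum_A csgn R A (symdiff A C) * coef s A * coef t (symdiff A C).
Proof. exact: coef_cmul. Qed.

Let cscaleAl (k : R) s t : k *: (s * t) = (k *: s) * t.
Proof.
apply: coefP => C; rewrite coefZ !coefM mulr_sumr; apply: eq_bigr => A _.
by rewrite coefZ !mulrA [k * _]mulrC.
Qed.

HB.instance Definition _ := GRing.Lmodule_isLalgebra.Build R cliff cscaleAl.

Let cscaleAr (k : R) s t : k *: (s * t) = s * (k *: t).
Proof.
apply: coefP => C; rewrite coefZ !coefM mulr_sumr; apply: eq_bigr => A _.
by rewrite coefZ mulrCA.
Qed.

HB.instance Definition _ := GRing.Lalgebra_isAlgebra.Build R cliff cscaleAr.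

Definition basis_elt (A : {set 'I_d}) : cliff := [ffun B => (B == A)%:R].

Lemma coef_basis A B : coef (basis_elt A) B = (B == A)%:R.
Proof. exact: ffunE. Qed.

Lemma basis_eltM A B :
  basis_elt A * basis_elt B = csgn R A B *: basis_elt (symdiff A B).
Proof.
apply: coefP => C; rewrite coefM coefZ coef_basis (bigD1 A) //= big1 => [|A' A'A].
  rewrite addr0 !coef_basis eqxx mulr1 [_ == B]eq_sym -symdiff_eq [_ == C]eq_sym.
  by case: eqP => [->|]; rewrite ?symdiffK ?mulr0.
by rewrite coef_basis (negbTE A'A) mulr0 mul0r.
Qed.

Lemma basis_elt0 : basis_elt finset.set0 = 1.
Proof. by []. Qed.

Lemma generator_sqr i : basis_elt [set i] * basis_elt [set i] = -1.
Proof.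
rewrite basis_eltM.
have -> : symdiff [set i] [set i] = finset.set0.
  by apply/setP => j; rewrite in_symdiff addbb inE.
by rewrite basis_elt0 /csgn big_set1 big_mkcondr big_set1 leqnn scaleN1r.
Qed.

Lemma generator_anticomm i j : i != j ->
  basis_elt [set i] * basis_elt [set j] = - (basis_elt [set j] * basis_elt [set i]).
Proof.
move=> ij; rewrite !basis_eltM symdiffC -scaleNr; congr (_ *: _).
have E k l : csgn R [set k] [set l] = (-1) ^+ (l <= k)%N :> R.
  rewrite /csgn big_set1 big_mkcondr big_set1.
  by case: leqP => _; rewrite ?expr1 ?expr0.
rewrite !E; have := ij; rewrite -(inj_eq val_inj) /= neq_ltn.
by case: ltngtP => // _ _; rewrite expr0 expr1 ?opprK.
Qed.

Lemma basis_elt_cons (i : 'I_d) (A : {set 'I_d}) : (forall j, j \in A -> (i < j)%N) ->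
  basis_elt [set i] * basis_elt A = basis_elt (i |: A).
Proof.
move=> iA; rewrite basis_eltM /csgn big_set1 big1 => [|j /andP[/iA ij]].
  rewrite scale1r; congr basis_elt; apply/setP => j; rewrite in_symdiff !inE.
  by case: eqVneq => //= ->; apply/negP => /iA; rewrite ltnn.
by rewrite leqNgt ij.
Qed.

End clifford_ring.

Section clifford_norm.
Context {R : realType} {d : nat}.
Local Notation cliff := (clifford R d).
Implicit Types s t : cliff.

Definition cnorm s : R := Num.sqrt (\sum_A coef s A ^+ 2).

Let sum_sqr_ge0 s : 0 <= \sum_A coef s A ^+ 2.
Proof. by apply: sumr_ge0 => A _; exact: sqr_ge0. Qed.

Let cauchy_schwarz s t :
  \sum_A coef s A * coef t A <= cnorm s * cnorm t.
Proof.
rewrite /cnorm -sqrtrM ?sum_sqr_ge0//.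
apply: (le_trans (ler_norm _)); rewrite -sqrtr_sqr ler_sqrt; last first.
  by rewrite mulr_ge0 ?sum_sqr_ge0.
rewrite -(ler_pM2l (ltr0n R 2)) -subr_ge0.
have -> : 2 * ((\sum_A coef s A ^+ 2) * (\sum_A coef t A ^+ 2))
   - 2 * (\sum_A coef s A * coef t A) ^+ 2
   = \sum_A \sum_B (coef s A * coef t B - coef s B * coef t A) ^+ 2.
  transitivity (\sum_A \sum_B (coef s A ^+ 2 * coef t B ^+ 2
      + coef t A ^+ 2 * coef s B ^+ 2
      - 2 * (coef s A * coef t A) * (coef s B * coef t B))).
    under [RHS]eq_bigr => A _ do
      rewrite sumrB big_split /= -!mulr_sumr.
    rewrite sumrB big_split /= -!mulr_suml -mulr_sumr; ring.
  by apply: eq_bigr => A _; apply: eq_bigr => B _; ring.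
by apply: sumr_ge0 => A _; apply: sumr_ge0 => B _; exact: sqr_ge0.
Qed.

Let cnorm_sqr s : cnorm s ^+ 2 = \sum_A coef s A ^+ 2.
Proof. by rewrite /cnorm sqr_sqrtr ?sum_sqr_ge0. Qed.

Let cnormD s t : cnorm (s + t) <= cnorm s + cnorm t.
Proof.
have n0 u : 0 <= cnorm u by exact: sqrtr_ge0.
rewrite -(@ler_pXn2r _ 2) ?nnegrE ?addr_ge0// sqrrD !cnorm_sqr.
under eq_bigr => A _ do rewrite coefD sqrrD.
rewrite big_split big_split /= lerD2r lerD2l sumrMnl.
by rewrite lerMn2r cauchy_schwarz orbT.
Qed.

Let cnormZ (k : R) s : cnorm (k *: s) = `|k| * cnorm s.
Proof.
rewrite /cnorm -sqrtr_sqr -sqrtrM ?sqr_ge0// mulr_sumr; congr Num.sqrt.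
by apply: eq_bigr => A _; rewrite coefZ exprMn.
Qed.

Let cnorm0_eq0 s : cnorm s = 0 -> s = 0.
Proof.
move=> s0; have : \sum_A coef s A ^+ 2 = 0 by rewrite -cnorm_sqr s0 expr0n.
move=> /psumr_eq0P sA; apply: coefP => A; rewrite coef0; apply/eqP.
by rewrite -sqrf_eq0; apply/eqP/sA => // B _; exact: sqr_ge0.
Qed.

HB.instance Definition _ :=
  Lmodule_isNormed.Build R cliff cnormD cnormZ cnorm0_eq0.

Lemma cnormE s : `|s| = Num.sqrt (\sum_A coef s A ^+ 2).
Proof. by []. Qed.

Lemma coef_le_norm s A : `|coef s A| <= `|s|.
Proof.
rewrite cnormE -sqrtr_sqr ler_wsqrtr// (bigD1 A)//= lerDl.
by apply: sumr_ge0 => B _; exact: sqr_ge0.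
Qed.

Lemma norm_le_sum s : `|s| <= \sum_A `|coef s A|.
Proof.
have s0 : 0 <= \sum_A `|coef s A| by exact: sumr_ge0.
rewrite -(@ler_pXn2r _ 2) ?nnegrE// cnorm_sqr.
rewrite [leRHS]expr2 mulr_suml; apply: ler_sum => A _.
rewrite -real_normK ?num_real// expr2 ler_wpM2l// (bigD1 A)//= lerDl.
by apply: sumr_ge0.
Qed.

Definition mul_bound s : R := (#|{set 'I_d}|%:R) * \sum_A `|coef s A|.

Lemma norm_csgn (A B : {set 'I_d}) : `|csgn R A B| = 1.
Proof.
rewrite /csgn normr_prod big1// => i _; rewrite normr_prod big1// => j _.
by rewrite normrN1.
Qed.

Lemma norm_mull s t : `|s * t| <= mul_bound s * `|t|.
Proof.
apply: (le_trans (norm_le_sum _)); rewrite /mul_bound -mulrA mulr_natl -sumr_const.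
apply: ler_sum => C _; rewrite coefM mulr_suml; apply: (le_trans (ler_norm_sum _ _ _)).
apply: ler_sum => A _; rewrite !normrM norm_csgn mul1r.
by rewrite ler_wpM2l// coef_le_norm.
Qed.

Lemma norm_mulr s t : `|s * t| <= mul_bound t * `|s|.
Proof.
apply: (le_trans (norm_le_sum _)); rewrite /mul_bound -mulrA mulr_natl -sumr_const.
apply: ler_sum => C _; rewrite coefM mulr_suml; apply: (le_trans (ler_norm_sum _ _ _)).
rewrite [leRHS](reindex_inj (can_inj (symdiffK C))) /=.
apply: ler_sum => A _; rewrite !normrM norm_csgn mul1r symdiffC mulrC.
by rewrite ler_wpM2l// coef_le_norm.
Qed.

End clifford_norm.

(** * Paravectors and slice hyperholomorphic functions *)

Section paravectors.
Context {R : realType} {d : nat}.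
Local Notation cliff := (clifford R d).
Implicit Types (s J : cliff) (omega theta phi : R).

Definition conjc s : cliff :=
  [ffun A : {set 'I_d} => (-1) ^+ (#|A| * #|A|.+1)./2 * coef s A].

(* R^{d+1} inside R_d; all sets of paravectors below are sets of Clifford
   numbers contained in this one. *)
Definition paravector : set cliff :=
  [set s | forall A : {set 'I_d}, (1 < #|A|)%N -> coef s A = 0].

Definition real_part s : R := coef s finset.set0.

(* The multiplicative inverse of a nonzero paravector. *)
Definition pinv s : cliff := `|s| ^- 2 *: conjc s.

Definition unit_sphere : set cliff :=
  [set J | [/\ paravector J, real_part J = 0 & `|J| = 1]].

Definition expc J phi : cliff := (cos phi)%:A + sin phi *: J.

Definition arg s : R := acos (real_part s / `|s|).

Definition double_sector omega : set cliff :=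
  [set s | [/\ paravector s, s != 0 &
     - omega < arg s < omega \/ pi - omega < arg s < pi + omega]].

(* [slice_dom U] is the set of all (x, y) with x + S y contained in U. *)
Definition slice_dom (U : set cliff) : set (R * R) :=
  [set p | forall J, unit_sphere J -> U (p.1%:A + p.2 *: J)].

Local Notation dx g := ('D_((1, 0) : R * R) g).
Local Notation dy g := ('D_((0, 1) : R * R) g).

(* Continuous differentiability on an open set D of the plane, by existence and
   continuity of both partial derivatives. *)
Definition C1_on (D : set (R * R)) (g : R * R -> cliff) : Prop :=
  forall p, D p ->
    [/\ derivable g p (1, 0), derivable g p (0, 1),
        {for p, continuous (dx g)} & {for p, continuous (dy g)}].

Definition slice_pair (D : set (R * R)) (f0 f1 : R * R -> cliff) : Prop :=
  [/\ C1_on D f0, C1_on D f1 &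
   forall p, D p ->
     [/\ f0 (p.1, - p.2) = f0 p, f1 (p.1, - p.2) = - f1 p,
         dx f0 p = dy f1 p & dy f0 p = - dx f1 p]].

(* Functions on U are represented by total functions, whose values outside U
   play no role. *)
Definition SHL (U : set cliff) (f : cliff -> cliff) : Prop :=
  exists f0 f1, slice_pair (slice_dom U) f0 f1 /\
    forall p J, slice_dom U p -> unit_sphere J ->
      f (p.1%:A + p.2 *: J) = f0 p + J * f1 p.

Definition SHR (U : set cliff) (f : cliff -> cliff) : Prop :=
  exists f0 f1, slice_pair (slice_dom U) f0 f1 /\
    forall p J, slice_dom U p -> unit_sphere J ->
      f (p.1%:A + p.2 *: J) = f0 p + f1 p * J.

Definition poly_growth theta (alpha : R) (f : cliff -> cliff) : Prop :=
  exists2 C : R, 0 <= C & forall s, double_sector theta s ->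
    `|f s| <= C * (`|s| `^ alpha + `|s| `^ (- alpha)).

Definition SHL_poly theta (f : cliff -> cliff) : Prop :=
  SHL (double_sector theta) f /\
  exists2 alpha : R, 0 <= alpha & poly_growth theta alpha f.

Definition SHR_poly theta (f : cliff -> cliff) : Prop :=
  SHR (double_sector theta) f /\
  exists2 alpha : R, 0 <= alpha & poly_growth theta alpha f.

(* m > alpha for some admissible exponent alpha in the growth bound of f *)
Definition regularizing theta (f : cliff -> cliff) (m : nat) : Prop :=
  exists alpha : R, [/\ 0 <= alpha, poly_growth theta alpha f & alpha < m%:R].

(* e(s) = s^m / (1 + s^2)^m *)
Definition regularizer (m : nat) s : cliff := s ^+ m * pinv (1 + s ^+ 2) ^+ m.

End paravectors.

(** * The Hilbert module L^2(X) of R_d-valued functions *)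

Section L2.
Context {R : realType} {d : nat} {disp : measure_display}
  {X : measurableType disp} (mu : {measure set X -> \bar R}).
Local Notation cliff := (clifford R d).

Definition cmeasurable (u : X -> cliff) : Prop :=
  forall A, measurable_fun setT (fun x => coef (u x) A).

Definition sq_integral (u : X -> cliff) : \bar R :=
  (\int[mu]_x (`|u x| ^+ 2)%:E)%E.

Definition sq_integrable : {pred X -> cliff} :=
  fun u => `[< cmeasurable u /\ (sq_integral u < +oo)%E >].

Lemma sq_integral_ge0 u : (0 <= sq_integral u)%E.
Proof. by apply: integral_ge0 => x _; rewrite lee_fin. Qed.

Lemma cmeasurable_norm u : cmeasurable u -> measurable_fun setT (fun x => `|u x|).
Proof.
move=> mu_; apply: (@measurableT_comp _ _ _ _ _ _ (@Num.sqrt R)).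
  exact: continuous_measurable_fun (@sqrt_continuous R).
apply: measurable_sum => A; apply: measurable_funX; exact: mu_.
Qed.

Lemma cmeasurable_cst s : cmeasurable (fun=> s).
Proof. by move=> A; exact: measurable_cst. Qed.

Lemma cmeasurableD u v : cmeasurable u -> cmeasurable v ->
  cmeasurable (u + v).
Proof.
move=> mu_ mv A; rewrite (_ : (fun _ => _) = (coef ^~ A \o u) \+ (coef ^~ A \o v)).
  by apply: measurable_funD; [exact: mu_|exact: mv].
by apply/funext => x /=; rewrite -coefD.
Qed.

Lemma cmeasurableM u v : cmeasurable u -> cmeasurable v ->
  cmeasurable (fun x => u x * v x).
Proof.
move=> mu_ mv A; under eq_fun do rewrite coefM.
apply: measurable_sum => B; apply: measurable_funM; last exact: mv.
by apply: measurable_funM => //; exact: mu_.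
Qed.

Lemma measurable_sqnorm u : cmeasurable u ->
  measurable_fun setT (fun x => (`|u x| ^+ 2)%:E).
Proof.
by move=> mu_; apply/measurable_EFinP/measurable_funX/cmeasurable_norm.
Qed.

Lemma sq_integrable_dominated (c : R) u v : cmeasurable v ->
  (forall x, `|v x| <= c * `|u x|) -> u \in sq_integrable ->
  v \in sq_integrable.
Proof.
move=> mv vu /asboolP[mu_ ufin]; apply/asboolP; split => //.
apply: (@le_lt_trans _ _ (\int[mu]_x ((c ^+ 2)%:E * (`|u x| ^+ 2)%:E))%E).
  apply: ge0_le_integral => //.
  - exact/measurable_sqnorm.
  - by apply/measurable_funeM/measurable_sqnorm.
  - move=> x _; rewrite -EFinM lee_fin -exprMn ler_pXn2r ?nnegrE//.
    by apply: le_trans (vu x).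
rewrite ge0_integralZl_EFin ?sqr_ge0//; last exact/measurable_sqnorm.
  by rewrite lte_mul_pinfty// lee_fin sqr_ge0.
Qed.

Lemma sq_integrableD u v : u \in sq_integrable -> v \in sq_integrable ->
  u + v \in sq_integrable.
Proof.
move=> /asboolP[mu_ ufin] /asboolP[mv vfin]; apply/asboolP; split.
  exact: cmeasurableD.
apply: (@le_lt_trans _ _
    (\int[mu]_x (2%:E * ((`|u x| ^+ 2)%:E + (`|v x| ^+ 2)%:E)))%E).
  apply: ge0_le_integral => //.
  - exact/measurable_sqnorm/cmeasurableD.
  - by apply/measurable_funeM/emeasurable_funD; exact/measurable_sqnorm.
  - move=> x _; rewrite -EFinD -EFinM lee_fin.
    apply: (@le_trans _ _ ((`|u x| + `|v x|) ^+ 2)).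
      by rewrite ler_pXn2r ?nnegrE ?addr_ge0// ler_normD.
    rewrite -subr_ge0.
    have -> : 2 * (`|u x| ^+ 2 + `|v x| ^+ 2) - (`|u x| + `|v x|) ^+ 2
      = (`|u x| - `|v x|) ^+ 2 by ring.
    exact: sqr_ge0.
have mus := measurable_sqnorm mu_; have mvs := measurable_sqnorm mv.
rewrite ge0_integralZl_EFin//; last 2 first.
  - by move=> x _; rewrite -EFinD lee_fin addr_ge0.
  - exact/emeasurable_funD.
rewrite ge0_integralD//; try by move=> x _; rewrite lee_fin.
by rewrite lte_mul_pinfty// lte_add_pinfty.
Qed.

Let sq_integrable_submod : submod_closed sq_integrable.
Proof.
split=> [|a u v uL vL].
  apply/asboolP; split; first exact: cmeasurable_cst.
  by rewrite /sq_integral; under eq_integral do rewrite normr0 expr0n; rewrite integral0.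
apply: sq_integrableD => //; apply: (@sq_integrable_dominated `|a| u) => //.
  move=> A; rewrite (_ : (fun _ => _) = (fun x => a * coef (u x) A)).
    by apply: measurable_funM => //; move: uL => /asboolP[+ _]; exact.
  by apply/funext => x; rewrite -coefZ.
by move=> x; rewrite [(a *: u) x]/(a *: u x) normrZ.
Qed.

HB.instance Definition _ := GRing.isSubmodClosed.Build R (X -> cliff)
  sq_integrable sq_integrable_submod.

Record L2fun := mkL2fun { L2fun_val :> X -> cliff; _ : L2fun_val \in sq_integrable }.

HB.instance Definition _ := [isSub for L2fun_val].
HB.instance Definition _ := [Choice of L2fun by <:].
HB.instance Definition _ := [SubChoice_isSubLmodule of L2fun by <:].

Definition ae_zero : {pred L2fun} := fun u => `[< {ae mu, forall x, u x = 0} >].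

Let ae_zero_zmod : zmod_closed ae_zero.
Proof.
split=> [|u v /asboolP u0 /asboolP v0]; apply/asboolP.
  by apply: filterE => x.
apply: filterS2 u0 v0 => x u0 v0.
by transitivity (u x - v x); rewrite // u0 v0 subr0.
Qed.

HB.instance Definition _ := GRing.isZmodClosed.Build L2fun ae_zero ae_zero_zmod.

Definition L2 : Type := Quotient.quot ae_zero.

HB.instance Definition _ := GRing.Zmodule.on L2.
HB.instance Definition _ := EqQuotient.on L2.

Local Open Scope quotient_scope.

Definition classL2 (u : L2fun) : L2 := \pi_L2 u.

Definition reprL2 (u : L2) : X -> cliff := repr u.

Lemma classL2P (u v : L2fun) :
  classL2 u = classL2 v <-> {ae mu, forall x, u x = v x}.
Proof.
split=> [/eqP|uv].
  rewrite /classL2 eqmodE => /asboolP; apply: filterS => x uv0.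
  by apply/eqP; rewrite -subr_eq0; apply/eqP.
apply/eqP; rewrite /classL2 eqmodE; apply/asboolP; apply: filterS uv => x uv.
by transitivity (u x - v x); rewrite // uv subrr.
Qed.

Lemma reprL2K (u : L2fun) : {ae mu, forall x, reprL2 (classL2 u) x = u x}.
Proof. by apply/classL2P; rewrite /classL2 reprK. Qed.

Lemma L2P (u v : L2) :
  {ae mu, forall x, reprL2 u x = reprL2 v x} -> u = v.
Proof. by move=> uv; rewrite -[u]reprK -[v]reprK; apply/classL2P. Qed.

Let mull_subproof s (u : L2fun) : (fun x => s * u x) \in sq_integrable.
Proof.
apply: (@sq_integrable_dominated (mul_bound s) u); last by case: u.
  apply: cmeasurableM; first exact: cmeasurable_cst.
  by case: u => u /= /asboolP[].
by move=> x; exact: norm_mull.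
Qed.

Let mulr_subproof s (u : L2fun) : (fun x => u x * s) \in sq_integrable.
Proof.
apply: (@sq_integrable_dominated (mul_bound s) u); last by case: u.
  apply: cmeasurableM; last exact: cmeasurable_cst.
  by case: u => u /= /asboolP[].
by move=> x; exact: norm_mulr.
Qed.

Definition lmulL2 s (u : L2) : L2 := classL2 (mkL2fun (mull_subproof s (repr u))).
Definition rmulL2 (u : L2) s : L2 := classL2 (mkL2fun (mulr_subproof s (repr u))).

Lemma lmulL2E s u : {ae mu, forall x, reprL2 (lmulL2 s u) x = s * reprL2 u x}.
Proof. exact: reprL2K. Qed.

Lemma rmulL2E s u : {ae mu, forall x, reprL2 (rmulL2 u s) x = reprL2 u x * s}.
Proof. exact: reprL2K. Qed.

Lemma reprL2D u v :
  {ae mu, forall x, reprL2 (u + v) x = reprL2 u x + reprL2 v x}.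
Proof.
have -> : u + v = classL2 (repr u + repr v).
  by rewrite -[in LHS](reprK u) -[in LHS](reprK v) /classL2 piE.
exact: reprL2K.
Qed.

Definition scaleL2 (k : R) (u : L2) : L2 := lmulL2 k%:A u.

Lemma scaleL2E (k : R) u :
  {ae mu, forall x, reprL2 (scaleL2 k u) x = k *: reprL2 u x}.
Proof.
by apply: filterS (lmulL2E k%:A u) => x ->; rewrite -scalerAl mul1r.
Qed.

Let scaleL2A a b u : scaleL2 a (scaleL2 b u) = scaleL2 (a * b) u.
Proof.
apply: L2P; apply: filterS3 (scaleL2E a (scaleL2 b u)) (scaleL2E b u)
  (scaleL2E (a * b) u) => x -> -> ->.
by rewrite scalerA.
Qed.

Let scale1L2 : left_id 1 scaleL2.
Proof.
by move=> u; apply: L2P; apply: filterS (scaleL2E 1 u) => x ->; rewrite scale1r.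
Qed.

Let scaleL2Dr : right_distributive scaleL2 +%R.
Proof.
move=> a u v; apply: L2P.
apply: filterS3 (reprL2D u v) (reprL2D (scaleL2 a u) (scaleL2 a v))
  (filterI (scaleL2E a (u + v)) (filterI (scaleL2E a u) (scaleL2E a v))).
by move=> x uv -> [-> [-> ->]]; rewrite uv scalerDr.
Qed.

Let scaleL2Dl u : {morph scaleL2^~ u : a b / a + b}.
Proof.
move=> a b; apply: L2P.
apply: filterS2 (reprL2D (scaleL2 a u) (scaleL2 b u))
  (filterI (scaleL2E (a + b) u) (filterI (scaleL2E a u) (scaleL2E b u))).
by move=> x -> [-> [-> ->]]; rewrite scalerDl.
Qed.

HB.instance Definition _ := GRing.Zmodule_isLmodule.Build R L2
  scaleL2A scale1L2 scaleL2Dr scaleL2Dl.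

Definition normL2 (u : L2) : R := Num.sqrt (fine (sq_integral (reprL2 u))).

Let cmeasurable_reprL2 (u : L2) : cmeasurable (reprL2 u).
Proof. by rewrite /reprL2; case: (repr u) => v /= /asboolP[]. Qed.

Let sq_integral_fin (u : L2) : sq_integral (reprL2 u) \is a fin_num.
Proof.
rewrite ge0_fin_numE ?sq_integral_ge0//.
by rewrite /reprL2; case: (repr u) => v /= /asboolP[].
Qed.

Let normL2E (u : L2) :
  (normL2 u)%:E = ('N[mu]_2%:E[EFin \o (fun x => `|reprL2 u x|)%R])%E.
Proof.
rewrite unlock (_ : (\int[mu]_x _)%E = sq_integral (reprL2 u)); last first.
  apply: eq_integral => x _ /=.
  by rewrite normr_id powR_mulrn.
rewrite -(fineK (sq_integral_fin u)) poweR_EFin powR12_sqrt//.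
exact/fine_ge0/sq_integral_ge0.
Qed.

Let normL2_ae (u : L2) (g : X -> R) : measurable_fun setT g ->
  {ae mu, forall x, `|reprL2 u x| ^+ 2 = g x} ->
  (sq_integral (reprL2 u) = \int[mu]_x (g x)%:E)%E.
Proof.
move=> mg ug; apply: ae_eq_integral => //.
- exact/measurable_sqnorm/cmeasurable_reprL2.
- exact/measurable_EFinP.
- by apply: filterS ug => x /= -> _.
Qed.

Let normL2D u v : normL2 (u + v) <= normL2 u + normL2 v.
Proof.
have mn w := cmeasurable_norm (cmeasurable_reprL2 w).
rewrite -lee_fin EFinD !normL2E.
apply: (le_trans _ (minkowski_EFin _ (mn u) (mn v) _)); last by rewrite ler1n.
rewrite unlock.
apply: gt0_ler_poweR; rewrite ?invr_ge0// ?in_itv/= ?leey ?andbT//.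
- by apply: integral_ge0 => x _; rewrite lee_fin powR_ge0.
- by apply: integral_ge0 => x _; rewrite lee_fin powR_ge0.
have mpow (f : X -> R) : measurable_fun setT f ->
    measurable_fun setT (fun x => (`|f x| `^ 2)%:E).
  move=> mf; apply/measurable_EFinP/(@measurableT_comp _ _ _ _ _ _ (@powR R ^~ 2)).
    exact: measurable_powR.
  exact: measurableT_comp.
apply: ae_ge0_le_integral; first exact: measurableT.
- by move=> x _; rewrite lee_fin powR_ge0.
- exact: (mpow _ (mn (u + v))).
- by move=> x _; rewrite lee_fin powR_ge0.
- exact: (mpow _ (measurable_funD (mn u) (mn v))).
apply: filterS (reprL2D u v) => x /= -> _.
rewrite lee_fin normr_id.
rewrite [leRHS in _ <= leRHS `^ _]ger0_norm ?addr_ge0//.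
by rewrite ge0_ler_powR ?nnegrE ?addr_ge0// ler_normD.
Qed.

Let normL2Z a u : normL2 (a *: u) = `|a| * normL2 u.
Proof.
rewrite /normL2 -sqrtr_sqr -sqrtrM ?sqr_ge0//; congr Num.sqrt.
rewrite (@normL2_ae _ (fun x => a ^+ 2 * `|reprL2 u x| ^+ 2)).
- under eq_integral do rewrite EFinM.
  rewrite ge0_integralZl_EFin ?sqr_ge0 ?fineM//.
  + exact: sq_integral_fin.
  + exact/measurable_sqnorm/cmeasurable_reprL2.
- apply: measurable_funM => //.
  exact/measurable_funX/cmeasurable_norm/cmeasurable_reprL2.
- apply: filterS (scaleL2E a u) => x ->.
  by rewrite normrZ exprMn real_normK ?num_real.
Qed.

Let normL2_eq0 u : normL2 u = 0 -> u = 0.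
Proof.
move=> u0; apply: L2P.
have : sq_integral (reprL2 u) = 0%E.
  rewrite -(fineK (sq_integral_fin u)); congr EFin; apply/eqP.
  rewrite eq_le fine_ge0 ?sq_integral_ge0// andbT.
  by rewrite -sqrtr_eq0; apply/eqP.
rewrite /sq_integral.
have z : {ae mu, forall x, reprL2 (0 : L2) x = 0}.
  have -> : (0 : L2) = classL2 0 by rewrite /classL2 piE.
  exact: reprL2K.
have {}u0 := proj1 (ae_eq_integral_abs _ measurableT
  (measurable_sqnorm (cmeasurable_reprL2 u))).
move=> ui; have {}/u0 : (\int[mu]_x `|(`|reprL2 u x| ^+ 2)%:E| = 0)%E.
  by rewrite -ui; apply: eq_integral => x _; rewrite gee0_abs// lee_fin.
apply: filterS2 z => x -> /(_ I) [/eqP].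
by rewrite sqrf_eq0 normr_eq0 => /eqP.
Qed.

HB.instance Definition _ := Lmodule_isNormed.Build R L2 normL2D normL2Z normL2_eq0.

End L2.

Arguments L2 {R} d {disp X} mu.

(** * Operators on L^2(X) as graphs *)

Section operators.
Context {R : realType} {d : nat} {disp : measure_display}
  {X : measurableType disp} {mu : {measure set X -> \bar R}}.
Local Notation cliff := (clifford R d).
Local Notation V := (L2 d mu).

(* An operator, possibly unbounded or multivalued, is identified with its graph. *)
Definition operator : Type := set (V * V).

Implicit Types (S T A B : operator) (F : R -> operator).

Definition op_add S T : operator :=
  [set p | exists v w, [/\ S (p.1, v), T (p.1, w) & p.2 = v + w]].

Definition op_comp S T : operator :=
  [set p | exists2 v, T (p.1, v) & S (v, p.2)].

Definition op_inv T : operator := [set p | T (p.2, p.1)].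

(* A Clifford number, seen as the operator of left multiplication by it; then
   [s T] is [op_comp (op_cliff s) T] and [T s] is [op_comp T (op_cliff s)]. *)
Definition op_cliff (s : cliff) : operator := [set p | p.2 = lmulL2 s p.1].

Definition op_scale (c : R) T : operator := op_comp (op_cliff c%:A) T.

Definition op_sub S T : operator := op_add S (op_scale (-1) T).

Definition right_linear T : Prop :=
  [/\ T (0, 0),
      forall u v u' v', T (u, v) -> T (u', v') -> T (u + u', v + v') &
      forall u v s, T (u, v) -> T (rmulL2 u s, rmulL2 v s)].

(* The operator norm of T is at most c. *)
Definition opnorm_le T (c : R) : Prop := forall u v, T (u, v) -> `|v| <= c * `|u|.

Definition bounded_op T : Prop :=
  [/\ right_linear T, forall u, exists! v, T (u, v) & exists c, opnorm_le T c].

(** Improper Riemann integrals of B(V)-valued functions, with respect to the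
    operator norm *)

Definition tagged_partition (a b delta : R) (n : nat) (x xi : nat -> R) : Prop :=
  [/\ x 0%N = a, x n = b &
   forall i, (i < n)%N -> [/\ x i <= xi i, xi i <= x i.+1 & x i.+1 - x i < delta]].

Definition riemann_sum F (n : nat) (x xi : nat -> R) : operator :=
  \big[op_add/op_cliff 0]_(i < n) op_scale (x i.+1 - x i) (F (xi i)).

Definition is_riemann_int F (a b : R) A : Prop :=
  [/\ forall t, a <= t <= b -> bounded_op (F t), bounded_op A &
   forall eps : R, 0 < eps -> exists2 delta : R, 0 < delta &
     forall n x xi, tagged_partition a b delta n x xi ->
       opnorm_le (op_sub (riemann_sum F n x xi) A) eps].

Definition is_improper_int F A : Prop :=
  bounded_op A /\
  forall eps : R, 0 < eps -> exists2 r : R, 0 < r &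
    forall a b, 0 < a -> a < r -> r^-1 < b -> a <= b ->
      exists2 B, is_riemann_int F a b B & opnorm_le (op_sub B A) eps.

(* the empty graph if the integral does not converge *)
Definition improper_int F : operator := xget set0 (is_improper_int F).

(** ** S-resolvents *)

Definition op_Q (s : cliff) T : operator :=
  op_add (op_sub (op_comp T T) (op_scale (2 * real_part s) T))
         (op_cliff (`|s| ^+ 2)%:A).

Definition S_resolventL (s : cliff) T : operator :=
  op_sub (op_comp (op_inv (op_Q s T)) (op_cliff (conjc s)))
         (op_comp T (op_inv (op_Q s T))).

Definition S_resolventR (s : cliff) T : operator :=
  op_comp (op_sub (op_cliff (conjc s)) T) (op_inv (op_Q s T)).

(** ** Functional calculi *)

(* The integral of S_L^{-1}(s, T) ds_J g(s), ds_J = - J ds, along the ray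
   s = t * w, t from 0 to +oo, for w in C_J. *)
Definition ray_intL J (w : cliff) T (g : cliff -> cliff) : operator :=
  improper_int (fun t => op_comp (S_resolventL (t *: w) T)
                                 (op_cliff (- J * w * g (t *: w)))).

Definition ray_intR J (w : cliff) T (g : cliff -> cliff) : operator :=
  improper_int (fun t => op_comp (op_cliff (g (t *: w) * (- J * w)))
                                 (S_resolventR (t *: w) T)).

(* The positively oriented boundary of D_phi in C_J: the rays in the directions
   exp(- J phi) and exp(J (pi - phi)) are outgoing, those in the directions
   exp(J phi) and exp(J (pi + phi)) incoming. *)
Definition boundary_int (ray_int : cliff -> operator) J phi : operator :=
  op_sub (op_add (ray_int (expc J (- phi))) (ray_int (expc J (pi - phi))))
         (op_add (ray_int (expc J phi)) (ray_int (expc J (pi + phi)))).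

Definition contour_intL J phi T g : operator :=
  op_scale (2 * pi)^-1 (boundary_int (fun w => ray_intL J w T g) J phi).

Definition contour_intR J phi T g : operator :=
  op_scale (2 * pi)^-1 (boundary_int (fun w => ray_intR J w T g) J phi).

(* g(T) for g holomorphic on D_theta and T bisectorial of angle omega: the common
   value of the contour integrals over all J and phi, and the empty graph (hence
   no operator) if they differ. *)
Definition omega_calcL omega theta T g : operator :=
  xget set0 [set A | forall J phi, unit_sphere J -> omega < phi < theta ->
    contour_intL J phi T g = A].

Definition omega_calcR omega theta T g : operator :=
  xget set0 [set A | forall J phi, unit_sphere J -> omega < phi < theta ->
    contour_intR J phi T g = A].

Definition regularizedL omega theta m T (f : cliff -> cliff) : operator :=
  op_comp (op_inv (omega_calcL omega theta T (regularizer m)))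
          (omega_calcL omega theta T (fun s => regularizer m s * f s)).

(* [closure] is the closure in the product V * V. *)
Definition regularizedR omega theta m T (f : cliff -> cliff) : operator :=
  closure (op_comp (omega_calcR omega theta T (fun s => f s * regularizer m s))
                   (op_inv (omega_calcR omega theta T (regularizer m)))).

(* f(T), as the common value of the regularized expressions over all m exceeding
   an exponent alpha in the growth bound of f on D_theta *)
Definition Hinf_calcL omega theta T f : operator :=
  xget set0 [set A | forall m, regularizing theta f m ->
    regularizedL omega theta m T f = A].

Definition Hinf_calcR omega theta T f : operator :=
  xget set0 [set A | forall m, regularizing theta f m ->
    regularizedR omega theta m T f = A].

End operators.

Section multiplication.
Context {R : realType} {d : nat} {disp : measure_display}
  {X : measurableType disp} (mu : {measure set X -> \bar R}).
Local Notation cliff := (clifford R d).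

(* Graph of M_g, g being relevant up to a.e. equality only. *)
Definition mul_op (g : X -> cliff) : @operator R d _ _ mu :=
  [set p | {ae mu, forall x, reprL2 p.2 x = g x * reprL2 p.1 x}].

Definition essran (h : X -> cliff) : set cliff :=
  [set s | paravector s /\
     forall eps : R, 0 < eps -> (0 < mu [set x | (`|h x - s| < eps)%R])%E].

End multiplication.

Arguments mul_op {R d disp X} mu g.

(* Main.v *)
Require Import Defs.
From mathcomp Require Import all_boot all_order all_algebra.
From mathcomp Require Import ring lra complex.
From mathcomp Require Import all_classical all_reals all_analysis.
From mathcomp Require Import measurable_realfun.
Import Defs.

Set Implicit Arguments.
Unset Strict Implicit.
Unset Printing Implicit Defensive.

Import Order.TTheory GRing.Theory Num.Theory.
Import numFieldNormedType.Exports.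

Local Open Scope classical_set_scope.
Local Open Scope ring_scope.

(** Multiplication operators reduce the calculus of M_h to scalar computations at
    the points q = h(x). Up to a null set every h(x) is a nonzero point of the
    closed double sector of angle omega ([essran_ae]), and Q_s[M_h]^{-1} is then
    multiplication by the inverse of q^2 - 2 s_0 q + |s|^2, so that both
    S-resolvents of M_h are multiplication operators ([S_resolventL_mul],
    [S_resolventR_mul]). The integrand of the contour integral is thus
    multiplication by a function k(t, q), and the estimates
    [ray_kernel_bound] (by an integrable function of t, uniformly in q) and
    [ray_kernel_lip] (in t, uniformly in q) make its Riemann sums converge in
    operator norm to multiplication by the pointwise integral
    ([improper_int_mul]). For a decaying g this shows that g(M_h) = M_{g o h} as
    soon as the scalar Cauchy formula
      g(q) = (1 / 2 pi) int S_L^{-1}(s, q) ds_J g(s)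
    holds for every unit J ([kernel_cauchy]).

    The Cauchy formula is proved in two steps. First, the sum of the integrands at
    s and at its conjugate does not depend on J ([ray_kernel_conj_indep]), so J may
    be replaced by the unit I such that q lies in C_I; there everything but the
    values of g commutes, and the kernel becomes s / (s - q) dt / t. Second, the
    plane Cauchy formula for this kernel is obtained in polar coordinates, in which
    the Cauchy-Riemann equations say that y |-> int_a^b u(t, y) dt / t has derivative
    v(a, y) - v(b, y): turning a ray changes the integral only by the contribution
    of two arcs ([angle_MVT]), which vanishes in the limit since g decays, while
    passing the pole at r e^{i psi} changes it by 2 pi v(r, psi), because the jump
    of the kernel across the pole is a Poisson kernel ([jump_limit]).

    For f of polynomial growth both e and e f decay, whence e(M_h) = M_{e o h} and
    (ef)(M_h) = M_{(ef) o h}. As e does not vanish at the points h(x), the left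
    calculus is M_{e o h}^{-1} M_{(ef) o h} = M_{f o h} ([regularized_left]). On the
    right the product M_{(fe) o h} M_{e o h}^{-1} is a restriction of the closed
    operator M_{f o h}, and cutting off u where e(h)^{-1} is large shows that it is
    a dense one ([regularized_right]). Otherwise the right case is the mirror image
    of the left one under the reversion of the Clifford algebra, the
    anti-automorphism that fixes all paravectors ([crev]). *)

(** * Integrals over compact intervals *)

Section integrals.
Context {R : realType}.
Implicit Types (f g F : R -> R) (a b c k : R).

Definition rint a b f : R := \int[@lebesgue_measure R]_(t in `[a, b]) f t.

Definition ccont a b f := forall t, a <= t <= b -> {for t, continuous f}.

Lemma ccont_within a b f : ccont a b f -> {within `[a, b], continuous f}.
Proof.
move=> cf; apply: continuous_in_subspaceT => x.
by rewrite inE/= in_itv/= => /cf.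
Qed.

Lemma ccont_integrable a b f : ccont a b f ->
  (@lebesgue_measure R).-integrable `[a, b] (EFin \o f).
Proof.
move=> /ccont_within cf; apply: continuous_compact_integrable => //.
exact: segment_compact.
Qed.

Lemma rint_eq a b f g : (forall t, a <= t <= b -> f t = g t) -> rint a b f = rint a b g.
Proof.
move=> fg; apply: eq_Rintegral => x; rewrite inE/= in_itv/=; exact: fg.
Qed.

Lemma rintD a b f g : ccont a b f -> ccont a b g ->
  rint a b (fun t => f t + g t) = rint a b f + rint a b g.
Proof. by move=> cf cg; apply: RintegralD => //; exact: ccont_integrable. Qed.

Lemma rintB a b f g : ccont a b f -> ccont a b g ->
  rint a b (fun t => f t - g t) = rint a b f - rint a b g.
Proof. by move=> cf cg; apply: RintegralB => //; exact: ccont_integrable. Qed.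

Lemma rintZ a b k f : ccont a b f -> rint a b (fun t => k * f t) = k * rint a b f.
Proof. by move=> cf; apply: RintegralZl => //; exact: ccont_integrable. Qed.

Lemma rint_le a b f g : ccont a b f -> ccont a b g ->
  (forall t, a <= t <= b -> f t <= g t) -> rint a b f <= rint a b g.
Proof.
move=> cf cg fg; apply: le_Rintegral => //; exact: ccont_integrable.
Qed.

Lemma rint_norm_le a b f g : ccont a b f -> ccont a b g ->
  (forall t, a <= t <= b -> `|f t| <= g t) -> `|rint a b f| <= rint a b g.
Proof.
move=> cf cg fg; rewrite ler_norml; apply/andP; split.
  rewrite -[X in X <= _]mulN1r -rintZ//; apply: rint_le => //.
    by move=> t tab; apply: continuousM; [exact: cst_continuous|exact: cg].
  by move=> t /fg; rewrite mulN1r ler_norml => /andP[].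
by apply: rint_le => // t /fg; rewrite ler_norml => /andP[].
Qed.

Lemma rint_FTC a b f F : a <= b -> ccont a b f ->
  (forall t, a <= t <= b -> is_derive t 1 F (f t)) -> rint a b f = F b - F a.
Proof.
rewrite le_eqVlt => /predU1P[->|ab] cf dF.
  by rewrite subrr /rint set_itv1 Rintegral_set1.
rewrite /rint /Rintegral (@continuous_FTC2 _ f F)//.
- exact: ccont_within.
- have cF t : a <= t <= b -> {for t, continuous F}.
    move=> /dF tF; apply/differentiable_continuous/derivable1_diffP.
    exact: ex_derive.
  split.
  + move=> x; rewrite in_itv/= => /andP[ax xb].
    have := dF x; rewrite !ltW// => /(_ isT) xF; exact: ex_derive.
  + apply: cvg_at_right_filter; apply: cF; by rewrite lexx ltW.
  + apply: cvg_at_left_filter; apply: cF; by rewrite lexx ltW.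
- move=> x; rewrite in_itv/= => /andP[ax xb].
  have := dF x; rewrite !ltW// => /(_ isT) xF; rewrite derive1E; exact: derive_val.
Qed.

Lemma rint_cst a b k : a <= b -> rint a b (fun=> k) = k * (b - a).
Proof.
move=> ab; rewrite mulrBr; apply: (@rint_FTC _ _ _ (fun t => k * t)) => //.
  by move=> t _; exact: cst_continuous.
move=> t _; have := @is_deriveZ _ _ _ id k t 1 1 _.
by rewrite [k *: 1]mulr1; apply.
Qed.

Lemma rint_Chasles a b c f : a <= b -> b <= c -> ccont a c f ->
  rint a c f = rint a b f + rint b c f.
Proof.
move=> ab bc cf; rewrite /rint.
have i := ccont_integrable cf.
have E := @Rintegral_itvB _ f (BLeft a) (BRight c) b i.
rewrite -[LHS](subrK (\int[lebesgue_measure]_(t in `[a, b]) f t)) E ?bnd_simp// addrC.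
congr (_ + _); apply: Rintegral_itv_obnd_cbnd.
apply: integrableS i => //= x /=; rewrite !in_itv/= => /andP[bx ->].
by rewrite (le_trans ab)// ltW.
Qed.

End integrals.

(** * Holomorphic functions in polar coordinates *)

Section polar_holomorphic.
Context {R : realType}.
Implicit Types (D : set (R * R)) (u v ut vt : R * R -> R) (p : R * R).

(** The derivatives in y are those of the Cauchy-Riemann equations for the
    function (t, y) |-> (u + i v)(t e^{iy}): t u_t = v_y and u_y = - t v_t. *)
Definition polar_CR_at u v ut vt p : Prop :=
  [/\ is_derive p.1 (1 : R) (fun t => u (t, p.2)) (ut p),
      is_derive p.1 (1 : R) (fun t => v (t, p.2)) (vt p),
      is_derive p.2 (1 : R) (fun y => u (p.1, y)) (- (p.1 * vt p)) &
      is_derive p.2 (1 : R) (fun y => v (p.1, y)) (p.1 * ut p)].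

(** The partial derivatives are quantified existentially, so that sums, products
    and inverses of such pairs are pairs of the same kind. *)
Definition polar_holo D u v : Prop := exists ut vt, forall p, D p ->
  polar_CR_at u v ut vt p /\
  [/\ {for p, continuous u}, {for p, continuous v},
      {for p, continuous ut} & {for p, continuous vt}].

Lemma polar_holoS D D' u v : D `<=` D' -> polar_holo D' u v -> polar_holo D u v.
Proof. by move=> DD' [ut [vt h]]; exists ut, vt => p /DD'; exact: h. Qed.

Lemma polar_holo_cst D (a b : R) : polar_holo D (fun=> a) (fun=> b).
Proof.
exists (fun=> 0), (fun=> 0) => p _; split.
  by split => /=; rewrite ?mulr0 ?oppr0; exact: is_derive_cst.
by split; exact: cst_continuous.
Qed.

Lemma polar_holo_id D :
  polar_holo D (fun p => p.1 * cos p.2) (fun p => p.1 * sin p.2).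
Proof.
have c2 (k : R -> R) p : continuous k -> {for p, continuous (fun q : R * R => k q.2)}.
  by move=> ck; apply: continuous_comp; [exact: cvg_snd|exact: ck].
have c1 p : {for p, continuous (fun q : R * R => q.1)} by exact: cvg_fst.
exists (fun p => cos p.2), (fun p => sin p.2) => -[t y] _; split.
  by split => /=; apply: is_derive_eq; rewrite /GRing.scale/=; ring.
split; try (apply: continuousM; first exact: c1); apply: c2.
- exact: continuous_cos.
- exact: continuous_sin.
- exact: continuous_cos.
- exact: continuous_sin.
Qed.

Lemma polar_holoD D u v u' v' : polar_holo D u v -> polar_holo D u' v' ->
  polar_holo D (fun p => u p + u' p) (fun p => v p + v' p).
Proof.
move=> [ut [vt h]] [ut' [vt' h']].
exists (fun p => ut p + ut' p), (fun p => vt p + vt' p) => p Dp.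
have [[h1 h2 h3 h4] [c1 c2 c3 c4]] := h _ Dp.
have [[k1 k2 k3 k4] [d1 d2 d3 d4]] := h' _ Dp.
split; last by split; exact: continuousD.
split.
- exact: is_deriveD.
- exact: is_deriveD.
- by rewrite mulrDr opprD; exact: is_deriveD.
- by rewrite mulrDr; exact: is_deriveD.
Qed.

Lemma polar_holoM D u v u' v' : polar_holo D u v -> polar_holo D u' v' ->
  polar_holo D (fun p => u p * u' p - v p * v' p) (fun p => u p * v' p + v p * u' p).
Proof.
move=> [ut [vt h]] [ut' [vt' h']].
exists (fun p => ut p * u' p + u p * ut' p - (vt p * v' p + v p * vt' p)),
  (fun p => ut p * v' p + u p * vt' p + (vt p * u' p + v p * ut' p)) => p Dp.
have [[h1 h2 h3 h4] [c1 c2 c3 c4]] := h _ Dp.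
have [[k1 k2 k3 k4] [d1 d2 d3 d4]] := h' _ Dp.
split; last first.
  split.
  - exact: (continuousB (continuousM c1 d1) (continuousM c2 d2)).
  - exact: (continuousD (continuousM c1 d2) (continuousM c2 d1)).
  - exact: (continuousB (continuousD (continuousM c3 d1) (continuousM c1 d3))
                        (continuousD (continuousM c4 d2) (continuousM c2 d4))).
  - exact: (continuousD (continuousD (continuousM c3 d2) (continuousM c1 d4))
                        (continuousD (continuousM c4 d1) (continuousM c2 d3))).
move: p Dp h1 h2 h3 h4 c1 c2 c3 c4 k1 k2 k3 k4 d1 d2 d3 d4 => [t y] /= Dp h1 h2 h3 h4 c1 c2 c3 c4 k1 k2 k3 k4 d1 d2 d3 d4.
split => /=; apply: is_derive_eq; rewrite /GRing.scale/=; ring.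
Qed.

(** Multiplication by - i; it turns a formula for v into one for u. *)
Lemma polar_holoNi D u v : polar_holo D u v -> polar_holo D v (fun p => - u p).
Proof.
move=> /(polar_holoM (polar_holo_cst D 0 (-1))) h.
have : polar_holo D (fun p => 0 * u p - -1 * v p) (fun p => 0 * v p + -1 * u p) by [].
by under eq_fun do rewrite mul0r add0r mulN1r opprK;
   under [X in polar_holo _ _ X]eq_fun do rewrite mul0r add0r mulN1r.
Qed.

Lemma polar_holoV D u v : (forall p, D p -> u p ^+ 2 + v p ^+ 2 != 0) ->
  polar_holo D u v ->
  polar_holo D (fun p => u p / (u p ^+ 2 + v p ^+ 2))
               (fun p => - v p / (u p ^+ 2 + v p ^+ 2)).
Proof.
move=> N0 [ut [vt h]].
pose N p := u p ^+ 2 + v p ^+ 2.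
pose a p := u p ^+ 2 - v p ^+ 2.
pose b p := 2 * u p * v p.
exists (fun p => - (ut p * a p + vt p * b p) / N p ^+ 2),
  (fun p => (ut p * b p - vt p * a p) / N p ^+ 2) => p Dp.
have [[h1 h2 h3 h4] [c1 c2 c3 c4]] := h _ Dp.
have cN : {for p, continuous N}.
  by apply: continuousD; rewrite /= ; apply: continuousM.
have ca : {for p, continuous a} by apply: continuousB; apply: continuousM.
have cb : {for p, continuous b}.
  by apply: continuousM => //; apply: continuousM => //; exact: cst_continuous.
have cNV : {for p, continuous (fun p => (N p)^-1)} by apply: continuousV => //; exact: N0.
have cNV2 : {for p, continuous (fun p => (N p ^+ 2)^-1)}.
  apply: continuousV => //; first by rewrite sqrf_eq0 N0.
  exact: continuousM.
split; last first.
  split; apply: continuousM => //.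
  - exact: continuousN.
  - by apply: continuousN; apply: continuousD; exact: continuousM.
  - by apply: continuousB; exact: continuousM.
have := N0 _ Dp.
move: p Dp h1 h2 h3 h4 {c1 c2 c3 c4 cN ca cb cNV cNV2} => [t y] /= Dp h1 h2 h3 h4 Np.
have N2 : N (t, y) ^+ 2 != 0 by rewrite sqrf_eq0.
have dV (z : R) (w : R -> R * R) (dw1 dw2 : R) :
    u (w z) ^+ 2 + v (w z) ^+ 2 != 0 ->
    is_derive z 1 (fun t => u (w t)) dw1 -> is_derive z 1 (fun t => v (w t)) dw2 ->
    is_derive z 1 (fun t => (u (w t) ^+ 2 + v (w t) ^+ 2)^-1)
      (- (2 * u (w z) * dw1 + 2 * v (w z) * dw2) / N (w z) ^+ 2).
  move=> Nw d1 d2.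
  have dN : is_derive z 1 (fun t => u (w t) ^+ 2 + v (w t) ^+ 2)
      (2 * u (w z) * dw1 + 2 * v (w z) * dw2).
    by apply: is_derive_eq; rewrite /GRing.scale/=; ring.
  apply: (is_derive_eq (is_deriveV _ dN)) => //.
  by rewrite /GRing.scale/= -/(N (w z)) !mulNr mulrC.
have d1 := @dV t (fun t => (t, y)) _ _ Np h1 h2.
have d2 := @dV y (fun y => (t, y)) _ _ Np h3 h4.
by split => /=; apply: is_derive_eq; rewrite /GRing.scale/= /N /= /a /b;
  move: Np {N2 d1 d2 dV h1 h2 h3 h4}; set A := u _; set B := v _ => Np; field.
Qed.

End polar_holomorphic.

(** * From Cartesian to polar Cauchy-Riemann equations *)

Section polar_coordinates.
Context {R : realType}.
Implicit Types (D : set (R * R)) (p : R * R).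

(** Derivatives as first-order approximations, a form that can be composed with
    a function of two variables. *)
Lemma is_derive_eps (f : R -> R) (x a : R) :
  (forall e, 0 < e -> \forall h \near 0, `|f (h + x) - f x - a * h| <= e * `|h|) ->
  is_derive x (1 : R) f a.
Proof.
move=> H.
suff L : h^-1 *: (f (h *: 1 + x) - f x) @[h --> 0^'] --> a.
  split; first by apply/cvg_ex; exists a.
  by apply/cvg_lim => //.
apply/cvgrPdist_le => e e0; near=> h.
have h0 : h != 0 by near: h; exact: nbhs_dnbhs_neq.
rewrite /GRing.scale/= mulr1.
have -> : a - h^-1 * (f (h + x) - f x) = - h^-1 * (f (h + x) - f x - a * h) by field.
rewrite normrM normrN normfV mulrC ler_pdivrMr ?normr_gt0//.
by near: h; apply: nbhs_dnbhs; exact: H.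
Unshelve. all: by end_near. Qed.

Lemma eps_is_derive (f : R -> R) (x a : R) : is_derive x (1 : R) f a ->
  forall e, 0 < e -> \forall h \near 0, `|f (h + x) - f x - a * h| <= e * `|h|.
Proof.
move=> [df dfa] e e0.
have : h^-1 *: (f (h *: 1 + x) - f x) @[h --> 0^'] --> a by rewrite -dfa; exact: df.
move=> /cvgrPdist_le/(_ _ e0); rewrite near_withinE; apply: filterS => h.
have [->|h0] := eqVneq h 0.
  by rewrite add0r subrr mulr0 subr0 normr0 mulr0.
move=> /(_ isT); rewrite /GRing.scale/= mulr1.
have -> : a - h^-1 * (f (h + x) - f x) = - h^-1 * (f (h + x) - f x - a * h) by field.
by rewrite normrM normrN normfV mulrC ler_pdivrMr ?normr_gt0.
Qed.

Lemma is_derive_fst (g : R * R -> R) p (a : R) :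
  is_derive p (1, 0) g a -> is_derive p.1 (1 : R) (fun t => g (t, p.2)) a.
Proof.
move: p => [x y] [dg dga].
have E : (fun h : R => h^-1 *: (g (h *: (1, 0) + (x, y)) - g (x, y))) =
         (fun h : R => h^-1 *: (g (h *: 1 + x, y) - g (x, y))).
  apply/funext => h; congr (_ *: (g _ - _)); congr pair => /=.
  by rewrite /GRing.scale/= mulr0 add0r.
by split; [rewrite /derivable /= -E|rewrite -dga /derive /= -E].
Qed.

Lemma is_derive_snd (g : R * R -> R) p (a : R) :
  is_derive p (0, 1) g a -> is_derive p.2 (1 : R) (fun t => g (p.1, t)) a.
Proof.
move: p => [x y] [dg dga].
have E : (fun h : R => h^-1 *: (g (h *: (0, 1) + (x, y)) - g (x, y))) =
         (fun h : R => h^-1 *: (g (x, h *: 1 + y) - g (x, y))).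
  apply/funext => h; congr (_ *: (g _ - _)); congr pair => /=.
  by rewrite /GRing.scale/= mulr0 add0r.
by split; [rewrite /derivable /= -E|rewrite -dga /derive /= -E].
Qed.

(** The two end points may come in any order. *)
Lemma MVT_any (f df : R -> R) (a b : R) :
  (forall x, Num.min a b <= x <= Num.max a b -> is_derive x 1 f (df x)) ->
  exists2 c, Num.min a b <= c <= Num.max a b & f b - f a = df c * (b - a).
Proof.
have W (a' b' : R) : a' <= b' -> (forall x, a' <= x <= b' -> is_derive x 1 f (df x)) ->
  exists2 c, a' <= c <= b' & f b' - f a' = df c * (b' - a').
  move=> ab dF.
  have cf : {within `[a', b'], continuous f}.
    by apply: derivable_within_continuous => x; rewrite in_itv/= => /dF h; exact: ex_derive.
  have df' x : x \in `]a', b'[ -> is_derive x 1 f (df x).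
    by rewrite in_itv/= => /andP[/ltW ax /ltW xb]; apply: dF; rewrite ax.
  by have [c] := MVT_segment ab df' cf; rewrite in_itv => cab E; exists c.
case: (leP a b) => [ab|/ltW ba]; first exact: W.
move=> /(W _ _ ba)[c cba E]; exists c => //.
by rewrite -[LHS]opprB E -mulrN opprB.
Qed.

Section frechet.
Variables (D : set (R * R)) (g gx gy : R * R -> R).
Hypothesis oD : open D.
Hypothesis dgx : forall p, D p -> is_derive p (1, 0) g (gx p).
Hypothesis dgy : forall p, D p -> is_derive p (0, 1) g (gy p).
Hypothesis cgx : forall p, D p -> {for p, continuous gx}.
Hypothesis cgy : forall p, D p -> {for p, continuous gy}.

(** Continuous partial derivatives give a differential: pass from p to q along the
    two sides of a rectangle and apply the mean value theorem on each. *)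
Lemma C1_frechet p (e : R) : D p -> 0 < e -> \forall q \near p,
  `|g q - g p - (gx p * (q.1 - p.1) + gy p * (q.2 - p.2))|
     <= e * (`|q.1 - p.1| + `|q.2 - p.2|).
Proof.
move=> Dp e0.
have nD : \forall q \near p, D q by exact: open_nbhs_nbhs.
have nx : \forall q \near p, `|gx p - gx q| <= e by have /cvgrPdist_le := cgx Dp; exact.
have ny : \forall q \near p, `|gy p - gy q| <= e by have /cvgrPdist_le := cgy Dp; exact.
have nn : nbhs p [set q | D q /\ (`|gx p - gx q| <= e /\ `|gy p - gy q| <= e)].
  exact: filterI nD (filterI nx ny).
have [r /= r0 Br] := (nbhs_ballP _ _).1 nn; clear nn.
apply/nbhs_ballP; exists r => //= -[x' y'] [/= bx by_].
move: p Dp nD nx ny bx by_ Br => [x y] /= Dp nD nx ny bx by_ Br.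
have btw (u u' c : R) : ball u r u' -> Num.min u u' <= c <= Num.max u u' -> ball u r c.
  rewrite /ball/= !ltr_distl.
  by case: (leP u u') => uu' /andP[h1 h2] /andP[h3 h4]; apply/andP; split; lra.
have [c1 c1i E1] := @MVT_any (fun t => g (t, y')) (fun t => gx (t, y')) x x'
  (fun t ht => is_derive_fst (dgx (Br (t, y') (conj (btw _ _ _ bx ht) by_)).1)).
have bxx : ball x r x by exact: ballxx.
have [c2 c2i E2] := @MVT_any (fun t => g (x, t)) (fun t => gy (x, t)) y y'
  (fun t ht => is_derive_snd (dgy (Br (x, t) (conj bxx (btw _ _ _ by_ ht))).1)).
have [_ [X1 _]] := Br (c1, y') (conj (btw _ _ _ bx c1i) by_).
have [_ [_ Y1]] := Br (x, c2) (conj bxx (btw _ _ _ by_ c2i)).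
have -> : g (x', y') - g (x, y) - (gx (x, y) * (x' - x) + gy (x, y) * (y' - y)) =
  - ((gx (x, y) - gx (c1, y')) * (x' - x)) - (gy (x, y) - gy (x, c2)) * (y' - y).
  by rewrite -[g _ - g _](subrKA (g (x, y'))) E1 E2; ring.
rewrite (le_trans (ler_normB _ _))// [leRHS]mulrDr normrN !normrM.
by apply: lerD; apply: ler_wpM2r.
Qed.

Lemma C1_continuous p : D p -> {for p, continuous g}.
Proof.
move=> Dp; apply/cvgrPdist_le => e e0.
pose M := `|gx p| + `|gy p| + 1.
have M0 : 0 < M by rewrite ltr_wpDl// addr_ge0.
have d0 : 0 < e / (2 * M) by rewrite divr_gt0// mulr_gt0.
have nb : \forall q \near p, `|q.1 - p.1| <= e / (2 * M) /\ `|q.2 - p.2| <= e / (2 * M).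
  apply/nbhs_ballP; exists (e / (2 * M)) => //= q [/= h1 h2].
  by rewrite (distrC q.1) (distrC q.2); split; apply/ltW.
apply: filterS2 nb (C1_frechet Dp ltr01) => q [h1 h2] h3.
rewrite distrC -[g q - g p](subrK (gx p * (q.1 - p.1) + gy p * (q.2 - p.2))).
apply: (le_trans (ler_normD _ _)).
apply: (@le_trans _ _ (M * `|q.1 - p.1| + M * `|q.2 - p.2|)).
  apply: (le_trans (lerD h3 (ler_normD _ _))).
  rewrite !normrM mul1r /M.
  have := normr_ge0 (q.1 - p.1); have := normr_ge0 (q.2 - p.2).
  have := normr_ge0 (gx p); have := normr_ge0 (gy p).
  set a := `|gx p|; set b := `|gy p|; set c := `|q.1 - _|; set d := `|q.2 - _|.
  nra.
rewrite -mulrDr; apply: (@le_trans _ _ (M * (e / (2 * M) + e / (2 * M)))).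
  by rewrite ler_pM2l// lerD.
by rewrite le_eqVlt; apply/orP; left; apply/eqP; field; rewrite gt_eqF.
Qed.

Lemma C1_chain (X Y : R -> R) (t X' Y' : R) : D (X t, Y t) ->
  is_derive t (1 : R) X X' -> is_derive t (1 : R) Y Y' ->
  is_derive t (1 : R) (fun s => g (X s, Y s))
    (gx (X t, Y t) * X' + gy (X t, Y t) * Y').
Proof.
move=> Dp dX dY; apply: is_derive_eps => e e0.
set p := (X t, Y t) in Dp *.
pose M := `|gx p| + `|gy p| + `|X'| + `|Y'| + 3.
have M0 : 0 < M by rewrite ltr_wpDl// !addr_ge0.
pose e1 := Num.min 1 (e / M).
have e10 : 0 < e1 by rewrite lt_min ltr01 divr_gt0.
have cX : X (h + t) @[h --> (0 : R)] --> X t.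
  have -> : X t = X (0 + t) by rewrite add0r.
  apply: (@continuous_comp _ _ _ (fun h => h + t) X).
    by apply: continuousD; [exact: cvg_id|exact: cvg_cst].
  by rewrite add0r; apply/differentiable_continuous/derivable1_diffP; exact: ex_derive.
have cY : Y (h + t) @[h --> (0 : R)] --> Y t.
  have -> : Y t = Y (0 + t) by rewrite add0r.
  apply: (@continuous_comp _ _ _ (fun h => h + t) Y).
    by apply: continuousD; [exact: cvg_id|exact: cvg_cst].
  by rewrite add0r; apply/differentiable_continuous/derivable1_diffP; exact: ex_derive.
have cXY : (X (h + t), Y (h + t)) @[h --> (0 : R)] --> (X t, Y t) by exact: (cvg_pair cX cY).
have hF : \forall h \near (0 : R),
    `|g (X (h + t), Y (h + t)) - g p - (gx p * (X (h + t) - X t) + gy p * (Y (h + t) - Y t))|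
     <= e1 * (`|X (h + t) - X t| + `|Y (h + t) - Y t|).
  exact: (cXY _ (C1_frechet Dp e10)).
have hX := eps_is_derive dX e10; have hY := eps_is_derive dY e10.
near=> h.
have F1 : `|g (X (h + t), Y (h + t)) - g p - (gx p * (X (h + t) - X t) + gy p * (Y (h + t) - Y t))|
     <= e1 * (`|X (h + t) - X t| + `|Y (h + t) - Y t|) by near: h.
have FX : `|X (h + t) - X t - X' * h| <= e1 * `|h| by near: h.
have FY : `|Y (h + t) - Y t - Y' * h| <= e1 * `|h| by near: h.
move: F1 FX FY.
set A := g _ - g p; set x := X (h + t) - X t; set y := Y (h + t) - Y t.
move=> F1 FX FY.
have e11 : e1 <= 1 by rewrite ge_min lexx.
have hx : `|x| <= (`|X'| + 1) * `|h|.
  have := ler_normD (x - X' * h) (X' * h); rewrite subrK => /le_trans; apply.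
  by rewrite normrM mulrDl [leRHS]addrC lerD// (le_trans FX)// ler_wpM2r.
have hy : `|y| <= (`|Y'| + 1) * `|h|.
  have := ler_normD (y - Y' * h) (Y' * h); rewrite subrK => /le_trans; apply.
  by rewrite normrM mulrDl [leRHS]addrC lerD// (le_trans FY)// ler_wpM2r.
have -> : A - (gx p * X' + gy p * Y') * h =
   (A - (gx p * x + gy p * y)) + (gx p * (x - X' * h) + gy p * (y - Y' * h)) by ring.
apply: (@le_trans _ _ (e1 * M * `|h|)); last first.
  rewrite ler_wpM2r// -ler_pdivlMr// ge_min lexx orbT//.
apply: (le_trans (ler_normD _ _)).
apply: (@le_trans _ _ (e1 * (`|x| + `|y|) + (`|gx p| * (e1 * `|h|) + `|gy p| * (e1 * `|h|)))).
  apply: lerD => //; apply: (le_trans (ler_normD _ _)); rewrite !normrM.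
  by apply: lerD; apply: ler_wpM2l.
rewrite /M -!mulrA ![_ * (e1 * _)]mulrCA -!mulrDr ler_pM2l//.
have := normr_ge0 h; lra.
Unshelve. all: by end_near. Qed.

End frechet.

Definition polar_set D : set (R * R) :=
  [set p | 0 < p.1 /\ D (p.1 * cos p.2, p.1 * sin p.2)].

(** The polar equations follow from the Cartesian ones by the chain rule along
    t |-> (t cos y, t sin y) and y |-> (t cos y, t sin y). *)
Lemma polar_holo_cartesian D (u v ux uy vx vy : R * R -> R) : open D ->
  (forall p, D p -> is_derive p (1, 0) u (ux p)) ->
  (forall p, D p -> is_derive p (0, 1) u (uy p)) ->
  (forall p, D p -> is_derive p (1, 0) v (vx p)) ->
  (forall p, D p -> is_derive p (0, 1) v (vy p)) ->
  (forall p, D p -> [/\ {for p, continuous ux}, {for p, continuous uy},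
     {for p, continuous vx} & {for p, continuous vy}]) ->
  (forall p, D p -> ux p = vy p /\ uy p = - vx p) ->
  polar_holo (polar_set D) (fun p => u (p.1 * cos p.2, p.1 * sin p.2))
                           (fun p => v (p.1 * cos p.2, p.1 * sin p.2)).
Proof.
move=> oD dux duy dvx dvy cD CR.
pose P (p : R * R) := (p.1 * cos p.2, p.1 * sin p.2).
exists (fun p => ux (P p) * cos p.2 + uy (P p) * sin p.2),
       (fun p => vx (P p) * cos p.2 + vy (P p) * sin p.2) => -[t y] [/= t0 Dp].
have [CR1 CR2] := CR _ Dp; have [c1 c2 c3 c4] := cD _ Dp.
have cux p Dp := let: And4 c _ _ _ := cD p Dp in c.
have cuy p Dp := let: And4 _ c _ _ := cD p Dp in c.
have cvx p Dp := let: And4 _ _ c _ := cD p Dp in c.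
have cvy p Dp := let: And4 _ _ _ c := cD p Dp in c.
split.
  have dxt : is_derive t (1 : R) (fun t => t * cos y) (cos y).
    by apply: is_derive_eq; rewrite /GRing.scale/=; ring.
  have dyt : is_derive t (1 : R) (fun t => t * sin y) (sin y).
    by apply: is_derive_eq; rewrite /GRing.scale/=; ring.
  have dxy : is_derive y (1 : R) (fun y => t * cos y) (- (t * sin y)).
    by apply: is_derive_eq; rewrite /GRing.scale/=; ring.
  have dyy : is_derive y (1 : R) (fun y => t * sin y) (t * cos y).
    by apply: is_derive_eq; rewrite /GRing.scale/=; ring.
  split => /=.
  - exact: (C1_chain oD dux duy cux cuy (X := fun t => t * cos y)).
  - exact: (C1_chain oD dvx dvy cvx cvy (X := fun t => t * cos y)).
  - apply: (is_derive_eq (C1_chain oD dux duy cux cuy (X := fun y => t * cos y) Dp dxy dyy)).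
    by rewrite /P/= CR1 CR2; ring.
  - apply: (is_derive_eq (C1_chain oD dvx dvy cvx cvy (X := fun y => t * cos y) Dp dxy dyy)).
    by rewrite /P/= CR1 CR2; ring.
have ccos : {for (t, y), continuous (fun p : R * R => cos p.2)}.
  by apply: continuous_comp; [exact: cvg_snd|exact: continuous_cos].
have csin : {for (t, y), continuous (fun p : R * R => sin p.2)}.
  by apply: continuous_comp; [exact: cvg_snd|exact: continuous_sin].
have cfst : {for (t, y), continuous (fun p : R * R => p.1)} by exact: cvg_fst.
have cP : {for (t, y), continuous P}.
  exact: (cvg_pair (continuousM cfst ccos) (continuousM cfst csin)).
have comp (w : R * R -> R) : {for P (t, y), continuous w} -> {for (t, y), continuous (w \o P)}.
  by move=> cw; exact: (continuous_comp cP cw).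
split.
- exact/comp/(C1_continuous oD dux duy cux cuy).
- exact/comp/(C1_continuous oD dvx dvy cvx cvy).
- by apply: continuousD; apply: continuousM => //; exact: comp.
- by apply: continuousD; apply: continuousM => //; exact: comp.
Qed.

End polar_coordinates.

(** * Rotating a ray of integration *)

Section ray_integrals.
Context {R : realType}.
Implicit Types (D : set (R * R)) (u v w : R * R -> R) (p : R * R) (a b r psi : R).

Definition rect (a b c d : R) : set (R * R) := [set p | a <= p.1 <= b /\ c <= p.2 <= d].

Lemma rect_bounded w a b c d : (forall p, rect a b c d p -> {for p, continuous w}) ->
  exists2 M : R, 0 < M & forall p, rect a b c d p -> `|w p| <= M.
Proof.
move=> cw.
have E : rect a b c d = `[a, b] `*` `[c, d].
  by apply/seteqP; split => p /=; rewrite !in_itv.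
have /compact_bounded[M [_ HM]] : compact (w @` rect a b c d).
  apply: continuous_compact.
    by apply: continuous_in_subspaceT => x; rewrite inE; exact: cw.
  by rewrite E; apply: compact_setX; exact: segment_compact.
exists (Num.max M 0 + 1) => [|p Dp].
  by rewrite ltr_wpDl// le_max lexx orbT.
by apply: HM; [rewrite ltr_pwDr// le_max lexx|exists p].
Qed.

Lemma polar_CR_continuous1 u v ut vt p : polar_CR_at u v ut vt p ->
  {for p.1, continuous (fun t => u (t, p.2))} /\
  {for p.1, continuous (fun t => v (t, p.2))}.
Proof.
case=> du dv _ _; split; apply/differentiable_continuous/derivable1_diffP; exact: ex_derive.
Qed.

Lemma ccont_divt a b (f : R -> R) : 0 < a -> ccont a b f -> ccont a b (fun t => f t / t).
Proof.
move=> a0 cf t tab; apply: continuousM; first exact: cf.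
apply: continuousV; last exact: cvg_id.
by rewrite gt_eqF// (lt_le_trans a0)//; case/andP: tab.
Qed.

Lemma continuous_fst_snd (w : R * R -> R) (t y : R) : {for (t, y), continuous w} ->
  {for t, continuous (fun s => w (s, y))}.
Proof.
move=> cw; apply: (@continuous_comp _ _ _ (fun s => (s, y)) w) => //.
by exact: (cvg_pair cvg_id (cvg_cst _)).
Qed.

(** Differentiating under the integral gives the integral of u_y / t = - v_t, which
    the fundamental theorem of calculus turns into values at the end points: the two
    arcs that close the contour. *)
Lemma angle_derive D u v a b c y d : polar_holo D u v -> 0 < a -> a <= b ->
  c < y < d -> rect a b c d `<=` D ->
  is_derive y (1 : R) (fun y => rint a b (fun t => u (t, y) / t))
    (- (v (b, y) - v (a, y))).
Proof.
move=> [ut [vt h]] a0 ab cyd sD.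
have [M M0 HM] : exists2 M : R, 0 < M & forall p, rect a b c d p -> `|vt p| <= M.
  by apply: rect_bounded => p /sD/h[_ []].
have tpos t : a <= t <= b -> 0 < t by move=> /andP[/(lt_le_trans a0)].
have yI : `]c, d[%classic y by rewrite /= in_itv.
pose f z t := u (t, z) / t.
have df z t : c <= z <= d -> a <= t <= b -> is_derive z 1 (f ^~ t) (- vt (t, z)).
  move=> zI tI; have /sD/h[[_ _ du _] _] : rect a b c d (t, z) by [].
  have : is_derive z (1 : R) (fun z => t^-1 * u (t, z)) (- vt (t, z)).
    apply: (is_derive_eq (is_deriveZ _ _)).
    by rewrite /GRing.scale/= mulrN mulKf// gt_eqF// tpos.
  by rewrite /f; under eq_fun do rewrite mulrC.
have cv z : c <= z <= d -> ccont a b (fun t => vt (t, z)).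
  by move=> zI t tI; apply: continuous_fst_snd; have /sD/h[_ []] : rect a b c d (t, z).
have cu z : c <= z <= d -> ccont a b (f z).
  move=> zI; apply: ccont_divt => // t tI.
  by have /sD/h[/polar_CR_continuous1[]] : rect a b c d (t, z).
have int1 z : `]c, d[%classic z -> (@lebesgue_measure R).-integrable `[a, b] (EFin \o f z).
  by rewrite /= in_itv/= => /andP[/ltW cz /ltW zd]; apply: ccont_integrable; apply: cu; rewrite cz.
have int2 z t : `]c, d[%classic z -> `[a, b]%classic t -> derivable (f ^~ t) z 1.
  rewrite /= !in_itv/= => /andP[/ltW cz /ltW zd] tI.
  have zI : c <= z <= d by rewrite cz.
  by have := df _ _ zI tI => ?; exact: ex_derive.
have int3 z t : `]c, d[%classic z -> `[a, b]%classic t -> `|partial1of2 f z t| <= M.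
  rewrite /= !in_itv/= => /andP[/ltW cz /ltW zd] tI.
  have zI : c <= z <= d by rewrite cz.
  rewrite partial1of2E; have := df _ _ zI tI => ?; rewrite derive_val normrN.
  exact: HM.
have intM : (@lebesgue_measure R).-integrable `[a, b] (EFin \o (fun=> M)).
  by apply: ccont_integrable => t _; exact: cst_continuous.
have mab : measurable (`[a, b]%classic : set (measurableTypeR R)) by exact: measurable_itv.
have M0' (t : measurableTypeR R) : 0 <= M by exact: ltW.
have D1 := @derivable_under_integral R _ (measurableTypeR R) _ f _ mab y c d yI int1 int2
  (fun=> M) M0' intM int3.
have D2 := @differentiation_under_integral R _ (measurableTypeR R) _ f _ mab y c d yI int1 int2
  (fun=> M) M0' intM int3.
split; first exact: D1.
have yI' : c <= y <= d by case/andP: cyd => *; rewrite !ltW.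
rewrite -derive1E D2 -/(rint _ _ _) (@rint_eq _ _ _ _ (fun t => - vt (t, y))); last first.
  by move=> t tI; rewrite partial1of2E; have := df _ _ yI' tI => ?; rewrite derive_val.
have -> : - (v (b, y) - v (a, y)) = - v (b, y) - - v (a, y) by ring.
apply: (@rint_FTC _ a b (fun t => - vt (t, y)) (fun t => - v (t, y))) => //.
- by move=> t tI; apply: continuousN; exact: cv.
- move=> t tI; have /sD/h[[_ dv _ _] _] : rect a b c d (t, y) by [].
  exact: is_deriveN.
Qed.

(** Cauchy's theorem for a sector of an annulus, as an estimate: the integrals along
    the two rays differ by at most the length of the arcs times the bound on them. *)
Lemma angle_MVT D u v a b c d M e : polar_holo D u v -> 0 < a -> a <= b ->
  c <= d -> 0 < e -> rect a b (c - e) (d + e) `<=` D ->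
  (forall y, c <= y <= d -> `|v (b, y)| <= M /\ `|v (a, y)| <= M) ->
  `|rint a b (fun t => u (t, d) / t) - rint a b (fun t => u (t, c) / t)| <= 2 * M * (d - c).
Proof.
move=> huv a0 ab cd e0 sDe vM.
pose F y := rint a b (fun t => u (t, y) / t).
have dF y : Num.min c d <= y <= Num.max c d -> is_derive y 1 F (- (v (b, y) - v (a, y))).
  rewrite min_l// max_r// => /andP[cy yd].
  apply: (angle_derive huv a0 ab _ sDe); apply/andP; split; lra.
have [y + ->] := MVT_any dF; rewrite min_l// max_r// => yI.
have [M1 M2] := vM _ yI.
rewrite normrM normrN [`|d - c|]ger0_norm ?subr_ge0//.
rewrite ler_wpM2r ?subr_ge0// (le_trans (ler_normB _ _))//; lra.
Qed.

End ray_integrals.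

(** * The Cauchy formula in a sector *)

Section kernel.
Context {R : realType}.
Implicit Types (D : set (R * R)) (u v w : R * R -> R) (p : R * R) (a b r psi : R).

(** The squared distance from t e^{iy} to the pole r e^{i psi}, after a rotation
    by - psi. *)
Definition ker_den r psi p : R :=
  (p.1 * cos (p.2 - psi) - r) ^+ 2 + (p.1 * sin (p.2 - psi)) ^+ 2.

(** Real part of z / (z - r e^{i psi}) at z = t e^{iy}. Integrating this kernel
    against dt / t amounts to integrating dz / (z - r e^{i psi}) along a ray. *)
Definition kerRe r psi p : R := p.1 * (p.1 - r * cos (p.2 - psi)) / ker_den r psi p.
Definition kerIm r psi p : R := - (r * p.1 * sin (p.2 - psi)) / ker_den r psi p.

Lemma ker_denE r psi p : ker_den r psi p =
  (p.1 - r * cos (p.2 - psi)) ^+ 2 + (r * sin (p.2 - psi)) ^+ 2.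
Proof.
have := cos2Dsin2 (p.2 - psi); rewrite /ker_den.
set c := cos _; set s := sin _ => cs.
rewrite !exprMn; have -> : s ^+ 2 = 1 - c ^+ 2 by rewrite -cs; ring.
ring.
Qed.

Lemma ker_den_ge r psi p : 0 < r -> 0 < p.1 -> (p.1 - r) ^+ 2 <= ker_den r psi p.
Proof.
move=> r0 t0; rewrite ker_denE.
have := cos2Dsin2 (p.2 - psi); have := cos_le1 (p.2 - psi).
set c := cos _; set s := sin _ => c1 cs.
have := mulr_ge0 (ltW r0) (ltW t0).
have -> : (p.1 - r * c) ^+ 2 + (r * s) ^+ 2 =
   (p.1 - r) ^+ 2 + 2 * ((r * p.1) * (1 - c)) + r ^+ 2 * (c ^+ 2 + s ^+ 2 - 1) by ring.
move=> rt; rewrite cs subrr mulr0 addr0 lerDl mulr_ge0// mulr_ge0// subr_ge0//.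
Qed.

Lemma polar_holo_rot D psi :
  polar_holo D (fun p => p.1 * cos (p.2 - psi)) (fun p => p.1 * sin (p.2 - psi)).
Proof.
have := polar_holoM (polar_holo_cst D (cos psi) (- sin psi)) (polar_holo_id D).
congr polar_holo; apply/funext => p; rewrite ?cosB ?sinB; ring.
Qed.

Lemma polar_holo_ker D r psi : (forall p, D p -> ker_den r psi p != 0) ->
  polar_holo D (kerRe r psi) (kerIm r psi).
Proof.
move=> N0; have hz := polar_holo_rot D psi.
have hzr := polar_holoD hz (polar_holo_cst D (- r) 0).
have N0' p : D p -> (p.1 * cos (p.2 - psi) + - r) ^+ 2 + (p.1 * sin (p.2 - psi) + 0) ^+ 2 != 0.
  by move=> Dp; rewrite addr0; exact: N0.
have := polar_holoM hz (polar_holoV N0' hzr).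
congr polar_holo; apply/funext => p; rewrite /kerRe /kerIm addr0 -/(ker_den r psi p).
  have := cos2Dsin2 (p.2 - psi); set c := cos _; set s := sin _ => cs.
  rewrite !mulrA -mulrBl; congr (_ / _).
  have -> : p.1 * c * (p.1 * c - r) - p.1 * s * - (p.1 * s) =
    p.1 * (p.1 * (c ^+ 2 + s ^+ 2) - r * c) by ring.
  by rewrite cs mulr1.
by rewrite !mulrA -mulrDl; congr (_ / _); ring.
Qed.

(** Away from |z| = r by a factor 2, the kernel z / (z - r e^{i psi}) is bounded by
    a constant; this controls the arcs. *)
Lemma ker_le2 r psi p : 0 < r -> 0 < p.1 -> 2 * r <= p.1 \/ 2 * p.1 <= r ->
  `|kerRe r psi p| <= 2 /\ `|kerIm r psi p| <= 2.
Proof.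
move=> r0 t0 H.
have N4 : p.1 ^+ 2 / 4 <= ker_den r psi p.
  apply: le_trans (ker_den_ge psi r0 t0).
  have -> : (p.1 - r) ^+ 2 = p.1 ^+ 2 / 4 + (p.1 / 2 - r) * (3 * p.1 / 2 - r) by field.
  rewrite lerDl; case: H => H.
    by apply: mulr_ge0; lra.
  by rewrite -mulrNN; apply: mulr_ge0; lra.
have N0 : 0 < ker_den r psi p by apply: lt_le_trans N4; rewrite divr_gt0// exprn_gt0.
have S : kerRe r psi p ^+ 2 + kerIm r psi p ^+ 2 = p.1 ^+ 2 / ker_den r psi p.
  rewrite /kerRe /kerIm; move: (ker_denE r psi p) N0.
  set N := ker_den _ _ _; set c := cos _; set s := sin _ => NE N0.
  have -> : (p.1 * (p.1 - r * c) / N) ^+ 2 + (- (r * p.1 * s) / N) ^+ 2 =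
    p.1 ^+ 2 * ((p.1 - r * c) ^+ 2 + (r * s) ^+ 2) / N ^+ 2.
    by field; rewrite gt_eqF.
  by rewrite -NE; field; rewrite gt_eqF.
have S4 : kerRe r psi p ^+ 2 + kerIm r psi p ^+ 2 <= 2 ^+ 2.
  by rewrite S ler_pdivrMr//; move: N4; rewrite ler_pdivrMr//; lra.
have sq (x y : R) : x ^+ 2 + y ^+ 2 <= 2 ^+ 2 -> `|x| <= 2.
  move=> h; rewrite -(@ler_pXn2r _ 2)// ?nnegrE// real_normK ?num_real//.
  by apply: le_trans h; rewrite lerDl sqr_ge0.
by split; [exact: (sq _ _ S4)|apply: (sq _ (kerRe r psi p)); rewrite addrC].
Qed.

Section jump.
Variables (D : set (R * R)) (u v : R * R -> R) (a b r psi e0 : R).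
Hypothesis huv : polar_holo D u v.
Hypothesis a0 : 0 < a.
Hypothesis ar : a < r.
Hypothesis rb : r < b.
Hypothesis e00 : 0 < e0.
Hypothesis sD : rect a b (psi - e0) (psi + e0) `<=` D.

Let P p := kerRe r psi p * u p - kerIm r psi p * v p.
Let r0 : 0 < r. Proof. exact: lt_trans ar. Qed.
Let ab : a <= b. Proof. exact/ltW/(lt_trans ar). Qed.

Let N (c s t : R) := (t - r * c) ^+ 2 + (r * s) ^+ 2.

(** At angles psi + e and psi - e the kernels are conjugate to each other, so the
    difference of the integrands splits into a jump of u, which is small, and the
    Poisson kernel against the sum of the values of v. *)
Lemma jump_integrand (t e : R) : 0 < t ->
  P (t, psi + e) / t - P (t, psi - e) / t =
  (t - r * cos e) / N (cos e) (sin e) t * (u (t, psi + e) - u (t, psi - e)) +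
  r * sin e / N (cos e) (sin e) t * (v (t, psi + e) + v (t, psi - e)).
Proof.
move=> t0; rewrite /P /kerRe /kerIm !ker_denE /=.
have -> : psi + e - psi = e by ring.
have -> : psi - e - psi = - e by ring.
rewrite cosN sinN mulrN sqrrN -/(N (cos e) (sin e) t); set k := N _ _ _.
have [k0|k0] := eqVneq k 0.
  by rewrite k0 invr0 !mulr0 !mul0r !subr0 addr0 !mul0r subrr.
by field; rewrite k0 gt_eqF.
Qed.

(** The primitive of the Poisson kernel is an arc tangent. *)
Lemma poisson_int (c s : R) : 0 < s ->
  rint a b (fun t => r * s / N c s t) =
  atan ((b - r * c) / (r * s)) - atan ((a - r * c) / (r * s)).
Proof.
move=> s0; have rs0 : 0 < r * s by rewrite mulr_gt0.
have N0 t : N c s t != 0.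
  by rewrite gt_eqF// /N ltr_wpDl ?sqr_ge0// exprn_gt0.
apply: (@rint_FTC _ a b _ (fun t => atan ((t - r * c) / (r * s)))) => //.
  move=> t _; apply: continuousM; first exact: cst_continuous.
  apply: continuousV; first exact: N0.
  apply: continuousD; last exact: cst_continuous.
  apply: continuousM; apply: continuousB;
    [exact: cvg_id|exact: cst_continuous|exact: cvg_id|exact: cst_continuous].
move=> t _.
have d : is_derive t (1 : R) (fun t => (t - r * c) / (r * s)) (r * s)^-1.
  by apply: is_derive_eq; rewrite /GRing.scale/=; ring.
have := is_derive1_comp (f := atan) (g := fun t => (t - r * c) / (r * s))
  (is_derive1_atan _) d.
move=> h; apply: (is_derive_eq h).
move: (N0 t); rewrite /N /GRing.scale/=; set k := _ + _ => k0.
have -> : 1 + ((t - r * c) / (r * s)) ^+ 2 = k / (r * s) ^+ 2.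
  by rewrite /k; field; rewrite !gt_eqF.
by field; rewrite k0 !gt_eqF.
Qed.

Lemma trig_small : exists2 k : R, 0 < k & forall e, 0 < e < k ->
  [/\ e / 2 <= sin e, sin e <= 2 * e & 1 - cos e <= e].
Proof.
have hs : \forall h \near (0 : R), `|sin (h + 0) - sin 0 - cos 0 * h| <= 2^-1 * `|h|.
  exact: eps_is_derive.
have hc : \forall h \near (0 : R), `|cos (h + 0) - cos 0 - - sin 0 * h| <= 1 * `|h|.
  exact: eps_is_derive.
have hh : nbhs (0 : R) [set h | `|sin (h + 0) - sin 0 - cos 0 * h| <= 2^-1 * `|h| /\
  `|cos (h + 0) - cos 0 - - sin 0 * h| <= 1 * `|h|] by exact: filterI.
have [k /= k0 Hk] := (nbhs_ballP _ _).1 hh.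
exists k => // e /andP[ep ek].
have : ball 0 k e by rewrite /ball/= sub0r normrN gtr0_norm.
move=> /Hk[]; rewrite addr0 sin0 cos0 (gtr0_norm ep) subr0 oppr0 mul0r subr0 mul1r.
rewrite !ler_norml => /andP[s1 s2] /andP[c1 c2]; split; lra.
Qed.

Lemma lipschitz_rect : exists2 L : R, 0 < L & forall t y, a <= t <= b ->
  psi - e0 <= y <= psi + e0 ->
  [/\ `|u (t, y) - u (t, psi)| <= L * `|y - psi|,
      `|v (t, y) - v (t, psi)| <= L * `|y - psi| &
      `|v (t, psi) - v (r, psi)| <= L * `|t - r|].
Proof.
have [ut [vt h]] := huv.
have [M1 M10 HM1] : exists2 M : R, 0 < M & forall p, rect a b (psi - e0) (psi + e0) p -> `|ut p| <= M.
  by apply: rect_bounded => p /sD/h[_ []].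
have [M2 M20 HM2] : exists2 M : R, 0 < M & forall p, rect a b (psi - e0) (psi + e0) p -> `|vt p| <= M.
  by apply: rect_bounded => p /sD/h[_ []].
have b0 : 0 < b by rewrite (lt_trans r0).
exists ((b + 1) * (M1 + M2)) => [|t y tI yI].
  by rewrite mulr_gt0 ?addr_gt0.
have t0 : 0 < t by case/andP: tI => /(lt_le_trans a0).
have btw (z c : R) : psi - e0 <= z <= psi + e0 -> Num.min psi z <= c <= Num.max psi z ->
   psi - e0 <= c <= psi + e0.
  by case: (leP psi z) => pz /andP[h1 h2] /andP[h3 h4]; apply/andP; split; lra.
have btr (z c : R) : a <= z <= b -> Num.min r z <= c <= Num.max r z -> a <= c <= b.
  move: ar rb; case: (leP r z) => pz ar' rb' /andP[h1 h2] /andP[h3 h4]; apply/andP; split; lra.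
have pI : psi - e0 <= psi <= psi + e0 by apply/andP; split; move: e00; lra.
have bnd (x y' k : R) : `|x| <= k -> k <= (b + 1) * (M1 + M2) -> `|x * y'| <= (b + 1) * (M1 + M2) * `|y'|.
  by move=> h1 h2; rewrite normrM ler_wpM2r// (le_trans h1).
have tb : t <= b by case/andP: tI.
split.
- have [c cI ->] := @MVT_any _ (fun y => u (t, y)) (fun y => - (t * vt (t, y))) psi y
    (fun z hz => let: conj (And4 _ _ d _) _ := h (t, z) (@sD (t, z) (conj tI (btw _ _ yI hz))) in d).
  apply: (bnd _ _ (b * M2)); last by nra.
  rewrite normrN normrM (gtr0_norm t0) ler_pM ?(ltW t0)//.
  by apply: HM2; split => //; exact: btw cI.
- have [c cI ->] := @MVT_any _ (fun y => v (t, y)) (fun y => (t * ut (t, y))) psi y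
    (fun z hz => let: conj (And4 _ _ _ d) _ := h (t, z) (@sD (t, z) (conj tI (btw _ _ yI hz))) in d).
  apply: (bnd _ _ (b * M1)); last by nra.
  rewrite normrM (gtr0_norm t0) ler_pM ?(ltW t0)//.
  by apply: HM1; split => //; exact: btw cI.
- have [c cI ->] := @MVT_any _ (fun t => v (t, psi)) (fun t => vt (t, psi)) r t
    (fun z hz => let: conj (And4 _ d _ _) _ := h (z, psi) (@sD (z, psi) (conj (btr _ _ tI hz) pI)) in d).
  apply: (bnd _ _ M2); last by nra.
  by apply: HM2; split => //; exact: btr cI.
Qed.

(** With u and v Lipschitz near the ray of angle psi, the error in the jump is at
    most a constant times (|t - r cos e| e + e^2) / N. The first term is split as
    k N + e^2 / k with a free parameter k, so that the error becomes k plus a small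
    multiple of the Poisson integral. *)
Lemma jump_bound : exists A B : R, [/\ 0 < A, 0 < B &
  forall e k Q, 0 < e < e0 -> 0 < k -> e / 2 <= sin e -> sin e <= 2 * e ->
    1 - cos e <= e ->
    Q = rint a b (fun t => r * sin e / N (cos e) (sin e) t) ->
  `|(rint a b (fun t => P (t, psi + e) / t) - rint a b (fun t => P (t, psi - e) / t))
     - 2 * v (r, psi) * Q| <= A * k * (b - a) + (A / k + B) * (2 * e / r) * Q].
Proof.
have [L L0 HL] := lipschitz_rect.
(* The coefficients of k N + e^2 / k and of e^2 in the final estimate. *)
exists (L * (1 + 2 * r)), (4 * L * r * (1 + r)); split.
- by rewrite mulr_gt0// addr_gt0// mulr_gt0.
- by rewrite !mulr_gt0// addr_gt0.
move=> e k Q /andP[ep ee0] k0 s1 s2 c1 QE; set A := L * _; set B := 4 * _ * _ * _.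
set c := cos e in c1 QE; set s := sin e in s1 s2 QE.
have sp : 0 < s by apply: lt_le_trans s1; rewrite divr_gt0.
have N0 t : 0 < N c s t.
  by rewrite /N ltr_wpDl ?sqr_ge0// exprn_gt0// mulr_gt0.
have tpos t : a <= t <= b -> 0 < t by case/andP => /(lt_le_trans a0).
have yIp : psi - e0 <= psi + e <= psi + e0 by apply/andP; split; lra.
have yIm : psi - e0 <= psi - e <= psi + e0 by apply/andP; split; lra.
have kerden_ge y t : y = psi + e \/ y = psi - e -> ker_den r psi (t, y) = N c s t.
  rewrite ker_denE/=; case=> ->.
    by have -> : psi + e - psi = e by ring.
  have -> : psi - e - psi = - e by ring.
  by rewrite cosN sinN mulrN sqrrN.
have hP y : y = psi + e \/ y = psi - e -> ccont a b (fun t => P (t, y)).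
  move=> hy t tI.
  have hk : polar_holo (D `&` [set p | ker_den r psi p != 0]) (kerRe r psi) (kerIm r psi).
    by apply: polar_holo_ker => p [].
  have [ut [vt h]] := polar_holoM hk (polar_holoS (@subIsetl _ D _) huv).
  have [|/polar_CR_continuous1[]//] := h (t, y).
  split; first by apply: sD; split => //=; case: hy => ->.
  by rewrite /= kerden_ge// gt_eqF.
have cu y : psi - e0 <= y <= psi + e0 -> ccont a b (fun t => u (t, y)).
  by move=> yI t tI; have [ut [vt h]] := huv; have [|/polar_CR_continuous1[]] := h (t, y); first exact: sD.
have cv y : psi - e0 <= y <= psi + e0 -> ccont a b (fun t => v (t, y)).
  by move=> yI t tI; have [ut [vt h]] := huv; have [|/polar_CR_continuous1[]] := h (t, y); first exact: sD.
have cN : ccont a b (fun t => (N c s t)^-1).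
  move=> t _; apply: continuousV; first by rewrite gt_eqF.
  apply: continuousD; last exact: cst_continuous.
  apply: continuousM; apply: continuousB;
    [exact: cvg_id|exact: cst_continuous|exact: cvg_id|exact: cst_continuous].
have cp : ccont a b (fun t => r * s / N c s t).
  by move=> t tI; apply: continuousM; [exact: cst_continuous|exact: cN].
have cpv (C : R) : ccont a b (fun t => C * (r * s / N c s t)).
  by move=> t tI; apply: continuousM; [exact: cst_continuous|exact: cp].
have c1P := ccont_divt a0 (hP (psi + e) (or_introl erefl)).
have c2P := ccont_divt a0 (hP (psi - e) (or_intror erefl)).
rewrite [in leLHS]QE -rintB// -rintZ// -rintB//; last first.
  by move=> t tI; apply: continuousB; [exact: c1P|exact: c2P].
have -> : A * k * (b - a) + (A / k + B) * (2 * e / r) * Q =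
  rint a b (fun t => A * k + (A / k + B) * (2 * e / r) * (r * s / N c s t)).
  rewrite rintD//; last by move=> t _; exact: cst_continuous.
  by rewrite rint_cst// rintZ// -QE.
apply: rint_norm_le.
- move=> t tI; apply: continuousB; last exact: cpv.
  by apply: continuousB; [exact: c1P|exact: c2P].
- by move=> t tI; apply: continuousD; [exact: cst_continuous|exact: cpv].
move=> t tI; rewrite jump_integrand ?tpos// -/c -/s.
have [u1 v1 v3] := HL t _ tI yIp; have [u2 v2 _] := HL t _ tI yIm.
have ee1 : `|psi + e - psi| = e by rewrite addrAC subrr add0r gtr0_norm.
have ee2 : `|psi - e - psi| = e by rewrite addrAC subrr add0r normrN gtr0_norm.
rewrite ee1 in u1 v1; rewrite ee2 in u2 v2.
set X := t - r * c; have X2 : X ^+ 2 <= N c s t by rewrite /N lerDl sqr_ge0.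
have tr : `|t - r| <= `|X| + r * e.
  have -> : t - r = X - r * (1 - c) by rewrite /X; ring.
  rewrite (le_trans (ler_normB _ _))// lerD2l normrM (gtr0_norm r0) ler_pM2l//.
  by rewrite ger0_norm// subr_ge0 cos_le1.
(* Young's inequality with weight k. *)
have nX : 2 * (`|X| * e) <= k * N c s t + e ^+ 2 / k.
  have h1 : k * X ^+ 2 <= k * N c s t by rewrite ler_pM2l.
  have h2 : 0 <= (k * `|X| - e) ^+ 2 / k by rewrite divr_ge0 ?sqr_ge0// ltW.
  move: h2; have -> : (k * `|X| - e) ^+ 2 / k = k * `|X| ^+ 2 + e ^+ 2 / k - 2 * (`|X| * e).
    by field; rewrite gt_eqF.
  by rewrite real_normK ?num_real//; lra.
set up := u _; set um := u _; set vp := v _; set vm := v _; set v0 := v _.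
have -> : X / N c s t * (up - um) + r * s / N c s t * (vp + vm) - 2 * v0 * (r * s / N c s t)
 = (X * (up - um) + r * s * ((vp - v0) + (vm - v0))) / N c s t by ring.
have -> : A * k + (A / k + B) * (2 * e / r) * (r * s / N c s t) =
  (A * (k * N c s t) + (A / k + B) * (2 * e * s)) / N c s t.
  by field; rewrite !gt_eqF.
rewrite normrM normfV (gtr0_norm (N0 t)) ler_pM2r ?invr_gt0//.
have hu : `|up - um| <= 2 * L * e.
  have -> : up - um = (up - u (t, psi)) - (um - u (t, psi)) by ring.
  by rewrite (le_trans (ler_normB _ _))//; lra.
have hv : `|(vp - v0) + (vm - v0)| <= 2 * L * (e + (`|X| + r * e)).
  have h x : `|x - v (t, psi)| <= L * e -> `|x - v0| <= L * (e + (`|X| + r * e)).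
    move=> h1; have -> : x - v0 = (x - v (t, psi)) + (v (t, psi) - v0) by ring.
    rewrite (le_trans (ler_normD _ _))// mulrDr lerD// (le_trans v3)// ler_pM2l//.
  by rewrite (le_trans (ler_normD _ _))//; have := h _ v1; have := h _ v2; lra.
rewrite (le_trans (ler_normD _ _))// !normrM (gtr0_norm r0) (gtr0_norm sp).
have Xe0 : 0 <= `|X| by [].
have E1 : `|X| * `|up - um| <= L * (k * N c s t + e ^+ 2 / k).
  apply: (@le_trans _ _ (`|X| * (2 * L * e))); first by rewrite ler_wpM2l.
  have -> : `|X| * (2 * L * e) = L * (2 * (`|X| * e)) by ring.
  by rewrite ler_pM2l.
have E2 : r * s * `|vp - v0 + (vm - v0)| <=
   2 * L * r * (k * N c s t + e ^+ 2 / k) + 4 * L * r * (1 + r) * e ^+ 2.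
  apply: (@le_trans _ _ (r * (2 * e) * (2 * L * (e + (`|X| + r * e))))).
    by apply: ler_pM => //; [rewrite mulr_ge0// ltW|rewrite ler_pM2l].
  have -> : r * (2 * e) * (2 * L * (e + (`|X| + r * e))) =
    2 * L * r * (2 * (`|X| * e)) + 4 * L * r * (1 + r) * e ^+ 2 by ring.
  by rewrite lerD2r ler_pM2l// !mulr_gt0.
apply: le_trans (lerD E1 E2) _.
have es : e ^+ 2 <= 2 * e * s by rewrite expr2; nra.
have ek : e ^+ 2 / k <= (2 * e * s) / k by rewrite ler_pM2r ?invr_gt0.
have -> : L * (k * N c s t + e ^+ 2 / k) + (2 * L * r * (k * N c s t + e ^+ 2 / k) +
   4 * L * r * (1 + r) * e ^+ 2) = A * (k * N c s t) + A * (e ^+ 2 / k) + B * e ^+ 2.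
  by rewrite /A /B; ring.
rewrite -addrA lerD2l mulrDl lerD//.
  by rewrite -mulrA [k^-1 * _]mulrC ler_pM2l// /A mulr_gt0// addr_gt0// mulr_gt0.
by rewrite ler_pM2l// /B !mulr_gt0// addr_gt0.
Qed.
(** The arguments of the two arc tangents tend to infinity of both signs as e goes
    to 0. *)
Lemma poisson_limit (eta : R) : 0 < eta -> exists2 k : R, 0 < k & forall e, 0 < e < k ->
  pi - eta <= rint a b (fun t => r * sin e / N (cos e) (sin e) t) <= pi.
Proof.
move=> eta0.
have [K HK] : exists K : R, forall x, K <= x -> pi / 2 - eta / 2 <= atan x.
  have /cvgrPdist_le := @cvgy_atan R => /(_ (eta / 2)); rewrite divr_gt0// => /(_ isT).
  move=> [K [_ HK]]; exists (K + 1) => x Kx.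
  have Kx' : K < x by apply: lt_le_trans Kx; rewrite ltrDl.
  by have := HK _ Kx'; rewrite /= ler_norml => /andP[_]; lra.
pose K1 := Num.max K 1.
have K10 : 0 < K1 by rewrite lt_max ltr01 orbT.
have [k0 k00 Hk0] := trig_small.
have rb0 : 0 < b - r by rewrite subr_gt0.
have ra0 : 0 < r - a by rewrite subr_gt0.
exists (Num.min k0 (Num.min ((b - r) / (2 * r * K1)) ((r - a) / (4 * r * K1)))).
  by rewrite !lt_min k00 !divr_gt0//= !mulr_gt0.
move=> e; rewrite !lt_min => /andP[ep /and3P[ek0 ek1 ek2]].
have [|s1 s2 c1] := Hk0 e; first by rewrite ep.
have sp : 0 < sin e by apply: lt_le_trans s1; rewrite divr_gt0.
rewrite poisson_int//.
have rs0 : 0 < r * sin e by rewrite mulr_gt0.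
have cle := cos_le1 e.
move: ek1 ek2; rewrite !ltr_pdivlMr ?mulr_gt0// => ek1 ek2.
have K1g : 1 <= K1 by rewrite le_max lexx orbT.
have Kg : K <= K1 by rewrite le_max lexx.
have re0 : 0 < r * e by rewrite mulr_gt0.
have ub x := atan_ltpi2 (x : R); have lb x := atan_gtNpi2 (x : R).
have h1 : pi / 2 - eta / 2 <= atan ((b - r * cos e) / (r * sin e)).
  apply: HK; apply: (le_trans Kg); rewrite ler_pdivlMr//.
  have : K1 * (r * sin e) <= K1 * (r * (2 * e)) by rewrite !ler_pM2l.
  have : r * cos e <= r by rewrite ler_piMr// ltW.
  lra.
have h2 : pi / 2 - eta / 2 <= - atan ((a - r * cos e) / (r * sin e)).
  rewrite -atanN; apply: HK; apply: (le_trans Kg); rewrite -mulNr ler_pdivlMr//.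
  have : K1 * (r * sin e) <= K1 * (r * (2 * e)) by rewrite !ler_pM2l.
  have : r * (1 - cos e) <= r * e by rewrite ler_pM2l.
  have : r * e <= r * e * K1 by rewrite ler_peMr// ltW.
  lra.
have := ub ((b - r * cos e) / (r * sin e)).
have := lb ((a - r * cos e) / (r * sin e)).
by move=> h3 h4; apply/andP; split; lra.
Qed.

(** The residue at the pole: k is chosen first, to make the term A k (b - a) small,
    and then e. *)
Lemma jump_limit (eta : R) : 0 < eta -> exists2 k : R, 0 < k & forall e, 0 < e < k ->
  `|(rint a b (fun t => P (t, psi + e) / t) - rint a b (fun t => P (t, psi - e) / t))
     - 2 * pi * v (r, psi)| <= eta.
Proof.
move=> eta0; have [A [B [A0 B0 H]]] := jump_bound.
have ba0 : 0 < b - a by rewrite subr_gt0 (lt_trans ar).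
pose k := eta / (4 * A * (b - a)).
have k0 : 0 < k by rewrite divr_gt0// !mulr_gt0.
pose v0 := v (r, psi).
have pi0 := pi_gt0 R.
have V0 : 0 < 8 * (`|v0| + 1) by rewrite mulr_gt0// ltr_wpDl.
have [k1 k10 H1] := @poisson_limit (eta / (8 * (`|v0| + 1))) (divr_gt0 eta0 V0).
have [k2 k20 H2] := trig_small.
pose C := (A / k + B) * 2 * pi.
have AB0 : 0 < A / k + B by rewrite addr_gt0// divr_gt0.
have C0 : 0 < C by rewrite !mulr_gt0.
exists (Num.min e0 (Num.min k1 (Num.min k2 (eta * r / (4 * C))))).
  rewrite !lt_min e00 k10 k20 divr_gt0 ?mulr_gt0//.
move=> e; rewrite !lt_min => /andP[ep /and4P[ee0 ek1 ek2 ek3]].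
have [|s1 s2 c1] := H2 e; first by rewrite ep.
have := H1 e; rewrite ep ek1 => /(_ isT).
set Q := rint a b _ => /andP[Q1 Q2].
have := H e k Q; rewrite ep ee0 => /(_ isT k0 s1 s2 c1 erefl).
set W := rint a b _ - _ => HW.
have -> : W - 2 * pi * v0 = (W - 2 * v0 * Q) + 2 * v0 * (Q - pi) by ring.
rewrite (le_trans (ler_normD _ _))//.
have t1 : A * k * (b - a) = eta / 4 by rewrite /k; field; rewrite !gt_eqF.
have t2 : (A / k + B) * (2 * e / r) * Q <= eta / 4.
  apply: (@le_trans _ _ ((A / k + B) * (2 * e / r) * pi)).
    by rewrite ler_pM2l// !mulr_gt0 ?invr_gt0.
  have -> : (A / k + B) * (2 * e / r) * pi = C * e / r by rewrite /C; ring.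
  rewrite ler_pdivrMr//; move: ek3; rewrite ltr_pdivlMr ?mulr_gt0//; lra.
have t3 : `|2 * v0 * (Q - pi)| <= eta / 4.
  rewrite !normrM [`|2|]ger0_norm// distrC [`|pi - Q|]ger0_norm ?subr_ge0//.
  have : pi - Q <= eta / (8 * (`|v0| + 1)) by rewrite lerBlDl -lerBlDr.
  rewrite ler_pdivlMr// => h.
  have : 0 <= pi - Q by rewrite subr_ge0.
  move: h; set z := pi - Q; set w := `|v0|.
  have -> : z * (8 * (w + 1)) = 4 * (2 * w * z) + 8 * z by ring.
  lra.
lra.
Qed.

End jump.

Lemma ker_den_gt0 r psi p : 0 < r -> 0 < p.1 -> cos (p.2 - psi) < 1 ->
  0 < ker_den r psi p.
Proof.
move=> r0 t0 c1; rewrite ker_denE; have := cos2Dsin2 (p.2 - psi).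
set c := cos _ in c1 *; set s := sin _ => cs.
have -> : (p.1 - r * c) ^+ 2 + (r * s) ^+ 2 =
   (p.1 - r) ^+ 2 + 2 * ((r * p.1) * (1 - c)) + r ^+ 2 * (c ^+ 2 + s ^+ 2 - 1) by ring.
by rewrite cs subrr mulr0 addr0 ltr_wpDl ?sqr_ge0// !mulr_gt0// subr_gt0.
Qed.

Lemma cos_lt1 (x : R) : 0 < `|x| < pi -> cos x < 1.
Proof.
move=> /andP[x0 xpi].
have -> : cos x = cos `|x| by case: (ger0P x) => //; rewrite cosN.
by rewrite -[ltRHS]cos0 ltr_cos ?in_itv//= ?lexx ?pi_ge0// (ltW x0) (ltW xpi).
Qed.

Section sector_cauchy.
Variables (D : set (R * R)) (u v : R * R -> R) (Xi : R -> R) (phi e1 r psi : R).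
Hypothesis huv : polar_holo D u v.
Hypothesis phi0 : 0 < phi.
Hypothesis e10 : 0 < e1.
Hypothesis phi_e1 : phi + e1 < pi / 2.
Hypothesis sD : forall p, 0 < p.1 -> `|p.2| <= phi + e1 -> D p.
Hypothesis decay : forall p, 0 < p.1 -> `|p.2| <= phi -> `|u p| + `|v p| <= Xi p.1.
Hypothesis r0 : 0 < r.

Let P p := kerRe r psi p * u p - kerIm r psi p * v p.
Let S p := kerRe r psi p * v p + kerIm r psi p * u p.

Let arc p : 0 < p.1 -> `|p.2| <= phi -> 2 * r <= p.1 \/ 2 * p.1 <= r ->
  `|S p| <= 2 * Xi p.1.
Proof.
move=> t0 yI tr; have [k1 k2] := ker_le2 psi r0 t0 tr.
rewrite (le_trans (ler_normD _ _))// (normrM (kerRe _ _ _)) (normrM (kerIm _ _ _)).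
have := decay t0 yI => d.
apply: (@le_trans _ _ (2 * `|v p| + 2 * `|u p|)); last by lra.
by apply: lerD; apply: ler_wpM2r.
Qed.

Let piece a b c d e : 0 < a -> 2 * a <= r -> 2 * r <= b -> c <= d -> 0 < e ->
  - phi <= c -> d <= phi -> e <= e1 ->
  (forall y, c - e <= y <= d + e -> cos (y - psi) < 1) ->
  `|rint a b (fun t => P (t, d) / t) - rint a b (fun t => P (t, c) / t)|
     <= 4 * (Xi a + Xi b) * (d - c).
Proof.
move=> a0 ar rb cd e0 phic dphi ee1 Hc.
have ab : a <= b by lra.
have b0 : 0 < b by lra.
pose D' : set (R * R) := rect a b (c - e) (d + e).
have sD' : D' `<=` D.
  move=> p [/andP[h1 h2] /andP[h3 h4]]; apply: sD; first lra.
  by rewrite ler_norml; apply/andP; split; lra.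
have hk : polar_holo D' (kerRe r psi) (kerIm r psi).
  apply: polar_holo_ker => p [/andP[h1 h2] h3]; rewrite gt_eqF// ker_den_gt0//; first lra.
  exact: Hc.
have hPS := polar_holoM hk (polar_holoS sD' huv).
have H : `|rint a b (fun t => P (t, d) / t) - rint a b (fun t => P (t, c) / t)|
     <= 2 * (2 * (Xi a + Xi b)) * (d - c).
  apply: (angle_MVT hPS a0 ab cd e0 (fun _ h => h)) => y /andP[cy yd].
  have yI : `|y| <= phi by rewrite ler_norml; apply/andP; split; lra.
  have XiP t : 0 < t -> 0 <= Xi t.
    move=> t0; apply: le_trans (@decay (t, 0) t0 _); first by rewrite addr_ge0.
    by rewrite normr0 ltW.
  have := XiP _ a0; have := XiP _ b0 => ? ?.
  split.
    apply: (le_trans (@arc (b, y) b0 yI _)); first by left.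
    by rewrite /=; lra.
  apply: (le_trans (@arc (a, y) a0 yI _)); first by right.
  by rewrite /=; lra.
by apply: (le_trans H); rewrite mulrA; have -> : (2 * 2 : R) = 4 by ring.
Qed.

(** The pole lies outside the closed sector, hence no ray between the angles - phi
    and phi meets it and only the two arcs contribute. *)
Lemma sector_cauchy_outside a b : 0 < a -> 2 * a <= r -> 2 * r <= b ->
  (forall y, `|y| <= phi + e1 -> cos (y - psi) < 1) ->
  `|rint a b (fun t => P (t, phi) / t) - rint a b (fun t => P (t, - phi) / t)|
     <= 8 * phi * (Xi a + Xi b).
Proof.
move=> a0 ar rb Hc.
have -> : 8 * phi * (Xi a + Xi b) = 4 * (Xi a + Xi b) * (phi - - phi) by ring.
apply: (@piece a b (- phi) phi e1) => //; first by rewrite ge0_cp// ltW.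
move=> y /andP[y1 y2]; apply: Hc; rewrite ler_norml; apply/andP; split; lra.
Qed.

(** Rotate from phi down to psi + e and from psi - e down to - phi; the two arc terms
    add up to at most those of the whole sector, and the jump across the pole gives
    2 pi v. *)
Lemma sector_cauchy_inside a b : 0 < a -> 2 * a <= r -> 2 * r <= b ->
  `|psi| < phi ->
  `|rint a b (fun t => P (t, phi) / t) - rint a b (fun t => P (t, - phi) / t)
     - 2 * pi * v (r, psi)| <= 8 * phi * (Xi a + Xi b).
Proof.
move=> a0 ar rb; rewrite ltr_norml => /andP[psi1 psi2].
apply/ler_addgt0Pl => eta eta0.
have ab : a <= b by lra.
have b0 : 0 < b by lra.
pose e0 : R := Num.min (phi - psi) (psi + phi).
have e00 : 0 < e0 by rewrite lt_min; apply/andP; split; lra.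
have el1' : e0 <= phi - psi by rewrite ge_min lexx.
have el2' : e0 <= psi + phi by rewrite ge_min lexx orbT.
clearbody e0.
have sD0 : rect a b (psi - e0) (psi + e0) `<=` D.
  move=> p [/andP[h1 h2] /andP[h3 h4]]; apply: sD; first lra.
  have {}h3 : - phi <= p.2 by apply: le_trans h3; move: el2'; lra.
  have {}h4 : p.2 <= phi by apply: (le_trans h4); move: el1'; lra.
  by rewrite ler_norml; apply/andP; move: e10; split; lra.
have ar' : a < r by lra.
have rb' : r < b by lra.
have [k k0 Hk] := jump_limit huv a0 ar' rb' e00 sD0 eta0.
have [e [e_gt0 ek el1 el2]] : exists e : R,
    [/\ 0 < e, 0 < e < k, 2 * e <= phi - psi & 2 * e <= psi + phi].
  have ke : 0 < Num.min k e0 by rewrite lt_min k0.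
  have kl : Num.min k e0 <= k by rewrite ge_min lexx.
  have kl' : Num.min k e0 <= e0 by rewrite ge_min lexx orbT.
  by exists (Num.min k e0 / 2); split; lra.
have := Hk e ek; rewrite -/P.
(* Room for moving the end angles psi + e and psi - e without meeting the pole. *)
pose e' : R := Num.min e1 (e / 2).
have e'0 : 0 < e' by rewrite lt_min e10 divr_gt0.
have e'1 : e' <= e1 by rewrite ge_min lexx.
have e'2 : e' <= e / 2 by rewrite ge_min lexx orbT.
have pi0 := pi_gt0 R; clearbody e'.
have h1 := e10; have h2 := phi_e1; have h3 := phi0.
have H1 := @piece a b (psi + e) phi e' a0 ar rb _ e'0 _ (lexx _) e'1 _.
have H2 := @piece a b (- phi) (psi - e) e' a0 ar rb _ e'0 (lexx _) _ e'1 _.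
have {}H1 : `|rint a b (fun t => P (t, phi) / t) - rint a b (fun t => P (t, psi + e) / t)|
     <= 4 * (Xi a + Xi b) * (phi - (psi + e)).
  apply: H1; [lra|lra|].
  move=> y /andP[y1 y2]; apply: cos_lt1; rewrite gtr0_norm; last lra.
  by apply/andP; split; lra.
have {}H2 : `|rint a b (fun t => P (t, psi - e) / t) - rint a b (fun t => P (t, - phi) / t)|
     <= 4 * (Xi a + Xi b) * (psi - e - - phi).
  apply: H2; [lra|lra|].
  move=> y /andP[y1 y2]; apply: cos_lt1; rewrite ltr0_norm; last lra.
  by apply/andP; split; lra.
move: H1 H2; set I1 := rint a b _; set I2 := rint a b _; set I3 := rint a b _; set I4 := rint a b _.
move=> H1 H2 H3.
have -> : I1 - I4 - 2 * pi * v (r, psi) =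
  (I2 - I3 - 2 * pi * v (r, psi)) + ((I1 - I2) + (I3 - I4)) by ring.
rewrite (le_trans (ler_normD _ _))// lerD// (le_trans (ler_normD _ _))//.
apply: (le_trans (lerD H1 H2)).
have -> : 4 * (Xi a + Xi b) * (phi - (psi + e)) + 4 * (Xi a + Xi b) * (psi - e - - phi)
  = 8 * phi * (Xi a + Xi b) - 8 * e * (Xi a + Xi b) by ring.
rewrite gerBl; apply: mulr_ge0; first by rewrite mulr_ge0// ltW.
have XiP t : 0 < t -> 0 <= Xi t.
  move=> t0; apply: le_trans (@decay (t, 0) t0 _); first by rewrite addr_ge0.
  by rewrite normr0 ltW.
by rewrite addr_ge0// XiP.
Qed.

End sector_cauchy.
End kernel.

(** * Norm and imaginary units of the Clifford algebra *)

Section clifford_algebra.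
Context {R : realType} {d : nat}.
Local Notation cliff := (clifford R d).
Local Notation sg i := ([set i]%SET : {set 'I_d}).
Implicit Types (s t u J : cliff) (A B C : {set 'I_d}).

(** Sum of the absolute values of all structure constants of the Clifford algebra:
    a bound for the norm of the multiplication. *)
Definition Mnorm : R := #|{set 'I_d}|%:R * #|{set 'I_d}|%:R.

Lemma card_sets_ge1 : 1 <= #|{set 'I_d}|%:R :> R.
Proof. by rewrite ler1n; apply/card_gt0P; exists finset.set0. Qed.

Lemma Mnorm_ge1 : 1 <= Mnorm.
Proof. by rewrite /Mnorm -[leLHS]mul1r ler_pM ?card_sets_ge1. Qed.

Lemma Mnorm_gt0 : 0 < Mnorm.
Proof. exact: lt_le_trans Mnorm_ge1. Qed.

Lemma norm_le_coefs s (c : R) : (forall A, `|coef s A| <= c) ->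
  `|s| <= #|{set 'I_d}|%:R * c.
Proof.
move=> sc; apply: (le_trans (norm_le_sum s)).
by rewrite mulr_natl -sumr_const; apply: ler_sum => A _.
Qed.

Lemma norm_mul s t : `|s * t| <= Mnorm * (`|s| * `|t|).
Proof.
apply: (le_trans (norm_mull s t)); rewrite mulrA ler_wpM2r// /mul_bound -mulrA.
rewrite ler_wpM2l// mulr_natl -sumr_const; apply: ler_sum => A _.
exact: coef_le_norm.
Qed.

Lemma coef_one A : coef (1 : cliff) A = (A == finset.set0)%:R.
Proof. by rewrite -basis_elt0 coef_basis. Qed.

Lemma coef_sum (I : Type) (r : seq I) (P : pred I) (F : I -> cliff) A :
  coef (\sum_(i <- r | P i) F i) A = \sum_(i <- r | P i) coef (F i) A.
Proof.
exact: (big_morph (fun s => coef s A) (fun s t => coefD s t A) (coef0 A)).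
Qed.

Lemma sqr_cnorm s : `|s| ^+ 2 = \sum_A coef s A ^+ 2.
Proof. by rewrite cnormE sqr_sqrtr// sumr_ge0// => A _; exact: sqr_ge0. Qed.

Lemma real_partE s : real_part s = coef s finset.set0. Proof. by []. Qed.

Lemma coef_pure J A : paravector J -> real_part J = 0 -> #|A| != 1%N -> coef J A = 0.
Proof.
move=> pJ J0; case: (posnP #|A|) => [/eqP|A0 A1].
  by rewrite finset.cards_eq0 => /eqP-> _.
by apply: pJ; rewrite ltn_neqAle eq_sym A1.
Qed.

Lemma sum_pure J (F : {set 'I_d} -> R) : (forall A, #|A| != 1%N -> F A = 0) ->
  \sum_A F A = \sum_(i < d) F (sg i).
Proof.
move=> F0; rewrite (bigID (mem [set sg i | i : 'I_d]%SET)) /= [X in _ + X]big1 => [|A].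
  rewrite addr0 big_imset/=; last by move=> i j _ _; exact: finset.set1_inj.
  by apply: eq_bigl => i; rewrite inE.
move=> /imsetP AN; apply: F0; apply/negP => /cards1P[i Ai]; apply: AN.
by exists i.
Qed.

Lemma pure_sum J : paravector J -> real_part J = 0 ->
  J = \sum_(i < d) coef J (sg i) *: basis_elt (sg i).
Proof.
move=> pJ J0; apply: coefP => A; rewrite coef_sum.
under eq_bigr => i _ do rewrite coefZ coef_basis.
have [/cards1P[i ->]|A1] := boolP (#|A| == 1%N).
  rewrite (bigD1 i)//= eqxx mulr1 big1 ?addr0// => j ji.
  by rewrite (inj_eq finset.set1_inj) eq_sym (negbTE ji) mulr0.
rewrite coef_pure// big1// => i _; case: eqP => [Ai|]; last by rewrite mulr0.
by move: A1; rewrite Ai cards1.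
Qed.

(** In the product of the two expansions the mixed terms cancel by anticommutation. *)
Lemma pure_sqr J : paravector J -> real_part J = 0 -> J * J = - (`|J| ^+ 2)%:A.
Proof.
move=> pJ J0; set x := fun i => coef J (sg i).
have JE : J = \sum_(i < d) x i *: basis_elt (sg i) by exact: pure_sum.
have nJ : `|J| ^+ 2 = \sum_(i < d) x i ^+ 2.
  rewrite sqr_cnorm (@sum_pure J)// => A A1; rewrite coef_pure//.
  by rewrite expr0n.
have S : J * J = \sum_(i < d) \sum_(j < d) (x i * x j) *: (basis_elt (sg i) * basis_elt (sg j)).
  rewrite {1}JE mulr_suml; apply: eq_bigr => i _.
  rewrite {1}JE mulr_sumr; apply: eq_bigr => j _.
  by rewrite -scalerAl -scalerAr scalerA.
have S' : J * J = \sum_(i < d) \sum_(j < d) (x i * x j) *: (basis_elt (sg j) * basis_elt (sg i)).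
  rewrite S exchange_big; apply: eq_bigr => i _; apply: eq_bigr => j _.
  by rewrite mulrC.
have : J * J + J * J = - (`|J| ^+ 2)%:A + - (`|J| ^+ 2)%:A.
  transitivity (\sum_(i < d) (x i ^+ 2 *: (-1 : cliff) + x i ^+ 2 *: (-1 : cliff))).
    rewrite {1}S S' -big_split/=; apply: eq_bigr => i _; rewrite -big_split/=.
    rewrite (bigD1 i)//= big1 => [|j ji]; first by rewrite addr0 generator_sqr expr2.
    by rewrite (generator_anticomm ji) -scalerDr subrr scaler0.
  by rewrite big_split/= -scaler_suml scalerN nJ.
move=> H; have : 2%:R *: (J * J) = 2%:R *: (- (`|J| ^+ 2)%:A : cliff).
  by rewrite !scaler_nat !mulr2n.
by move=> /(congr1 (fun z => 2^-1 *: z)); rewrite !scalerA mulVf ?pnatr_eq0// !scale1r.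
Qed.

Lemma unit_sphere_sqr J : unit_sphere J -> J * J = -1.
Proof. by case=> pJ J0 J1; rewrite pure_sqr// J1 expr1n scale1r. Qed.

Lemma unit_sphere_nonempty : (1 <= d)%N -> exists J, unit_sphere J.
Proof.
move=> d1; pose i := Ordinal d1; exists (basis_elt (sg i)); split.
- move=> A A1; rewrite coef_basis; case: eqP => // Ai.
  by move: A1; rewrite Ai cards1.
- rewrite real_partE coef_basis; case: eqP => // /setP/(_ i).
  by rewrite !inE eqxx.
- apply/eqP; rewrite -(@eqrXn2 _ 2)// sqr_cnorm (bigD1 (sg i))//= big1 => [|A Ai].
    by rewrite coef_basis eqxx addr0.
  by rewrite coef_basis (negbTE Ai) expr0n.
Qed.

End clifford_algebra.
Arguments Mnorm R d : clear implicits.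

(** * Complex slices and reversion *)

Section complex_slices.
Context {R : realType} {d : nat}.
Local Notation cliff := (clifford R d).
Local Notation Re := (@complex.Re R).
Local Notation Im := (@complex.Im R).
Implicit Types (s t u J q : cliff) (A B C : {set 'I_d}) (z w : R[i]).

(** The embedding of the complex plane onto the slice C_J; a morphism of rings when
    J is an imaginary unit. *)
Definition cemb J z : cliff := (Re z)%:A + Im z *: J.

Definition sqnc z : R := Re z ^+ 2 + Im z ^+ 2.

Lemma cReM z w : Re (z * w) = Re z * Re w - Im z * Im w.
Proof. by case: z w => [a b] [a' b']. Qed.

Lemma cImM z w : Im (z * w) = Re z * Im w + Im z * Re w.
Proof. by case: z w => [a b] [a' b']. Qed.

Lemma sqncM z w : sqnc (z * w) = sqnc z * sqnc w.
Proof. by rewrite /sqnc cReM cImM; ring. Qed.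

Lemma sqnc_ge0 z : 0 <= sqnc z.
Proof. by rewrite addr_ge0 ?sqr_ge0. Qed.

Lemma sqnc_eq0 z : (sqnc z == 0) = (z == 0).
Proof.
case: z => a b; rewrite /sqnc /= paddr_eq0 ?sqr_ge0// !sqrf_eq0.
by apply/andP/eqP => [[/eqP-> /eqP->]//|[-> ->]].
Qed.

Lemma sqnc_gt0 z : z != 0 -> 0 < sqnc z.
Proof. by move=> z0; rewrite lt0r sqnc_eq0 z0 sqnc_ge0. Qed.

Lemma cReV z : Re z^-1 = Re z / sqnc z.
Proof. by case: z. Qed.

Lemma cImV z : Im z^-1 = - Im z / sqnc z.
Proof. by case: z => a b; rewrite /sqnc /= mulNr. Qed.

Lemma sqnc1 : sqnc 1 = 1.
Proof. by rewrite /sqnc /= expr1n expr0n addr0. Qed.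

Lemma sqncV z : sqnc z^-1 = (sqnc z)^-1.
Proof.
have [->|z0] := eqVneq z 0.
  by rewrite invr0 /sqnc /= expr0n /= addr0 invr0.
by apply: (mulfI (lt0r_neq0 (sqnc_gt0 z0))); rewrite -sqncM !divff ?sqnc1// sqnc_eq0.
Qed.

Lemma sqncX z m : sqnc (z ^+ m) = sqnc z ^+ m.
Proof. elim: m => [|m IH]; first by rewrite !expr0 sqnc1.
by rewrite !exprS sqncM IH. Qed.

Lemma cembD J z w : cemb J (z + w) = cemb J z + cemb J w.
Proof. by case: z w => [a b] [a' b']; rewrite /cemb /= !scalerDl addrACA. Qed.

Lemma cembN J z : cemb J (- z) = - cemb J z.
Proof. by case: z => a b; rewrite /cemb /= !scaleNr opprD. Qed.

Lemma cembB J z w : cemb J (z - w) = cemb J z - cemb J w.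
Proof. by rewrite cembD cembN. Qed.

Lemma cemb_real J (x : R) : cemb J (x +i* 0)%C = x%:A.
Proof. by rewrite /cemb /= scale0r addr0. Qed.

Lemma cemb1 J : cemb J 1 = 1.
Proof. by rewrite /cemb /= scale0r addr0 scale1r. Qed.

Lemma cemb_i J : cemb J 'i%C = J.
Proof. by rewrite /cemb /= scale0r add0r scale1r. Qed.

Lemma cembZ J (k : R) z : cemb J ((k +i* 0)%C * z) = k *: cemb J z.
Proof. by rewrite /cemb cReM cImM /= !mul0r subr0 addr0 scalerDr !scalerA. Qed.

Section unit.
Variable J : cliff.
Hypothesis HJ : unit_sphere J.

Lemma cembM z w : cemb J (z * w) = cemb J z * cemb J w.
Proof.
rewrite /cemb cReM cImM mulrDl !mulrDr -!scalerAl !mul1r -!scalerAr.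
by rewrite unit_sphere_sqr// mulr1 !scalerA scalerN scalerBl scalerDl addrACA [- _ + _]addrC.
Qed.

Lemma cembX z m : cemb J (z ^+ m) = cemb J z ^+ m.
Proof. elim: m => [|m IH]; first by rewrite !expr0 cemb1.
by rewrite !exprS cembM IH. Qed.

Lemma real_part_cemb z : real_part (cemb J z) = Re z.
Proof.
by case: HJ => _ J0 _; rewrite real_partE coefD !coefZ coef_one eqxx mulr1 -real_partE J0 mulr0 addr0.
Qed.

Lemma paravector_cemb z : paravector (cemb J z).
Proof.
case: HJ => pJ _ _ A A1; rewrite coefD !coefZ pJ// mulr0 addr0 coef_one.
by case: eqP => [A0|]; [rewrite A0 cards0 in A1|rewrite mulr0].
Qed.

Lemma sqr_norm_cemb z : `|cemb J z| ^+ 2 = sqnc z.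
Proof.
case: (HJ) => pJ J0 J1; rewrite sqr_cnorm (bigD1 finset.set0)//= -real_partE real_part_cemb.
congr (_ + _); have := J1 => /(congr1 (fun x => x ^+ 2)); rewrite expr1n sqr_cnorm.
rewrite (bigD1 finset.set0)//= -real_partE J0 expr0n add0r => S.
rewrite -[RHS]mulr1 -S mulr_sumr; apply: eq_bigr => A A0.
by rewrite coefD !coefZ coef_one (negbTE A0) mulr0 add0r exprMn.
Qed.

Lemma norm_cemb z : `|cemb J z| = Num.sqrt (sqnc z).
Proof. by rewrite -sqr_norm_cemb sqrtr_sqr normr_id. Qed.

Lemma conjc_cemb z : conjc (cemb J z) = cemb J (z^*)%C.
Proof.
case: (HJ) => pJ J0 J1; case: z => a b; apply: coefP => A.
have -> : coef (conjc (cemb J (a +i* b)%C)) A =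
  (-1) ^+ (#|A| * #|A|.+1)./2 * coef (cemb J (a +i* b)%C) A by rewrite /coef ffunE.
rewrite /cemb /= !coefD !coefZ coef_one mulNr.
have [/cards1P[i ->]|A1] := boolP (#|A| == 1%N).
  rewrite cards1 expr1 mulN1r; case: eqP => [/finset.setP/(_ i)|_].
    by rewrite !inE eqxx.
  by rewrite !mulr0 !add0r.
rewrite coef_pure// mulr0 oppr0 !addr0; case: eqP => [->|_]; last by rewrite !mulr0.
by rewrite cards0 expr0 mul1r.
Qed.

Lemma pinv_cemb z : pinv (cemb J z) = cemb J z^-1.
Proof.
rewrite /pinv conjc_cemb sqr_norm_cemb -cembZ; congr cemb.
by case: z => a b; simpc; rewrite /sqnc /= ![(_ + _)^-1 * _]mulrC.
Qed.

Lemma cemb_inj0 z : (cemb J z == 0) = (z == 0).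
Proof. by rewrite -normr_eq0 norm_cemb sqrtr_eq0 -sqnc_eq0 eq_le sqnc_ge0 andbT. Qed.

Lemma cembC z w : cemb J z * cemb J w = cemb J w * cemb J z.
Proof. by rewrite -!cembM mulrC. Qed.

End unit.

Lemma expcE J (y : R) : expc J y = cemb J (cos y +i* sin y)%C.
Proof. by []. Qed.

Lemma scale_expc J (t y : R) :
  t *: expc J y = cemb J ((t * cos y) +i* (t * sin y))%C.
Proof. by rewrite expcE -cembZ; congr cemb; simpc. Qed.

(** Every paravector lies in some slice; on the real axis any unit will do, and one
    exists since d >= 1. *)
Lemma paravector_decomp q : (1 <= d)%N -> paravector q ->
  exists J z, [/\ unit_sphere J, q = cemb J z & 0 <= Im z].
Proof.
move=> d1 pq; pose v : cliff := q - (real_part q)%:A.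
have pv : paravector v.
  move=> A A1; rewrite coefD coefN coefZ coef_one pq//.
  by case: eqP => [A0|]; [rewrite A0 cards0 in A1|rewrite mulr0 subrr].
have v0 : real_part v = 0.
  by rewrite real_partE coefD coefN coefZ coef_one eqxx mulr1 subrr.
have qE : q = (real_part q)%:A + v by rewrite /v addrC subrK.
have [v00|vn0] := eqVneq v 0.
  have [J HJ] := @unit_sphere_nonempty R d d1; exists J, (real_part q +i* 0)%C.
  by split => //; rewrite cemb_real {1}qE v00 addr0.
have nv0 : `|v| != 0 by rewrite normr_eq0.
exists (`|v|^-1 *: v), (real_part q +i* `|v|)%C; split => //.
  split.
  - by move=> A A1; rewrite coefZ pv// mulr0.
  - by rewrite real_partE coefZ -real_partE v0 mulr0.
  - by rewrite normrZ normfV normr_id mulVf.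
  by rewrite /cemb /= scalerA mulfV// scale1r.
exact: normr_ge0.
Qed.

(** The sign (-1)^(r (r - 1) / 2) of the permutation that reverses r factors: e_A e_A
    is that sign times (-1)^r, and csgn A A is the coefficient of e_A e_A. *)
Definition revsgn A : R := csgn R A A * \prod_(i in A) -1.

Lemma csgn_sqr A B : csgn R A B * csgn R A B = 1.
Proof.
rewrite /csgn -big_split /= big1// => i _; rewrite -big_split /= big1// => j _.
by rewrite mulrNN mulr1.
Qed.

Lemma revsgn_sqr A : revsgn A * revsgn A = 1.
Proof.
rewrite /revsgn mulrACA csgn_sqr mul1r -big_split /= big1// => i _.
by rewrite mulrNN mulr1.
Qed.

Lemma revsgn_symdiff A B :
  revsgn (symdiff A B) * csgn R A B = revsgn A * revsgn B * csgn R B A.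
Proof.
have P : \prod_(i in symdiff A B) -1 = (\prod_(i in A) -1) * (\prod_(i in B) -1) :> R.
  rewrite big_mkcond [X in X * _]big_mkcond [X in _ * X]big_mkcond -big_split.
  apply: eq_bigr => i _ /=; rewrite in_symdiff.
  by case: (i \in A); case: (i \in B); rewrite /= ?mulr1 ?mul1r ?mulrNN ?mulr1.
rewrite /revsgn P csgnDl !csgnDr.
transitivity (csgn R A A * csgn R B B * csgn R B A * (csgn R A B * csgn R A B) *
   ((\prod_(i in A) -1) * (\prod_(i in B) -1))); first by ring.
rewrite csgn_sqr; ring.
Qed.

(** Reversion, the anti-automorphism e_{i_1} ... e_{i_r} |-> e_{i_r} ... e_{i_1}. It
    exchanges left and right slice functions and S-resolvents. *)
Definition crev s : cliff := [ffun A => revsgn A * coef s A].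

Lemma coef_crev s A : coef (crev s) A = revsgn A * coef s A.
Proof. by rewrite /coef ffunE. Qed.

Lemma crevD s t : crev (s + t) = crev s + crev t.
Proof. by apply: coefP => A; rewrite coefD !coef_crev coefD mulrDr. Qed.

Lemma crevZ (k : R) s : crev (k *: s) = k *: crev s.
Proof. by apply: coefP => A; rewrite coefZ !coef_crev coefZ mulrCA. Qed.

Lemma crevN s : crev (- s) = - crev s.
Proof. by rewrite -scaleN1r crevZ scaleN1r. Qed.

Lemma crevB s t : crev (s - t) = crev s - crev t.
Proof. by rewrite crevD crevN. Qed.

Lemma crevK : involutive crev.
Proof.
by move=> s; apply: coefP => A; rewrite !coef_crev mulrA revsgn_sqr mul1r.
Qed.

Lemma norm_crev s : `|crev s| = `|s|.
Proof.
rewrite !cnormE; congr Num.sqrt; apply: eq_bigr => A _.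
by rewrite coef_crev exprMn [revsgn A ^+ 2]expr2 revsgn_sqr mul1r.
Qed.

Lemma crevM s t : crev (s * t) = crev t * crev s.
Proof.
apply: coefP => C; rewrite coef_crev !coefM mulr_sumr.
rewrite [RHS](reindex_inj (can_inj (symdiffK C))) /=; apply: eq_bigr => A _.
have -> : symdiff (symdiff C A) C = A by rewrite symdiffC symdiffK.
rewrite !coef_crev [symdiff C A]symdiffC; set B := symdiff A C.
have CE : C = symdiff A B by rewrite /B symdiffK.
rewrite {1}CE.
transitivity ((revsgn (symdiff A B) * csgn R A B) * (coef s A * coef t B)); first by ring.
rewrite revsgn_symdiff; ring.
Qed.

Lemma crev_paravector s : paravector s -> crev s = s.
Proof.
move=> ps; apply: coefP => A; rewrite coef_crev.
have [A1|] := ltnP 1 #|A|; first by rewrite ps// mulr0.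
rewrite leq_eqVlt ltnS leqn0 finset.cards_eq0 => /orP[/cards1P[i ->]|/eqP->].
  by rewrite /revsgn /csgn !big_set1 big_mkcondr big_set1 leqnn mulrNN !mul1r.
by rewrite /revsgn csgn0l big_set0 !mul1r.
Qed.

End complex_slices.

(** * Integrals of Clifford-valued functions *)

Section clifford_integral.
Context {R : realType} {d : nat}.
Local Notation cliff := (clifford R d).
Local Notation nd := (#|{set 'I_d}|%:R : R).
Implicit Types (F G : R -> cliff) (a b : R).

(** A function with values in a finite-dimensional space is integrated coordinatewise. *)
Definition cint a b F : cliff := [ffun A => rint a b (fun t => coef (F t) A)].

Definition ccontc a b F := forall A, ccont a b (fun t => coef (F t) A).

Lemma coef_cint a b F A : coef (cint a b F) A = rint a b (fun t => coef (F t) A).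
Proof. by rewrite /coef ffunE. Qed.

Lemma cint_eq a b F G : (forall t, a <= t <= b -> F t = G t) -> cint a b F = cint a b G.
Proof.
move=> FG; apply: coefP => A; rewrite !coef_cint; apply: rint_eq => t tI.
by rewrite FG.
Qed.

Lemma ccont_cst a b (c : R) : ccont a b (fun=> c).
Proof. by move=> t _; exact: cst_continuous. Qed.

Lemma ccont_sum (I : Type) (r : seq I) a b (f : I -> R -> R) :
  (forall i, ccont a b (f i)) -> ccont a b (fun t => \sum_(i <- r) f i t).
Proof.
move=> cf; elim: r => [|i r IH].
  by under eq_fun do rewrite big_nil; exact: ccont_cst.
under eq_fun do rewrite big_cons.
by move=> t tI; apply: continuousD; [exact: cf|exact: IH].
Qed.

Lemma rint_sum (I : Type) (r : seq I) a b (f : I -> R -> R) : a <= b ->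
  (forall i, ccont a b (f i)) ->
  rint a b (fun t => \sum_(i <- r) f i t) = \sum_(i <- r) rint a b (f i).
Proof.
move=> ab cf; elim: r => [|i r IH].
  by under eq_fun do rewrite big_nil; rewrite big_nil rint_cst// mul0r.
under eq_fun do rewrite big_cons.
by rewrite rintD// ?IH ?big_cons//; exact: ccont_sum.
Qed.

Lemma ccontc_mull (c : cliff) a b F : ccontc a b F -> ccontc a b (fun t => c * F t).
Proof.
move=> cF A; under eq_fun do rewrite coefM.
by apply: ccont_sum => B t tI; apply: continuousM; [exact: cst_continuous|exact: cF].
Qed.

Lemma cint_mull (c : cliff) a b F : a <= b -> ccontc a b F ->
  cint a b (fun t => c * F t) = c * cint a b F.
Proof.
move=> ab cF; apply: coefP => A; rewrite coef_cint coefM.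
under eq_fun do rewrite coefM.
rewrite rint_sum// => [|B]; last first.
  by move=> t tI; apply: continuousM; [exact: cst_continuous|exact: cF].
by apply: eq_bigr => B _; rewrite rintZ ?coef_cint//; exact: cF.
Qed.

Lemma cintB a b F G : ccontc a b F -> ccontc a b G ->
  cint a b (fun t => F t - G t) = cint a b F - cint a b G.
Proof.
move=> cF cG; apply: coefP => A; rewrite coefD coefN !coef_cint.
by under eq_fun do rewrite coefD coefN; exact: rintB.
Qed.

Definition lip_on a b (L : R) F := forall t t', a <= t <= b -> a <= t' <= b ->
  `|F t - F t'| <= L * `|t - t'|.

Lemma coefB (s t : cliff) A : coef (s - t) A = coef s A - coef t A.
Proof. by rewrite coefD coefN. Qed.

Definition loc_lip F := forall a b, 0 < a -> a <= b -> exists2 L, 0 <= L & lip_on a b L F.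

Lemma lip_on_ccontc a b F : 0 < a -> loc_lip F -> ccontc a b F.
Proof.
move=> a0 lF A t /andP[ta tb]; have t0 : 0 < t by exact: lt_le_trans ta.
have [L L0 HL] := lF (t / 2) (t * 2) ltac:(by rewrite divr_gt0) ltac:(lra).
apply/cvgrPdist_le => e e0.
have Le : 0 < e / (L + 1) by rewrite divr_gt0// ltr_wpDl.
have k0 : 0 < Num.min (e / (L + 1)) (t / 2) by rewrite lt_min Le divr_gt0.
apply/nbhs_ballP; exists (Num.min (e / (L + 1)) (t / 2)) => //= s.
rewrite /ball/= lt_min => /andP[s1 s2].
have tI : t / 2 <= t <= t * 2 by apply/andP; split; lra.
have sI : t / 2 <= s <= t * 2.
  by move: s2; rewrite ltr_distlC => /andP[h1 h2]; apply/andP; split; lra.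
rewrite -coefB (le_trans (coef_le_norm _ _))// (le_trans (HL _ _ tI sI))//.
apply: (@le_trans _ _ ((L + 1) * `|t - s|)); first by rewrite ler_wpM2r// lerDl.
by rewrite mulrC -ler_pdivlMr ?ltW// ltr_wpDl.
Qed.

(** On each subinterval a Lipschitz function differs from its value at the tag by at
    most L times the mesh. *)
Lemma riemann_sum_real a b (L : R) (f : R -> R) delta n (x xi : nat -> R) :
  0 <= L -> ccont a b f ->
  (forall t t', a <= t <= b -> a <= t' <= b -> `|f t - f t'| <= L * `|t - t'|) ->
  tagged_partition a b delta n x xi ->
  `|\sum_(i < n) (x i.+1 - x i) * f (xi i) - rint a b f| <= L * delta * (b - a).
Proof.
move=> L0 cf lf [x0 xn Hx].
have step i : (i < n)%N -> x i <= x i.+1 by move=> /Hx[/le_trans + /[swap] _]; apply.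
have mono i j : (i <= j <= n)%N -> x i <= x j.
  move=> /andP[]; elim: j => [|j IH]; first by rewrite leqn0 => /eqP->.
  rewrite leq_eqVlt => /predU1P[->//|ij] jn.
  by apply: le_trans (IH ij (ltnW jn)) (step _ jn).
have xI i : (i <= n)%N -> a <= x i <= b.
  by move=> i_n; rewrite -x0 -xn !mono ?i_n ?leqnn.
suff H m : (m <= n)%N ->
    `|\sum_(i < m) (x i.+1 - x i) * f (xi i) - rint a (x m) f| <= L * delta * (x m - a).
  by have := H n (leqnn n); rewrite xn.
have cs u w : a <= u -> w <= b -> ccont u w f.
  by move=> au wb t /andP[ut tw]; apply: cf; rewrite (le_trans au ut) (le_trans tw).
elim: m => [|m IH] mn.
  rewrite big_ord0 x0 subrr mulr0 sub0r normrN.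
  have -> : rint a a f = 0 by rewrite /rint set_itv1 Rintegral_set1.
  by rewrite normr0.
have /andP[xm1 xm2] := xI _ (ltnW mn); have /andP[xs1 xs2] := xI _ mn.
have sm := step _ mn; have [h1 h2 h3] := Hx _ mn.
rewrite big_ord_recr/= (@rint_Chasles _ a (x m) (x m.+1))//; last exact: cs.
have -> (p q r s : R) : p + q - (r + s) = (p - r) + (q - s) by ring.
rewrite (le_trans (ler_normD _ _))//.
have -> : L * delta * (x m.+1 - a) = L * delta * (x m - a) + L * delta * (x m.+1 - x m) by ring.
apply: lerD; first exact/IH/ltnW.
rewrite [_ * f _]mulrC -(@rint_cst _ (x m) (x m.+1) (f (xi m)))//.
rewrite -rintB//; [|exact: ccont_cst|exact: cs].
rewrite -(@rint_cst _ (x m) (x m.+1) (L * delta))//.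
apply: rint_norm_le.
- by move=> t tI; apply: continuousB; [exact: cst_continuous|exact: (cs (x m) (x m.+1))].
- exact: ccont_cst.
move=> t /andP[t1 t2]; apply: (le_trans (lf _ _ _ _)).
- by rewrite (le_trans xm1 h1) (le_trans h2).
- by rewrite (le_trans xm1 t1) (le_trans t2).
rewrite ler_wpM2l// ler_distl; apply/andP; split; lra.
Qed.

Lemma riemann_sum_cint a b (L : R) F delta n (x xi : nat -> R) :
  0 <= L -> ccontc a b F -> lip_on a b L F -> tagged_partition a b delta n x xi ->
  `|\sum_(i < n) (x i.+1 - x i) *: F (xi i) - cint a b F| <= nd * (L * delta * (b - a)).
Proof.
move=> L0 cF lF Hx; apply: norm_le_coefs => A.
rewrite coefB coef_sum coef_cint; under eq_bigr do rewrite coefZ.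
apply: (@riemann_sum_real a b L (fun t => coef (F t) A)) => //.
move=> t t' tI t'I; rewrite -coefB (le_trans (coef_le_norm _ _))//; exact: lF.
Qed.

End clifford_integral.

(** * Integrals along rays *)

Section improper.
Context {R : realType} {d : nat}.
Local Notation cliff := (clifford R d).
Local Notation nd := (#|{set 'I_d}|%:R : R).
Variable delta : R.
Hypothesis delta0 : 0 < delta.

(** An increasing bijection of (0, +oo) onto (0, 1). Its derivative, of order
    t^(delta - 1) at 0 and t^(- delta - 1) at infinity, is the integrable function
    of t that dominates all integrands along rays; Theta(a) and Theta(1 / b)
    measure the tails at 0 and at infinity. *)
Definition Theta (t : R) : R := t `^ delta / (1 + t `^ delta).
Definition dTheta (t : R) : R := delta * t `^ (delta - 1) / (1 + t `^ delta) ^+ 2.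

Lemma powR_den_gt0 (t : R) : 0 < 1 + t `^ delta.
Proof. by rewrite ltr_wpDr ?powR_ge0. Qed.

Lemma Theta_derive (t : R) : 0 < t -> is_derive t (1 : R) Theta (dTheta t).
Proof.
move=> t0; have D := powR_den_gt0 t.
have -> : Theta = fun t => 1 - (1 + t `^ delta)^-1.
  apply/funext => s; rewrite /Theta; have Ds := powR_den_gt0 s.
  by field; rewrite gt_eqF.
have dp : is_derive t (1 : R) (fun t => t `^ delta) (delta * t `^ (delta - 1)).
  exact: is_derive1_powR.
have dd : is_derive t (1 : R) (fun t => 1 + t `^ delta) (delta * t `^ (delta - 1)).
  have h := is_deriveD (is_derive_cst (1 : R) t 1) dp.
  by rewrite add0r in h; exact: h.
have di := is_deriveV (f := fun t => 1 + t `^ delta) (lt0r_neq0 D) dd.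
have h := is_deriveB (is_derive_cst (1 : R) t 1) di.
apply: (is_derive_eq h); rewrite /GRing.scale/= /dTheta.
by field; rewrite gt_eqF.
Qed.

Lemma dTheta_ge0 (t : R) : 0 <= dTheta t.
Proof. by rewrite /dTheta divr_ge0 ?sqr_ge0// mulr_ge0 ?powR_ge0// ltW. Qed.

Lemma dTheta_continuous (t : R) : 0 < t -> {for t, continuous dTheta}.
Proof.
have cp (e : R) s : 0 < s -> {for s, continuous (fun t => t `^ e)}.
  move=> s0; apply/differentiable_continuous/derivable1_diffP.
  have h : is_derive s (1 : R) (fun t => t `^ e) (e * s `^ (e - 1)) by exact: is_derive1_powR.
  exact: ex_derive.
move=> t0; apply: continuousM.
  by apply: continuousM; [exact: cst_continuous|exact: cp].
have cd : {for t, continuous (fun t => 1 + t `^ delta)}.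
  by apply: continuousD; [exact: cst_continuous|exact: cp].
apply: continuousV; first by rewrite sqrf_eq0 gt_eqF// powR_den_gt0.
exact: (continuousM cd cd).
Qed.

Lemma rint_dTheta (a b : R) : 0 < a -> a <= b -> rint a b dTheta = Theta b - Theta a.
Proof.
move=> a0 ab; apply: rint_FTC => // t /andP[/(lt_le_trans a0) t0 _].
  exact: dTheta_continuous.
exact: Theta_derive.
Qed.

Lemma Theta_ge0 (t : R) : 0 <= Theta t.
Proof. by rewrite /Theta divr_ge0 ?powR_ge0// ltW// powR_den_gt0. Qed.

Lemma Theta_le1 (t : R) : Theta t <= 1.
Proof. by rewrite /Theta ler_pdivrMr ?powR_den_gt0// mul1r lerDr. Qed.

Lemma ThetaV (t : R) : 0 < t -> Theta t^-1 = 1 - Theta t.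
Proof.
move=> t0; rewrite /Theta -powR_inv1 ?ltW// -powRrM mulN1r powRN.
have p0 := powR_gt0 delta t0; have D := powR_den_gt0 t.
by field; rewrite !gt_eqF// addrC.
Qed.

Lemma Theta_homo (a b : R) : 0 < a -> a <= b -> Theta a <= Theta b.
Proof.
move=> a0 ab; have b0 := lt_le_trans a0 ab.
have pab : a `^ delta <= b `^ delta by rewrite ge0_ler_powR ?nnegrE// ltW.
rewrite /Theta ler_pdivrMr ?powR_den_gt0// mulrAC ler_pdivlMr ?powR_den_gt0//; lra.
Qed.

Lemma Theta_lim0 (e : R) : 0 < e -> exists2 r : R, 0 < r & forall a, 0 < a -> a < r -> Theta a <= e.
Proof.
move=> e0; exists (e `^ delta^-1); first exact: powR_gt0.
move=> a a0 ar; rewrite /Theta ler_pdivrMr ?powR_den_gt0//.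
apply: (@le_trans _ _ e); last by rewrite ler_peMr ?lerDl ?powR_ge0// ltW.
have -> : e = (e `^ delta^-1) `^ delta by rewrite -powRrM mulVf ?gt_eqF// powRr1// ltW.
by rewrite ge0_ler_powR ?nnegrE ?powR_ge0 ?ltW.
Qed.

Section one.
Variables (F : R -> cliff) (C : R).
Hypothesis C0 : 0 <= C.
Hypothesis lF : loc_lip F.
Hypothesis bF : forall t, 0 < t -> `|F t| <= C * dTheta t.

Let inv n : R := n.+1%:R^-1.
Let inv_gt0 n : 0 < inv n. Proof. by rewrite invr_gt0. Qed.

Definition ray_int_seq A (n : nat) : R := rint n.+1%:R^-1 n.+1%:R (fun t => coef (F t) A).

(** The improper integral over (0, +oo), as a limit over the intervals
    [1 / (n + 1), n + 1]. *)
Definition cray : cliff := [ffun A => limn (ray_int_seq A)].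

Lemma rint_coef_le A (a b : R) : 0 < a -> a <= b ->
  `|rint a b (fun t => coef (F t) A)| <= C * (Theta b - Theta a).
Proof.
move=> a0 ab; rewrite -rint_dTheta// -rintZ; last first.
  by move=> t /andP[/(lt_le_trans a0) t0 _]; exact: dTheta_continuous.
apply: rint_norm_le.
- exact: lip_on_ccontc.
- move=> t /andP[/(lt_le_trans a0) t0 _]; apply: continuousM; first exact: cst_continuous.
  exact: dTheta_continuous.
move=> t /andP[/(lt_le_trans a0) t0 _]; rewrite (le_trans (coef_le_norm _ _))//; exact: bF.
Qed.

Lemma rint_coef_tail A (a b a' b' : R) : 0 < a' -> a' <= a -> a <= b -> b <= b' ->
  `|rint a b (fun t => coef (F t) A) - rint a' b' (fun t => coef (F t) A)| <=
  C * (Theta a + Theta b^-1).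
Proof.
move=> a'0 a'a ab bb'; have a0 := lt_le_trans a'0 a'a; have b0 := lt_le_trans a0 ab.
have cF u w : 0 < u -> ccont u w (fun t => coef (F t) A).
  by move=> u0; exact: lip_on_ccontc.
rewrite (@rint_Chasles _ a' a b')// ?(le_trans ab)//; last exact: cF.
rewrite (@rint_Chasles _ a b b')//; last exact: cF.
have -> (x y z : R) : x - (y + (x + z)) = - (y + z) by ring.
rewrite normrN (le_trans (ler_normD _ _))//.
apply: (le_trans (lerD (rint_coef_le A a'0 a'a) (rint_coef_le A b0 bb'))).
rewrite -mulrDr ler_wpM2l// ThetaV//.
have := Theta_ge0 a'; have := Theta_le1 b'; lra.
Qed.

(** The integrals over these intervals form a Cauchy sequence by the tail estimate. *)
Lemma ray_int_seq_cvg A : cvgn (ray_int_seq A).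
Proof.
apply: cauchy_cvg; apply/cauchy_exP => e e0.
have [r r0 Hr] := @Theta_lim0 (e / (4 * (C + 1))) ltac:(by rewrite divr_gt0// mulr_gt0// ltr_wpDl).
have [N HN] : exists N, N.+1%:R^-1 < r.
  exists (Num.truncn r^-1); rewrite invf_plt ?posrE//.
  exact: truncnS_gt.
exists (ray_int_seq A N); exists N => // n /= Nn.
rewrite /ball/= /ray_int_seq.
have NnR : (N.+1%:R : R) <= n.+1%:R by rewrite ler_nat.
have N1 : (1 : R) <= N.+1%:R by rewrite ler1n.
have i1 : (N.+1%:R^-1 : R) <= 1 by rewrite invf_le1.
apply: le_lt_trans (@rint_coef_tail A _ _ _ _ _ _ _ _) _ => //.
- by rewrite lef_pV2 ?posrE.
- exact: le_trans i1 N1.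
have T := Hr _ (inv_gt0 N) HN.
apply: (@le_lt_trans _ _ (C * (e / (4 * (C + 1)) + e / (4 * (C + 1))))).
  by rewrite ler_wpM2l// lerD.
have -> : C * (e / (4 * (C + 1)) + e / (4 * (C + 1))) = (e / 2) * (C / (C + 1)).
  by field; rewrite gt_eqF// ltr_wpDl.
apply: (@le_lt_trans _ _ (e / 2)); last by lra.
by rewrite ler_piMr ?ler_pdivrMr ?mul1r ?lerDl// ?ltr_wpDl//; lra.
Qed.

Lemma cray_tail A (a b : R) : 0 < a -> a <= b ->
  `|coef cray A - rint a b (fun t => coef (F t) A)| <= C * (Theta a + Theta b^-1).
Proof.
move=> a0 ab; have b0 := lt_le_trans a0 ab.
rewrite [coef cray A]ffunE distrC.
apply/ler_addgt0Pl => e e0.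
have /cvgrPdist_le/(_ _ e0)[N _ HN] := @ray_int_seq_cvg A.
pose n := maxn N (maxn (Num.truncn a^-1) (Num.truncn b)).
have nN : (N <= n)%N by rewrite leq_maxl.
have n1 : n.+1%:R^-1 <= a.
  rewrite invf_ple ?posrE//; apply: (le_trans (ltW (truncnS_gt _))).
  by rewrite ler_nat ltnS /n !leq_max leqnn !orbT.
have n2 : b <= n.+1%:R.
  apply: (le_trans (ltW (truncnS_gt _))).
  by rewrite ler_nat ltnS /n !leq_max leqnn !orbT.
have H1 := HN n nN; have H2 := @rint_coef_tail A a b _ _ (inv_gt0 n) n1 ab n2.
set y := limn _ in H1 *; set x := rint _ _ _ in H2 *; set z := ray_int_seq A n in H1.
have -> : x - y = (x - z) + - (y - z) by ring.
rewrite (le_trans (ler_normD _ _))// normrN addrC lerD//.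
Qed.

Lemma cray_approx (a b : R) : 0 < a -> a <= b ->
  `|cray - cint a b F| <= nd * (C * (Theta a + Theta b^-1)).
Proof.
move=> a0 ab; apply: norm_le_coefs => A; rewrite coefB coef_cint.
exact: cray_tail.
Qed.

Lemma cray_bound : `|cray| <= nd * (C * 2).
Proof.
apply: norm_le_coefs => A.
have := @cray_tail A 1 1 ltr01 (lexx _).
have -> : rint 1 1 (fun t => coef (F t) A) = 0 by rewrite /rint set_itv1 Rintegral_set1.
rewrite subr0 invr1 => /le_trans; apply; rewrite ler_wpM2l//.
have := Theta_le1 1; lra.
Qed.

End one.
End improper.

(** * Multiplication operators *)

Section multiplication_operators.
Context {R : realType} {d : nat} {disp : measure_display}
  {X : measurableType disp} {mu : {measure set X -> \bar R}}.
Local Notation cliff := (clifford R d).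
Local Notation V := (L2 d mu).
Local Notation Mn := (Mnorm R d).
Implicit Types (g k : X -> cliff) (u v : V) (T : @operator R d disp X mu).

Lemma mul_op_ae g g' : {ae mu, forall x, g x = g' x} -> mul_op mu g = mul_op mu g'.
Proof.
move=> gg; apply/seteqP; split => -[u v] /= uv; apply: filterS2 gg uv => x.
  by move=> <-.
by move=> ->.
Qed.

Lemma mul_op_fun g u v v' : mul_op mu g (u, v) -> mul_op mu g (u, v') -> v = v'.
Proof. by move=> h h'; apply: L2P; apply: filterS2 h h' => x /= -> ->. Qed.

Lemma cmeasurable_repr u : cmeasurable (reprL2 u).
Proof. by rewrite /reprL2; case: (repr u) => v /= /asboolP[]. Qed.

Lemma sq_integral_repr_fin u : sq_integral mu (reprL2 u) \is a fin_num.
Proof.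
rewrite ge0_fin_numE ?sq_integral_ge0//.
by rewrite /reprL2; case: (repr u) => v /= /asboolP[].
Qed.

Lemma normL2E' u : `|u| = Num.sqrt (fine (sq_integral mu (reprL2 u))).
Proof. by []. Qed.

Lemma norm_le_ae u v (c : R) : 0 <= c ->
  {ae mu, forall x, `|reprL2 v x| <= c * `|reprL2 u x|} -> `|v| <= c * `|u|.
Proof.
move=> c0 vu; rewrite !normL2E' -[c]ger0_norm// -sqrtr_sqr -sqrtrM ?sqr_ge0//.
rewrite ler_wsqrtr// -lee_fin EFinM !fineK ?sq_integral_repr_fin//.
have mv := measurable_sqnorm (cmeasurable_repr v).
have mu_ := measurable_sqnorm (cmeasurable_repr u).
rewrite /sq_integral -ge0_integralZl_EFin ?sqr_ge0//.
apply: ae_ge0_le_integral => //.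
- by move=> x _; rewrite -EFinM lee_fin mulr_ge0// sqr_ge0.
- exact/measurable_funeM.
apply: filterS vu => x vu _; rewrite -EFinM lee_fin -exprMn ler_pXn2r ?nnegrE//.
exact: mulr_ge0.
Qed.

(** Measurable bounded multipliers: those whose multiplication operator is everywhere
    defined, so that sums and compositions do not shrink domains. *)
Definition bmult k := cmeasurable k /\ exists2 c : R, 0 <= c & forall x, `|k x| <= c.

Lemma bmult_cst (s : cliff) : bmult (fun=> s).
Proof. by split; [exact: cmeasurable_cst|exists `|s|]. Qed.

Lemma cmeasurableD' g g' : cmeasurable g -> cmeasurable g' ->
  cmeasurable (fun x => g x + g' x).
Proof. by move=> h h'; have := cmeasurableD h h'. Qed.

Lemma bmultD k k' : bmult k -> bmult k' -> bmult (fun x => k x + k' x).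
Proof.
move=> [mk [c c0 kc]] [mk' [c' c'0 kc']]; split; first exact: cmeasurableD'.
exists (c + c') => [|x]; first exact: addr_ge0.
by rewrite (le_trans (ler_normD _ _))// lerD.
Qed.

Lemma bmultM k k' : bmult k -> bmult k' -> bmult (fun x => k x * k' x).
Proof.
move=> [mk [c c0 kc]] [mk' [c' c'0 kc']]; split; first exact: cmeasurableM.
exists (Mn * (c * c')) => [|x]; first by rewrite !mulr_ge0// ltW// Mnorm_gt0.
by rewrite (le_trans (norm_mul _ _))// ler_pM2l ?Mnorm_gt0// ler_pM.
Qed.

Lemma bmultN k : bmult k -> bmult (fun x => - k x).
Proof.
move=> /(bmultM (bmult_cst (-1))).
by under eq_fun do rewrite mulN1r.
Qed.

Lemma bmultB k k' : bmult k -> bmult k' -> bmult (fun x => k x - k' x).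
Proof. by move=> h h'; apply: bmultD => //; exact: bmultN. Qed.

Lemma bmultZ (c : R) k : bmult k -> bmult (fun x => c *: k x).
Proof.
move=> /(bmultM (bmult_cst c%:A)).
by under eq_fun do rewrite -scalerAl mul1r.
Qed.

Lemma bmult_sum n (k : nat -> X -> cliff) : (forall i, (i < n)%N -> bmult (k i)) ->
  bmult (fun y => \sum_(i < n) k i y).
Proof.
elim: n => [|n IH] bk.
  by under eq_fun do rewrite big_ord0; exact: bmult_cst.
under eq_fun do rewrite big_ord_recr/=.
apply: bmultD; last exact: bk.
by apply: IH => i i_n; apply: bk; exact: ltnW.
Qed.

Lemma bmult_total k u : bmult k -> exists v, mul_op mu k (u, v).
Proof.
move=> [mk [c c0 kc]].
have H : (fun x => k x * reprL2 u x) \in @sq_integrable R d _ _ mu.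
  apply: (@sq_integrable_dominated _ _ _ _ _ (Mn * c) (reprL2 u)).
  - exact: cmeasurableM (cmeasurable_repr u).
  - move=> x; rewrite (le_trans (norm_mul _ _))// -mulrA ler_pM2l ?Mnorm_gt0//.
    by rewrite ler_wpM2r.
  - by rewrite /reprL2; case: (repr u).
by exists (classL2 (mkL2fun H)); exact: reprL2K.
Qed.

(** The constant Mnorm appears because the Clifford norm is not multiplicative. *)
Lemma mul_op_opnorm k (c : R) : 0 <= c -> (forall x, `|k x| <= c) ->
  opnorm_le (mul_op mu k) (Mn * c).
Proof.
move=> c0 kc u v uv; apply: norm_le_ae.
  by rewrite mulr_ge0// ltW// Mnorm_gt0.
apply: filterS uv => x /= ->; rewrite (le_trans (norm_mul _ _))//.
by rewrite -mulrA ler_pM2l ?Mnorm_gt0// ler_wpM2r.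
Qed.

Lemma reprL2_0 : {ae mu, forall x, reprL2 (0 : V) x = 0}.
Proof.
have E : scaleL2 0 (0 : V) = 0 by exact: (scale0r (0 : V)).
have := scaleL2E 0 (0 : V); rewrite E.
by apply: filterS => x ->; rewrite scale0r.
Qed.

Lemma mul_op_right_linear k : right_linear (mul_op mu k).
Proof.
split.
- by apply: filterS reprL2_0 => x /= ->; rewrite mulr0.
- move=> u v u' v' /= uv u'v'; rewrite /mul_op /=.
  apply: filterS2 (reprL2D v v') (filterI (reprL2D u u') (filterI uv u'v')).
  by move=> x -> [-> [-> ->]]; rewrite mulrDr.
- move=> u v s /= uv; rewrite /mul_op /=.
  apply: filterS2 (rmulL2E s v) (filterI (rmulL2E s u) uv).
  by move=> x -> [-> ->]; rewrite mulrA.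
Qed.

Lemma bmult_bounded k : bmult k -> bounded_op (mul_op mu k).
Proof.
move=> bk; split; first exact: mul_op_right_linear.
- move=> u; have [v uv] := bmult_total u bk; exists v; split => // v'.
  exact: mul_op_fun.
- by case: bk => mk [c c0 kc]; exists (Mn * c); exact: mul_op_opnorm.
Qed.

Lemma op_cliffE (s : cliff) : op_cliff s = mul_op mu (fun=> s).
Proof.
apply/seteqP; split => -[u v]; rewrite /op_cliff /mul_op /=.
  by move=> ->; exact: lmulL2E.
by move=> uv; apply: L2P; apply: filterS2 uv (lmulL2E s u) => x -> ->.
Qed.

Lemma op_add_mul g k : bmult k ->
  op_add (mul_op mu g) (mul_op mu k) = mul_op mu (fun x => g x + k x).
Proof.
move=> bk; apply/seteqP; split => -[u w] /=.
  move=> [v [v' [/= gv kv ->]]]; rewrite /mul_op /=.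
  apply: filterS2 (reprL2D v v') (filterI gv kv) => x -> [-> ->].
  by rewrite mulrDl.
move=> uw; have [v kv] := bmult_total u bk; exists (w - v), v; split => //=; last by rewrite subrK.
have D := reprL2D (w - v) v; rewrite subrK in D.
apply: filterS2 D (filterI uw kv) => x Dx [/= E1 E2].
by apply: (addIr (reprL2 v x)); rewrite -Dx E1 E2 mulrDl.
Qed.

Lemma op_addC S T : op_add S T = op_add T S.
Proof.
have H S' T' : op_add S' T' `<=` op_add T' S'.
  by move=> [u w] [v [v' [h h' E]]]; exists v', v; split => //; rewrite addrC.
by apply/seteqP; split; exact: H.
Qed.

Lemma op_comp_mul g k : bmult k ->
  op_comp (mul_op mu g) (mul_op mu k) = mul_op mu (fun x => g x * k x).
Proof.
move=> bk; apply/seteqP; split => -[u w] /=.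
  by move=> [v /= uv vw]; apply: filterS2 uv vw => x -> ->; rewrite mulrA.
move=> uw; have [v kv] := bmult_total u bk; exists v => //=.
by apply: filterS2 uw kv => x /= -> ->; rewrite mulrA.
Qed.

(** For c = 0 this fails in general: the left-hand side has the domain of M_g only. *)
Lemma op_scale_mul (c : R) g : c != 0 ->
  op_scale c (mul_op mu g) = mul_op mu (fun x => c *: g x).
Proof.
move=> c0; apply/seteqP; split => -[u w] /=.
  move=> [v /= uv]; rewrite op_cliffE => vw; apply: filterS2 uv vw => x /= -> ->.
  by rewrite -scalerAl mul1r scalerAl.
move=> uw; exists (c^-1 *: w); last first.
  by rewrite op_cliffE /=; apply: filterS (scaleL2E c^-1 w) => x ->; rewrite -scalerAl mul1r scalerA divff// scale1r.
by apply: filterS2 (scaleL2E c^-1 w) uw => x -> ->; rewrite -scalerAl scalerA mulVf// scale1r.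
Qed.

Lemma op_scale_bmult (c : R) k : bmult k ->
  op_scale c (mul_op mu k) = mul_op mu (fun x => c *: k x).
Proof.
move=> bk; rewrite /op_scale op_cliffE op_comp_mul//.
by congr mul_op; apply/funext => x; rewrite -scalerAl mul1r.
Qed.

Lemma op_sub_mul g k : bmult k ->
  op_sub (mul_op mu g) (mul_op mu k) = mul_op mu (fun x => g x - k x).
Proof.
move=> bk; rewrite /op_sub op_scale_bmult// op_add_mul; last exact: bmultZ.
by congr mul_op; apply/funext => x; rewrite scaleN1r.
Qed.

Lemma op_sub_mul_l g k : bmult k ->
  op_sub (mul_op mu k) (mul_op mu g) = mul_op mu (fun x => k x - g x).
Proof.
move=> bk; rewrite /op_sub op_scale_mul ?oppr_eq0 ?oner_eq0// op_addC op_add_mul//.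
by congr mul_op; apply/funext => x; rewrite scaleN1r addrC.
Qed.

Lemma op_sub_opnorm k k' (c : R) : bmult k -> bmult k' -> 0 <= c ->
  (forall x, `|k x - k' x| <= c) -> opnorm_le (op_sub (mul_op mu k) (mul_op mu k')) (Mn * c).
Proof. by move=> bk bk' c0 H; rewrite op_sub_mul//; exact: mul_op_opnorm. Qed.

Lemma riemann_sum_mul (F : R -> X -> cliff) n (x xi : nat -> R) :
  (forall i, (i < n)%N -> bmult (F (xi i))) ->
  riemann_sum (fun t => mul_op mu (F t)) n x xi =
  mul_op mu (fun y => \sum_(i < n) (x i.+1 - x i) *: F (xi i) y).
Proof.
rewrite /riemann_sum; elim: n x xi => [|n IH] x xi bF.
  by rewrite big_ord0 op_cliffE; congr mul_op; apply/funext => y; rewrite big_ord0.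
rewrite big_ord_recl (IH (fun i => x i.+1) (fun i => xi i.+1)); last first.
  by move=> i i_n; exact: bF.
rewrite op_scale_bmult; last exact: bF.
rewrite op_add_mul.
  by congr mul_op; apply/funext => y; rewrite big_ord_recl.
by apply: (@bmult_sum n (fun i y => (x i.+2 - x i.+1) *: F (xi i.+1) y)) => i i_n; apply: bmultZ; exact: bF.
Qed.

Lemma op_subP S T u w : op_sub S T (u, w) <->
  exists v v', [/\ S (u, v), T (u, v') & w = v - v'].
Proof.
have cN (v : V) : lmulL2 (-1)%:A v = - v by rewrite -[LHS]/(-1 *: v) scaleN1r.
split.
  move=> [v [v'' [/= Suv [v' Tuv' E] wE]]]; exists v, v'; split => //.
  by rewrite wE (_ : v'' = - v') // -cN.
move=> [v [v' [Suv Tuv' ->]]]; exists v, (- v'); split => //=.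
by exists v' => //; rewrite /op_cliff /= cN.
Qed.

Lemma op_sub_trans S T T' (c c' : R) : (forall u, exists v, T (u, v)) ->
  opnorm_le (op_sub S T) c -> opnorm_le (op_sub T T') c' ->
  opnorm_le (op_sub S T') (c + c').
Proof.
move=> totT h h' u w /op_subP[v [v' [Suv T'uv ->]]].
have [z Tuz] := totT u.
have h1 : `|v - z| <= c * `|u| by apply: h; apply/op_subP; exists v, z.
have h2 : `|z - v'| <= c' * `|u| by apply: h'; apply/op_subP; exists z, v'.
by rewrite -(subrKA z) (le_trans (ler_normD _ _))// mulrDl lerD.
Qed.

Lemma op_sub_sym S T (c : R) : opnorm_le (op_sub S T) c -> opnorm_le (op_sub T S) c.
Proof.
move=> h u w /op_subP[v [v' [Tuv Suv ->]]].
by rewrite distrC; apply: h; apply/op_subP; exists v', v.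
Qed.

(** Everywhere defined operators at norm distance zero coincide; this gives the
    uniqueness of operator-valued integrals. *)
Lemma op_sub_small_eq S T : (forall u, exists! v, S (u, v)) ->
  (forall u, exists! v, T (u, v)) ->
  (forall e, 0 < e -> opnorm_le (op_sub S T) e) -> S = T.
Proof.
move=> fS fT H.
have E u v v' : S (u, v) -> T (u, v') -> v = v'.
  move=> Suv Tuv; apply/eqP; rewrite -subr_eq0 -normr_eq0 eq_le normr_ge0 andbT.
  apply/ler_addgt0Pl => e e0; rewrite addr0.
  have e1 : 0 < e / (`|u| + 1) by rewrite divr_gt0// ltr_wpDl.
  apply: (@le_trans _ _ (e / (`|u| + 1) * `|u|)).
    by apply: (H _ e1); apply/op_subP; exists v, v'.
  by rewrite -mulrA ger_pMr// mulrC ler_pdivrMr ?mul1r ?lerDl// ltr_wpDl.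
apply/seteqP; split => -[u v] h.
  by have [v' [T' _]] := fT u; rewrite (E _ _ _ h T').
by have [v' [S' _]] := fS u; rewrite -(E _ _ _ S' h).
Qed.

Lemma uniform_partition (a b delta : R) : a <= b -> 0 < delta ->
  exists n x, tagged_partition a b delta n x x.
Proof.
move=> ab d0; pose n := (Num.truncn ((b - a) / delta)).+1.
have n0 : 0 < n%:R :> R by rewrite ltr0n.
exists n, (fun i => a + i%:R * ((b - a) / n%:R)); split.
- by rewrite mul0r addr0.
- by rewrite mulrC divfK ?gt_eqF// addrC subrK.
- move=> i i_n; split => //.
    by rewrite lerD2l ler_wpM2r ?ler_nat// divr_ge0 ?subr_ge0// ltW.
  have -> : a + i.+1%:R * ((b - a) / n%:R) - (a + i%:R * ((b - a) / n%:R)) = (b - a) / n%:R.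
    by rewrite -natr1; ring.
  by rewrite ltr_pdivrMr// mulrC -ltr_pdivrMr// truncnS_gt.
Qed.

Lemma tagged_partition_gt0 a b e n (x xi : nat -> R) : 0 < a -> tagged_partition a b e n x xi ->
  forall i, (i < n)%N -> 0 < xi i.
Proof.
move=> a0 [x0 xn Hx] i i_n; have [h1 _ _] := Hx _ i_n; apply: lt_le_trans h1.
elim: i i_n => [|i IH] i_n; first by rewrite x0.
have [h1 h2 _] := Hx _ (ltnW i_n).
exact: lt_le_trans (IH (ltnW i_n)) (le_trans h1 h2).
Qed.

Section ray_family.
Variables (F : R -> X -> cliff) (C delta : R).
Hypothesis delta0 : 0 < delta.
Hypothesis C0 : 0 <= C.
Hypothesis mF : forall t, 0 < t -> cmeasurable (F t).
Hypothesis lF : forall a b, 0 < a -> a <= b -> exists2 L, 0 <= L & forall x, lip_on a b L (F ^~ x).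
Hypothesis bF : forall t x, 0 < t -> `|F t x| <= C * dTheta delta t.

Let loc x : loc_lip (F ^~ x).
Proof. by move=> a b a0 ab; have [L L0 H] := lF a0 ab; exists L. Qed.

Let bm t : 0 < t -> bmult (F t).
Proof.
move=> t0; split; first exact: mF.
by exists (C * dTheta delta t) => [|x]; [rewrite mulr_ge0// dTheta_ge0|exact: bF].
Qed.

(** The integral is a pointwise limit of Riemann sums along uniform partitions. *)
Lemma cint_measurable a b : 0 < a -> a <= b ->
  cmeasurable (fun x => cint a b (F ^~ x)).
Proof.
move=> a0 ab A.
have [L L0 HL] := lF a0 ab.
have /choice[n Hn] : forall m : nat, exists n, exists x, tagged_partition a b m.+1%:R^-1 n x x.
  by move=> m; apply: uniform_partition; rewrite ?invr_gt0.
have /choice[p Hp] := Hn.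
apply: (@measurable_fun_cvg _ _ _ _
  (fun m x => coef (\sum_(i < n m) (p m i.+1 - p m i) *: F (p m i) x) A)).
  move=> m; have [+ _] : bmult (fun x => \sum_(i < n m) (p m i.+1 - p m i) *: F (p m i) x).
    by apply: (@bmult_sum (n m) (fun i x => (p m i.+1 - p m i) *: F (p m i) x)) => i i_n; apply/bmultZ/bm; exact: tagged_partition_gt0 (Hp m) _ i_n.
  exact.
move=> x _; apply/cvgrPdist_le => e e0.
pose K := #|{set 'I_d}|%:R * (L * (b - a)) : R.
have K0 : 0 <= K by rewrite !mulr_ge0// subr_ge0.
near=> m.
rewrite -coefB (le_trans (coef_le_norm _ _))// distrC.
apply: (le_trans (@riemann_sum_cint _ _ a b L _ m.+1%:R^-1 _ _ _ L0 _ (HL x) (Hp m))).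
  exact: lip_on_ccontc.
have -> : #|{set 'I_d}|%:R * (L * m.+1%:R^-1 * (b - a)) = K * m.+1%:R^-1 by rewrite /K; ring.
rewrite ler_pdivrMr// -ler_pdivrMl//.
near: m; exists (Num.truncn (e^-1 * K)) => // m /= Km.
by apply: (le_trans (ltW (truncnS_gt _))); rewrite ler_nat ltnS.
Unshelve. all: by end_near. Qed.

Definition rayX x : cliff := cray (F ^~ x).

Lemma rayX_measurable : cmeasurable rayX.
Proof.
move=> A; apply: (@measurable_fun_cvg _ _ _ _
  (fun m x => coef (cint m.+1%:R^-1 m.+1%:R (F ^~ x)) A)).
  move=> m; apply: cint_measurable; first by rewrite invr_gt0.
  by apply: (@le_trans _ _ 1); rewrite ?ler1n// invf_le1// ler1n.
move=> x _; rewrite [coef (rayX x) A]ffunE.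
have := @ray_int_seq_cvg _ _ _ delta0 _ _ C0 (@loc x) (bF^~ x) A.
rewrite /ray_int_seq => h; under eq_fun do rewrite coef_cint; exact: h.
Qed.

Lemma rayX_bmult : bmult rayX.
Proof.
split; first exact: rayX_measurable.
exists (#|{set 'I_d}|%:R * (C * 2)) => [|x]; first by rewrite !mulr_ge0.
exact: (@cray_bound _ _ _ delta0 _ _ C0 (@loc x) (bF^~ x)).
Qed.

Lemma cint_bmult a b : 0 < a -> a <= b -> bmult (fun x => cint a b (F ^~ x)).
Proof.
move=> a0 ab; split; first exact: cint_measurable.
exists (#|{set 'I_d}|%:R * (C * (Theta delta b - Theta delta a))) => [|x].
  by rewrite !mulr_ge0// subr_ge0 Theta_homo.
apply: norm_le_coefs => A; rewrite coef_cint.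
exact: (rint_coef_le (@loc x) (bF^~ x) A a0 ab).
Qed.

Let opF t := mul_op mu (F t).

Lemma riemann_int_mul a b : 0 < a -> a <= b ->
  is_riemann_int opF a b (mul_op mu (fun x => cint a b (F ^~ x))).
Proof.
move=> a0 ab; have [L L0 HL] := lF a0 ab; split.
- by move=> t /andP[ta _]; apply/bmult_bounded/bm/(lt_le_trans a0).
- exact/bmult_bounded/cint_bmult.
move=> eps eps0.
pose K := Mn * (#|{set 'I_d}|%:R * (L * (b - a))) + 1 : R.
have K0 : 0 < K by rewrite ltr_wpDl// !mulr_ge0// ?subr_ge0// ltW// Mnorm_gt0.
exists (eps / K); first by rewrite divr_gt0.
move=> n x xi Hx; have bxi i (i_n : (i < n)%N) : bmult (F (xi i)) := bm (tagged_partition_gt0 a0 Hx i_n).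
rewrite riemann_sum_mul// => u v uv.
have := @op_sub_opnorm (fun y => \sum_(i < n) (x i.+1 - x i) *: F (xi i) y)
  (fun x => cint a b (F ^~ x)) (#|{set 'I_d}|%:R * (L * (eps / K) * (b - a))).
have bs : bmult (fun y => \sum_(i < n) (x i.+1 - x i) *: F (xi i) y).
  by apply: (@bmult_sum n (fun i y => (x i.+1 - x i) *: F (xi i) y)) => i i_n; apply/bmultZ/bxi.
move=> /(_ bs (cint_bmult a0 ab) _ _ u v uv) h.
have {}h : `|v| <= Mn * (#|{set 'I_d}|%:R * (L * (eps / K) * (b - a))) * `|u|.
  apply: h; first by rewrite !mulr_ge0// ?subr_ge0// ?invr_ge0 ltW.
  by move=> y; apply: riemann_sum_cint => //; exact: lip_on_ccontc.
apply: (le_trans h); rewrite ler_wpM2r//.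
have -> : Mn * (#|{set 'I_d}|%:R * (L * (eps / K) * (b - a))) = eps / K * (K - 1).
  by rewrite /K; ring.
by rewrite -mulrA ger_pMr// mulrC ler_pdivrMr// mul1r gerBl.
Qed.

Lemma riemann_int_unique a b B : 0 < a -> a <= b -> is_riemann_int opF a b B ->
  B = mul_op mu (fun x => cint a b (F ^~ x)).
Proof.
move=> a0 ab [_ [_ fB _] HB]; have [_ [_ fM _] HM] := riemann_int_mul a0 ab.
apply: op_sub_small_eq => // e e0.
have e2 : 0 < e / 2 by rewrite divr_gt0.
have [d1 d10 H1] := HB _ e2; have [d2 d20 H2] := HM _ e2.
have [|n [x Hx]] := @uniform_partition a b (Num.min d1 d2) ab; first by rewrite lt_min d10.
have Hx1 : tagged_partition a b d1 n x x.
  case: Hx => h1 h2 h3; split => // i i_n; have [p1 p2 p3] := h3 _ i_n; split => //.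
  by rewrite (lt_le_trans p3)// ge_min lexx.
have Hx2 : tagged_partition a b d2 n x x.
  case: Hx => h1 h2 h3; split => // i i_n; have [p1 p2 p3] := h3 _ i_n; split => //.
  by rewrite (lt_le_trans p3)// ge_min lexx orbT.
rewrite (splitr e); apply: (@op_sub_trans _ (riemann_sum opF n x x)).
- move=> u; rewrite riemann_sum_mul; last first.
    by move=> i i_n; exact/bm/(tagged_partition_gt0 a0 Hx1).
  apply: bmult_total; apply: (@bmult_sum n (fun i y => (x i.+1 - x i) *: F (x i) y)) => i i_n.
  exact/bmultZ/bm/(tagged_partition_gt0 a0 Hx1 i_n).
- exact/op_sub_sym/H1.
- exact: H2.
Qed.

(** Integration in operator norm commutes with forming multiplication operators: the Riemann sums and the
    truncated integrals converge uniformly in x, and uniform convergence of bounded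
    multipliers is convergence of operators. *)
Lemma improper_int_mul : improper_int opF = mul_op mu rayX.
Proof.
have M0 : 0 < Mn := Mnorm_gt0.
have P : is_improper_int opF (mul_op mu rayX).
  split; first exact/bmult_bounded/rayX_bmult.
  move=> eps eps0.
  pose K := Mn * (#|{set 'I_d}|%:R * (C * 2)) + 1 : R.
  have K0 : 0 < K by rewrite ltr_wpDl// !mulr_ge0// ltW// Mnorm_gt0.
  have eK : 0 < eps / K by rewrite divr_gt0.
  have [r r0 Hr] := @Theta_lim0 _ _ delta0 _ eK.
  exists r => // a b a0 ar rb ab.
  exists (mul_op mu (fun x => cint a b (F ^~ x))); first exact: riemann_int_mul.
  have b0 := lt_le_trans a0 ab.
  have br : b^-1 < r by rewrite invf_plt ?posrE.
  have h1 := Hr _ a0 ar; have h2 := Hr b^-1 ltac:(by rewrite invr_gt0) br.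
  move=> u v uv; apply: (le_trans (@op_sub_opnorm _ _ (#|{set 'I_d}|%:R * (C * (eps / K + eps / K)))
    (cint_bmult a0 ab) rayX_bmult _ _ u v uv)).
  - by rewrite !mulr_ge0// addr_ge0// ltW.
  - move=> x; rewrite distrC.
    apply: (le_trans (@cray_approx _ _ _ delta0 _ _ C0 (@loc x) (bF^~ x) a b a0 ab)).
    by rewrite ler_wpM2l// ler_wpM2l// lerD.
  rewrite ler_wpM2r//.
  have -> : Mn * (#|{set 'I_d}|%:R * (C * (eps / K + eps / K))) = eps / K * (K - 1).
    by rewrite /K; ring.
  by rewrite -mulrA ger_pMr// mulrC ler_pdivrMr// mul1r gerBl.
have [[_ fA _] HA] := xgetI set0 P.
have [[_ fM _] HM] := P.
apply: op_sub_small_eq => // e e0.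
have e2 : 0 < e / 2 by rewrite divr_gt0.
have [r1 r10 H1] := HA _ e2; have [r2 r20 H2] := HM _ e2.
pose r := Num.min 1 (Num.min r1 r2).
have r_gt0 : 0 < r by rewrite !lt_min r10 r20 ltr01.
have rr1 : r <= r1 by rewrite !ge_min lexx orbT.
have rr2 : r <= r2 by rewrite !ge_min lexx !orbT.
have r1' : r <= 1 by rewrite ge_min lexx.
have a0 : 0 < r / 2 by rewrite divr_gt0.
have rV : 1 <= r^-1 by rewrite invf_ge1.
have ab : r / 2 <= r^-1 + 1 by lra.
have lt1 : r1^-1 < r^-1 + 1 by rewrite (@le_lt_trans _ _ r^-1) ?ltrDl// lef_pV2 ?posrE.
have lt2 : r2^-1 < r^-1 + 1 by rewrite (@le_lt_trans _ _ r^-1) ?ltrDl// lef_pV2 ?posrE.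
have ar : r / 2 < r by lra.
have [B1 /(riemann_int_unique a0 ab) -> HB1] := H1 _ _ a0 (lt_le_trans ar rr1) lt1 ab.
have [B2 /(riemann_int_unique a0 ab) -> HB2] := H2 _ _ a0 (lt_le_trans ar rr2) lt2 ab.
rewrite (splitr e); apply: op_sub_trans (op_sub_sym HB1) HB2.
by move=> u; exact/bmult_total/cint_bmult.
Qed.

End ray_family.

End multiplication_operators.

(** * Resolvents and regularized products of multiplication operators *)

Section resolvents.
Context {R : realType} {d : nat} {disp : measure_display}
  {X : measurableType disp} {mu : {measure set X -> \bar R}}.
Local Notation cliff := (clifford R d).
Local Notation V := (L2 d mu).
Local Notation Mn := (Mnorm R d).
Implicit Types (g k : X -> cliff) (u v : V).

Definition Qval (s q : cliff) : cliff :=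
  q * q - (2 * real_part s) *: q + (`|s| ^+ 2)%:A.

Lemma measurable_inv_ge0 (r : X -> R) : (forall x, 0 <= r x) ->
  measurable_fun setT r -> measurable_fun setT (fun x => (r x)^-1).
Proof.
move=> r0 mr; under eq_fun do rewrite -powR_inv1//.
exact: (@measurableT_comp _ _ _ _ _ _ (@powR R ^~ (-1))).
Qed.

Section one_point.
Variables (s : cliff) (h qi : X -> cliff).
Hypothesis Qqi : forall x, Qval s (h x) * qi x = 1.
Hypothesis qiQ : forall x, qi x * Qval s (h x) = 1.
Hypothesis bqi : bmult qi.
Hypothesis bhqi : bmult (fun x => h x * qi x).
Hypothesis bhhqi : bmult (fun x => h x * (h x * qi x)).

(** The domain of Q_s[M_h] is that of M_h^2; a function Q^{-1} u belongs to it because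
    h Q^{-1} and h^2 Q^{-1} are bounded as well. *)
Lemma op_Q_inv : op_inv (op_Q s (mul_op mu h)) = mul_op mu qi.
Proof.
apply/seteqP; split => -[v u].
  rewrite /op_inv /op_Q /= op_cliffE => -[p [w [/= + sw vE]]].
  move=> /op_subP[p1 [p2 [[z /= hu hz] + pE]]].
  rewrite /op_scale op_cliffE => -[z' /= hu' cz'].
  rewrite /mul_op /=.
  have D1 := reprL2D p w; rewrite -vE in D1.
  rewrite {}pE in D1.
  have D2 := reprL2D (p1 - p2) p2; rewrite subrK in D2.
  apply: filterS3 (filterI D1 D2) (filterI hu hz) (filterI sw (filterI hu' cz')).
  move=> x [d1 d2] [e1 e2] [e3 [e4 e5]].
  have : reprL2 v x = Qval s (h x) * reprL2 u x.
    have pp : reprL2 (p1 - p2) x = reprL2 p1 x - reprL2 p2 x by rewrite d2 addrK.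
    rewrite d1 pp e2 e1 e5 e4 e3 /Qval [RHS]mulrDl [in RHS]mulrBl mulrA /=; congr (_ - _ + _).
    by rewrite -!scalerAl mul1r.
  by move=> ->; rewrite mulrA qiQ mul1r.
rewrite /op_inv /op_Q /= op_cliffE => vu.
have [w1 hw1] := bmult_total v bhqi; have [w2 hw2] := bmult_total v bhhqi.
have [w3 hw3] := bmult_total u (bmult_cst (`|s| ^+ 2)%:A).
have [w4 hw4] := bmult_total w1 (bmult_cst (2 * real_part s)%:A).
rewrite /mul_op /= in vu hw1 hw2 hw3 hw4.
exists (w2 - w4), w3; split => //=.
  apply/op_subP; exists w2, w4; split => //.
    exists w1; rewrite /mul_op /=.
      by apply: filterS2 vu hw1 => x -> ->; rewrite mulrA.
    by apply: filterS2 hw1 hw2 => x -> ->; rewrite !mulrA.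
  exists w1; last by rewrite op_cliffE.
  by rewrite /mul_op /=; apply: filterS2 vu hw1 => x -> ->; rewrite mulrA.
apply: L2P.
have D1 := reprL2D (w2 - w4) w3.
have D2 := reprL2D (w2 - w4) w4; rewrite subrK in D2.
apply: filterS3 (filterI D1 D2) (filterI hw1 hw2) (filterI vu (filterI hw3 hw4)).
move=> x [-> d2] [e1 e2] [e3 [e4 e5]].
have -> : reprL2 (w2 - w4) x = reprL2 w2 x - reprL2 w4 x by rewrite d2 addrK.
rewrite e2 e5 e1 e4 e3 /=.
transitivity (Qval s (h x) * (qi x * reprL2 v x)); first by rewrite mulrA Qqi mul1r.
rewrite /Qval [LHS]mulrDl [in LHS]mulrBl -!mulrA.
by congr (_ - _ + _); rewrite -!scalerAl ?mul1r.
Qed.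

Lemma S_resolventL_mul : S_resolventL s (mul_op mu h) =
  mul_op mu (fun x => qi x * conjc s - h x * qi x).
Proof.
rewrite /S_resolventL op_Q_inv op_cliffE op_comp_mul; last exact: bmult_cst.
by rewrite op_comp_mul// op_sub_mul.
Qed.

Lemma S_resolventR_mul : S_resolventR s (mul_op mu h) =
  mul_op mu (fun x => (conjc s - h x) * qi x).
Proof.
rewrite /S_resolventR op_Q_inv op_cliffE op_sub_mul_l; last exact: bmult_cst.
by rewrite op_comp_mul.
Qed.

End one_point.

Section regularization.
Variables (e e' f : X -> cliff).
Hypothesis be : bmult e.
Hypothesis me' : cmeasurable e'.
Hypothesis e'e : forall x, e' x * e x = 1.
Hypothesis ee' : forall x, e x * e' x = 1.

(** If e v = e f u then v = f u pointwise. Conversely f u in L^2 forces e f u in L^2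
    since e is bounded; this is why the domains agree. *)
Lemma regularized_left :
  op_comp (op_inv (mul_op mu e)) (mul_op mu (fun x => e x * f x)) = mul_op mu f.
Proof.
apply/seteqP; split => -[u v].
  move=> [z /= uz vz]; rewrite /mul_op /op_inv /= in uz vz *.
  apply: filterS2 uz vz => x E1 E2.
  by rewrite -[LHS]mul1r -(e'e x) -mulrA -E2 E1 !mulrA e'e mul1r.
rewrite /mul_op /= => uv; have [z vz] := bmult_total v be.
exists z => //; rewrite /mul_op /= in vz *.
by apply: filterS2 uv vz => x -> ->; rewrite mulrA.
Qed.

Lemma cmeasurable_scale (r : X -> R) g : measurable_fun setT r -> cmeasurable g ->
  cmeasurable (fun x => r x *: g x).
Proof.
move=> mr mg A; under eq_fun do rewrite coefZ.
by apply: measurable_funM => //; exact: mg.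
Qed.

(** v = g u is equivalent to r v = r g u with r = 1 / (1 + |g|), where both
    multipliers are bounded, so the relation passes to limits. *)
Lemma mul_op_closed g : cmeasurable g -> closure (mul_op mu g) `<=` mul_op mu g.
Proof.
move=> mg [u v] cl.
(* r and r g are bounded, and r does not vanish. *)
pose r x : R := (1 + `|g x|)^-1.
have r0 x : 0 < 1 + `|g x| by rewrite ltr_wpDr.
have rn x : `|r x| = r x by rewrite ger0_norm// invr_ge0 ltW.
have mr : measurable_fun setT r.
  apply: measurable_inv_ge0 => [x|]; first exact: ltW.
  by apply: measurable_funD => //; exact: cmeasurable_norm.
have b1 : bmult (fun x => r x *: (1 : cliff)).
  split; first by apply: cmeasurable_scale => //; exact: cmeasurable_cst.
  exists `|1 : cliff| => // x; rewrite normrZ rn.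
  by rewrite ler_piMl// invf_le1// lerDl.
have b2 : bmult (fun x => r x *: g x).
  split; first exact: cmeasurable_scale.
  exists 1 => // x; rewrite normrZ rn.
  by rewrite ler_pdivrMl// mulr1 lerDr.
have [v1 hv1] := bmult_total v b1; have [u1 hu1] := bmult_total u b2.
suff E : v1 = u1.
  rewrite /mul_op /= in hv1 hu1 *; rewrite -E in hu1.
  apply: filterS2 hv1 hu1 => x -> H.
  have : r x *: reprL2 v x = r x *: (g x * reprL2 u x).
    by rewrite -[LHS]scalerAl mul1r in H *; rewrite H scalerAl.
  move=> /(congr1 (fun z => (1 + `|g x|) *: z)).
  by rewrite !scalerA divff ?gt_eqF// !scale1r.
have [c1 c10 H1] : exists2 c, 0 <= c & opnorm_le (mul_op mu (fun x => r x *: (1 : cliff))) c.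
  case: b1 => _ [c c0 Hc]; exists (Mn * c); last exact: mul_op_opnorm.
  by rewrite mulr_ge0// ltW// Mnorm_gt0.
have [c2 c20 H2] : exists2 c, 0 <= c & opnorm_le (mul_op mu (fun x => r x *: g x)) c.
  case: b2 => _ [c c0 Hc]; exists (Mn * c); last exact: mul_op_opnorm.
  by rewrite mulr_ge0// ltW// Mnorm_gt0.
apply/eqP; rewrite -subr_eq0 -normr_eq0 eq_le normr_ge0 andbT.
apply/ler_addgt0Pl => eps eps0; rewrite addr0.
pose eta := eps / (c1 + c2 + 1).
have c0 : 0 < c1 + c2 + 1 by rewrite ltr_wpDl// addr_ge0.
have eta0 : 0 < eta by rewrite divr_gt0.
have [[u' v'] [/= hu'v' [/= bu bv]]] := cl _ (nbhsx_ballx (u, v) _ eta0).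
have [v2 hv2] := bmult_total (v - v') b1; have [u2 hu2] := bmult_total (u - u') b2.
have E : v1 - u1 = v2 - u2.
  rewrite /mul_op /= in hv1 hu1 hv2 hu2 hu'v'.
  apply: L2P.
  have D1 := reprL2D (v1 - u1) u1; rewrite subrK in D1.
  have D2 := reprL2D (v2 - u2) u2; rewrite subrK in D2.
  have D3 := reprL2D (v - v') v'; rewrite subrK in D3.
  have D4 := reprL2D (u - u') u'; rewrite subrK in D4.
  apply: filterS3 (filterI hv1 (filterI hu1 (filterI hv2 (filterI hu2 hu'v'))))
    (filterI D1 D2) (filterI D3 D4) => x [e1 [e2 [e3 [e4 e5]]]] [d1 d2] [d3 d4].
  apply: (addIr (reprL2 u1 x)); rewrite -d1.
  have -> : reprL2 (v2 - u2) x = reprL2 v2 x - reprL2 u2 x by rewrite d2 addrK.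
  rewrite e1 e2 e3 e4 d3 d4 e5 mulrDr mulrDr.
  have -> : r x *: (1 : cliff) * (g x * reprL2 u' x) = r x *: g x * reprL2 u' x.
    by rewrite -!scalerAl mul1r.
  rewrite -addrA; congr (_ + _); by rewrite addrA addNr add0r.
rewrite E (le_trans (ler_normB _ _))//.
have hb1 : `|v2| <= c1 * eta.
  by apply: (le_trans (H1 _ _ hv2)); rewrite ler_wpM2l// ltW.
have hb2 : `|u2| <= c2 * eta.
  by apply: (le_trans (H2 _ _ hu2)); rewrite ler_wpM2l// ltW.
apply: (le_trans (lerD hb1 hb2)); rewrite -mulrDl /eta mulrCA ger_pMr//.
by rewrite ler_pdivrMr// mul1r lerDl.
Qed.

Lemma sq_integral_norm u (w : X -> cliff) (eps : R) : 0 < eps ->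
  {ae mu, forall x, reprL2 u x = w x} -> cmeasurable w ->
  (sq_integral mu w <= (eps ^+ 2)%:E)%E -> `|u| <= eps.
Proof.
move=> eps0 uw mw H; rewrite normL2E' -[eps]gtr0_norm// -sqrtr_sqr ler_wsqrtr//.
rewrite -lee_fin fineK ?sq_integral_repr_fin//.
apply: le_trans H; apply: ae_ge0_le_integral => //.
- exact/measurable_sqnorm/cmeasurable_repr.
- exact/measurable_sqnorm.
- by apply: filterS uw => x -> _.
Qed.

Let chi n x : R := \1_[set y | `|e' y| <= n%:R] x.

Let mchi n : measurable_fun setT (chi n).
Proof.
apply: measurable_indic.
have := cmeasurable_norm me' => /(_ measurableT `]-oo, n%:R]%classic (measurable_itv _)).
by rewrite setTI; congr measurable; apply/seteqP; split => x /=; rewrite in_itv.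
Qed.

Let chi01 n x : 0 <= chi n x <= 1.
Proof. by rewrite /chi indicE; case: (x \in _); rewrite /= ?lexx ler01. Qed.

(** Dominated convergence. *)
Lemma cutoff_cvg u (eps : R) : 0 < eps -> exists N, forall n, (N <= n)%N ->
  forall w, {ae mu, forall x, reprL2 w x = chi n x *: reprL2 u x} -> `|u - w| <= eps.
Proof.
move=> eps0.
pose F n x : \bar R := (`|(1 - chi n x) *: reprL2 u x| ^+ 2)%:E.
have mw n : cmeasurable (fun x => (1 - chi n x) *: reprL2 u x).
  apply: cmeasurable_scale (cmeasurable_repr u).
  by apply: measurable_funB => //; exact: mchi.
have mF n : measurable_fun setT (F n) by exact/measurable_sqnorm/mw.
have bnd n x : `|(1 - chi n x) *: reprL2 u x| <= `|reprL2 u x|.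
  have /andP[c0 c1] := chi01 n x.
  by rewrite normrZ ger0_norm ?subr_ge0// ler_piMl// gerBl.
have ig : mu.-integrable setT (fun x => (`|reprL2 u x| ^+ 2)%:E).
  apply/integrableP; split; first exact/measurable_sqnorm/cmeasurable_repr.
  under eq_integral do rewrite gee0_abs ?lee_fin//.
  by have := sq_integral_repr_fin u; rewrite ge0_fin_numE ?sq_integral_ge0.
have cvg0 : (\int[mu]_x F n x @[n --> \oo] --> \int[mu]_x (0 : \bar R))%E.
  apply: (@dominated_cvg _ _ _ mu setT measurableT F (fun=> 0%E)
    (fun x => (`|reprL2 u x| ^+ 2)%:E)) => //.
  - move=> x _; apply: cvg_near_cst; exists (Num.truncn `|e' x|).+1 => // n /= Hn.
    have -> : F n x = 0%E; last by [].
    rewrite /F /chi indicE mem_set/=; first by rewrite subrr scale0r normr0 expr0n.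
    by apply: (le_trans (ltW (truncnS_gt _))); rewrite ler_nat.
  - by move=> n x _; rewrite gee0_abs ?lee_fin// ler_pXn2r ?nnegrE.
rewrite integral0 in cvg0.
have e2 : 0 < eps ^+ 2 by rewrite exprn_gt0.
have [N _ HN] : \forall n \near \oo, (\int[mu]_x F n x <= (eps ^+ 2)%:E)%E.
  have [fin /cvgrPdist_le/(_ _ e2)] := (fine_cvgP _ _).1 cvg0.
  apply: filterS2 fin => n fin; rewrite sub0r normrN /= => h.
  by rewrite -(fineK fin) lee_fin (le_trans (ler_norm _)).
exists N => n Nn w hw; apply: (sq_integral_norm (w := fun x => (1 - chi n x) *: reprL2 u x)) => //.
  have D := reprL2D (u - w) w; rewrite subrK in D.
  apply: filterS2 D hw => x D hw; rewrite scalerBl scale1r -hw.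
  by apply/eqP; rewrite eq_sym subr_eq D.
exact: HN.
Qed.

(** Approximate (u, f u) by its restrictions to the sets where |e^{-1}| <= n: there
    e^{-1} u is in L^2, so the restriction of u is in the domain of M_{fe} M_e^{-1}. *)
Lemma regularized_right : cmeasurable f ->
  closure (op_comp (mul_op mu (fun x => f x * e x)) (op_inv (mul_op mu e))) = mul_op mu f.
Proof.
move=> mf; apply/seteqP; split.
  apply: subset_trans (mul_op_closed mf).
  apply: closure_subset => -[u v] [z]; rewrite /op_inv /mul_op /= => uz zv.
  by apply: filterS2 uz zv => x -> ->; rewrite mulrA.
move=> [u v] uv B.
move=> /nbhs_ballP[eps /= eps0 HB].
have e2 : 0 < eps / 2 by rewrite divr_gt0.
have [N1 H1] := cutoff_cvg u e2; have [N2 H2] := cutoff_cvg v e2.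
pose n := maxn N1 N2.
have bc : bmult (fun x => chi n x *: (1 : cliff)).
  split; first by apply: cmeasurable_scale => //; exact: cmeasurable_cst.
  exists `|1 : cliff| => // x; have /andP[c0 c1] := chi01 n x.
  by rewrite normrZ ger0_norm// ler_piMl.
have bce : bmult (fun x => chi n x *: e' x).
  split; first exact: cmeasurable_scale.
  exists n%:R => // x; rewrite normrZ /chi indicE.
  have [|] := boolP (x \in _); rewrite ?inE/= => h.
    by rewrite normr1 mul1r.
  by rewrite normr0 mul0r.
have [un hun] := bmult_total u bc; have [vn hvn] := bmult_total v bc.
have [zn hzn] := bmult_total u bce.
rewrite /mul_op /= in hun hvn hzn uv.
exists (un, vn); split.
  exists zn; rewrite /op_inv /mul_op /=.
    apply: filterS2 hun hzn => x -> ->.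
    by rewrite -!scalerAl -scalerAr mulrA ee' mul1r.
  apply: filterS3 hvn hzn uv => x -> -> ->.
  by rewrite -!scalerAl -scalerAr !mulrA mul1r -[f x * e x * e' x]mulrA ee' mulr1.
apply: HB; split; rewrite /ball /=.
  apply: (@le_lt_trans _ _ (eps / 2)); last by rewrite ltr_pdivrMr// ltr_pMr// ltr1n.
  apply: (H1 n (leq_maxl _ _)); apply: filterS hun => x ->.
  by rewrite -scalerAl mul1r.
apply: (@le_lt_trans _ _ (eps / 2)); last by rewrite ltr_pdivrMr// ltr_pMr// ltr1n.
apply: (H2 n (leq_maxr _ _)); apply: filterS hvn => x ->.
by rewrite -scalerAl mul1r.
Qed.

End regularization.

Lemma cmeasurable_pinv k : cmeasurable k -> cmeasurable (fun x => pinv (k x)).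
Proof.
move=> mk; apply: cmeasurable_scale.
  apply: measurable_inv_ge0; first by move=> x; exact: sqr_ge0.
  by apply: measurable_funX; exact: cmeasurable_norm.
move=> A; under eq_fun do rewrite /conjc {1}/coef ffunE.
by apply: measurable_funM => //; exact: mk.
Qed.

Lemma cmeasurable_pinvQ s k : cmeasurable k -> cmeasurable (fun x => pinv (Qval s (k x))).
Proof.
move=> mk; apply: cmeasurable_pinv; rewrite /Qval.
apply: cmeasurableD'; last exact: cmeasurable_cst.
apply: cmeasurableD'; first exact: cmeasurableM.
under eq_fun do rewrite -scaleNr.
by apply: cmeasurable_scale => //; exact: measurable_cst.
Qed.

End resolvents.

(** * Slice functions on the double sector *)

Section slice_functions.
Context {R : realType} {d : nat}.
Local Notation cliff := (clifford R d).
Local Notation Re := (@complex.Re R).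
Local Notation Im := (@complex.Im R).
Implicit Types (p : R * R) (J s q : cliff) (th om : R) (z : R[i]).

(** The double sector in each half slice, in Cartesian coordinates: the cosine of the
    argument exceeds cos th in absolute value. *)
Definition slice_cone th : set (R * R) :=
  [set p | cos th * Num.sqrt (p.1 ^+ 2 + p.2 ^+ 2) < `|p.1|].

Definition cart p : R * R := (p.1 * cos p.2, p.1 * sin p.2).

Lemma open_cone th : open (slice_cone th).
Proof.
have c1 : continuous (fun p : R * R => p.1) by move=> p; exact: cvg_fst.
have c2 : continuous (fun p : R * R => p.2) by move=> p; exact: cvg_snd.
have -> : slice_cone th = (fun p : R * R => `|p.1| - cos th * Num.sqrt (p.1 ^+ 2 + p.2 ^+ 2)) @^-1` [set x | 0 < x].
  by apply/seteqP; split => p /=; rewrite /slice_cone /= subr_gt0.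
have cr (p : R * R) : {for p, continuous (fun p : R * R => cos th * Num.sqrt (p.1 ^+ 2 + p.2 ^+ 2))}.
  apply: continuousM; first exact: cst_continuous.
  apply: (@continuous_comp _ _ _ (fun p : R * R => p.1 ^+ 2 + p.2 ^+ 2) (@Num.sqrt R)); last exact: sqrt_continuous.
  by apply: continuousD; apply: continuousM; [exact: c1|exact: c1|exact: c2|exact: c2].
have cl (p : R * R) : {for p, continuous (fun p : R * R => `|p.1|)}.
  by apply: (@continuous_comp _ _ _ (fun p : R * R => p.1) Num.norm); [exact: c1|exact: norm_continuous].
by apply: open_comp; [move=> p _; exact: (continuousB (cl p) (cr p))|exact: open_gt].
Qed.

Lemma polar_norm (t y : R) : (t * cos y) ^+ 2 + (t * sin y) ^+ 2 = t ^+ 2.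
Proof. by rewrite !exprMn -mulrDr cos2Dsin2 mulr1. Qed.

Lemma polar_set_cone th (t y : R) : 0 < t -> polar_set (slice_cone th) (t, y) <-> cos th < `|cos y|.
Proof.
move=> t0; rewrite /polar_set /slice_cone /= polar_norm sqrtr_sqr normrM gtr0_norm//.
by rewrite mulrC ltr_pM2l//; split => [[]|].
Qed.

Lemma cemb_pair J p : p.1%:A + p.2 *: J = cemb J (p.1 +i* p.2)%C :> cliff.
Proof. by []. Qed.

Lemma norm_pair J p : unit_sphere J ->
  `|p.1%:A + p.2 *: J : cliff| = Num.sqrt (p.1 ^+ 2 + p.2 ^+ 2).
Proof. by move=> HJ; rewrite cemb_pair norm_cemb. Qed.

Lemma pihalf_gt0 : 0 < pi / 2 :> R.
Proof. by rewrite divr_gt0// pi_gt0. Qed.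

Lemma cos_gt0' th : 0 < th < pi / 2 -> 0 < cos th.
Proof.
move=> /andP[h1 h2]; apply: cos_gt0_pihalf; rewrite h2 andbT.
by rewrite (lt_trans _ h1)// oppr_lt0 pihalf_gt0.
Qed.

Lemma cone_double_sector th p J : 0 < th < pi / 2 -> unit_sphere J -> slice_cone th p ->
  double_sector th (p.1%:A + p.2 *: J : cliff).
Proof.
move=> th2 HJ; rewrite /slice_cone /= -(norm_pair p HJ); set s : cliff := p.1%:A + _ => cs.
have cth := cos_gt0' th2; move/andP: th2 => [th0 th2].
have pp := @pi_gt0 R.
have s0 : 0 < `|s|.
  rewrite lt0r normr_ge0 andbT; apply/eqP => s0; move: cs; rewrite s0 mulr0 => p1.
  have : `|real_part s| <= `|s| by exact: coef_le_norm.
  by rewrite /s cemb_pair real_part_cemb// -cemb_pair -/s s0 /= leNgt p1.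
have rp : real_part s = p.1 by rewrite /s cemb_pair real_part_cemb.
split; first by rewrite /s cemb_pair; exact: paravector_cemb.
  by rewrite -normr_gt0.
rewrite /arg rp; set x := p.1 / `|s|.
have x1 : -1 <= x <= 1.
  rewrite -ler_norml /x normrM normfV normr_id ler_pdivrMr// mul1r -rp.
  exact: coef_le_norm.
have xth : cos th < `|x| by rewrite /x normrM normfV normr_id ltr_pdivlMr.
have a0 := acos_ge0 x1; have api := acos_lepi x1.
have thI : th \in `[0, pi] by rewrite in_itv/= (ltW th0)/=; lra.
have aI : acos x \in `[0, pi] by rewrite in_itv/= a0 api.
have cx : cos (acos x) = x by apply: acosK; rewrite in_itv/=.
have [xp|xn] := lerP 0 x.
  left; apply/andP; split; first lra.
  by rewrite -ltr_cos// cx -[x]ger0_norm.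
right; apply/andP; split; last lra.
have pI : pi - th \in `[0, pi] by rewrite in_itv/=; apply/andP; split; lra.
rewrite -ltr_cos// cx addrC cosDpi cosN.
by move: xth; rewrite ltr0_norm//; lra.
Qed.

Lemma double_sector_cos om s : 0 < om < pi / 2 -> double_sector om s ->
  cos om * `|s| <= `|real_part s|.
Proof.
move=> /andP[om0 om2] [ps s0]; have pp := @pi_gt0 R.
have sn : 0 < `|s| by rewrite normr_gt0.
rewrite -ler_pdivlMr//.
have -> : `|real_part s| / `|s| = `|real_part s / `|s| | by rewrite normrM normfV normr_id.
set x := real_part s / _.
have x1 : -1 <= x <= 1.
  rewrite -ler_norml /x normrM normfV normr_id ler_pdivrMr// mul1r.
  exact: coef_le_norm.
have xE : arg s = acos x by rewrite /arg /x.
rewrite xE.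
have a0 := acos_ge0 x1; have api := acos_lepi x1.
have thI : om \in `[0, pi] by rewrite in_itv/= (ltW om0)/=; lra.
have aI : acos x \in `[0, pi] by rewrite in_itv/= a0 api.
have cx : cos (acos x) = x by apply: acosK; rewrite in_itv/=.
case=> /andP[h1 h2].
  by apply: ltW; rewrite (lt_le_trans _ (ler_norm _))// -cx ltr_cos.
have pI : pi - om \in `[0, pi] by rewrite in_itv/=; apply/andP; split; lra.
have : cos (acos x) < cos (pi - om) by rewrite ltr_cos.
rewrite cx addrC cosDpi cosN => h.
by rewrite ler_normr; apply/orP; right; lra.
Qed.

Lemma coef_continuous A : continuous (fun s : cliff => coef s A).
Proof.
move=> s; have FF : Filter (nbhs s) := nbhs_filter s.
apply/cvgrPdist_le => e e0.
apply: filterS (nbhsx_ballx s _ e0) => t; rewrite /ball/= => st.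
by rewrite -coefB (le_trans (coef_le_norm _ _))// ltW.
Qed.

(** Both conditions are closed, so it suffices to have them on the double sector. *)
Lemma closure_double_sector om s : 0 < om < pi / 2 -> closure (double_sector om) s ->
  paravector s /\ cos om * `|s| <= `|real_part s|.
Proof.
move=> om2 cl.
have H (e : R) : 0 < e -> exists t, double_sector om t /\ `|s - t| < e.
  by move=> e0; have [t [ht bt]] := cl _ (nbhsx_ballx s _ e0); exists t.
have c0 := cos_gt0' om2; split.
  move=> A A1; apply/eqP; rewrite -normr_eq0 eq_le normr_ge0 andbT.
  apply/ler_addgt0Pl => e e0; rewrite addr0; have [t [[pt _ _] st]] := H e e0.
  have -> : coef s A = coef (s - t) A by rewrite coefB (pt _ A1) subr0.
  exact: (le_trans (coef_le_norm _ _) (ltW st)).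
apply/ler_addgt0Pl => e e0.
have [t [ht st]] := H (e / 2) ltac:(by rewrite divr_gt0).
have h1 := double_sector_cos om2 ht.
have h2 : `|s| <= `|t| + e / 2.
  by rewrite -[s](subrK t) addrC (le_trans (ler_normD _ _))// lerD2l ltW.
have h3 : `|real_part t| <= `|real_part s| + e / 2.
  have -> : real_part t = real_part s - real_part (s - t).
    by rewrite !real_partE coefB; ring.
  rewrite (le_trans (ler_normB _ _))// lerD2l (le_trans (coef_le_norm _ _))// ltW//.
have := cos_le1 om; nra.
Qed.

(** What is used of a left slice hyperholomorphic function: its two components satisfy
    the polar Cauchy-Riemann equations coordinatewise, are even and odd in y, and
    give back g. *)
Definition slice_data th (g : cliff -> cliff) (G0 G1 : R * R -> cliff) : Prop :=
  [/\ forall A, polar_holo (polar_set (slice_cone th)) (fun p => coef (G0 (cart p)) A)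
                  (fun p => coef (G1 (cart p)) A),
      forall p, slice_cone th p -> G0 (p.1, - p.2) = G0 p /\ G1 (p.1, - p.2) = - G1 p &
      forall p J, slice_cone th p -> unit_sphere J ->
        g (p.1%:A + p.2 *: J) = G0 p + J * G1 p].

Lemma coef_is_derive (f : R * R -> cliff) p (v : R * R) A : derivable f p v ->
  is_derive p v (fun p => coef (f p) A) (coef ('D_v f p) A).
Proof.
move=> df.
have : (fun h : R => coef (h^-1 *: (f (h *: v + p) - f p)) A) @ 0^' --> coef ('D_v f p) A.
  exact: (@cvg_comp _ _ _ _ (fun s : cliff => coef s A) _ _ _ df (@coef_continuous A _)).
have -> : (fun h : R => coef (h^-1 *: (f (h *: v + p) - f p)) A) =
          (fun h : R => h^-1 *: (coef (f (h *: v + p)) A - coef (f p) A)).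
  by apply/funext => h; rewrite coefZ coefB.
move=> H; split; first by apply/cvg_ex; exists (coef ('D_v f p) A).
by apply/cvg_lim.
Qed.

Lemma slice_pair_polar th (D : set (R * R)) (f0 f1 : R * R -> cliff) A :
  slice_cone th `<=` D -> slice_pair D f0 f1 ->
  polar_holo (polar_set (slice_cone th)) (fun p => coef (f0 (cart p)) A)
    (fun p => coef (f1 (cart p)) A).
Proof.
move=> sD [h0 h1 h].
have cc (w : R * R -> cliff) p : {for p, continuous w} -> {for p, continuous (fun p' : R * R => coef (w p') A)}.
  by move=> cw; exact: (@continuous_comp _ _ _ w (fun s : cliff => coef s A) _ cw (@coef_continuous A _)).
apply: (@polar_holo_cartesian _ _ (fun p => coef (f0 p) A) (fun p => coef (f1 p) A)
  (fun p => coef ('D_((1, 0) : R * R) f0 p) A) (fun p => coef ('D_((0, 1) : R * R) f0 p) A)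
  (fun p => coef ('D_((1, 0) : R * R) f1 p) A) (fun p => coef ('D_((0, 1) : R * R) f1 p) A)
  (@open_cone th)).
- by move=> p /sD/h0[dx dy cx cy]; exact: coef_is_derive.
- by move=> p /sD/h0[dx dy cx cy]; exact: coef_is_derive.
- by move=> p /sD/h1[dx dy cx cy]; exact: coef_is_derive.
- by move=> p /sD/h1[dx dy cx cy]; exact: coef_is_derive.
- by move=> p /sD Dp; have [_ _ c1 c2] := h0 p Dp; have [_ _ c3 c4] := h1 p Dp; split;
    [exact: (cc _ _ c1)|exact: (cc _ _ c2)|exact: (cc _ _ c3)|exact: (cc _ _ c4)].
- by move=> p /sD/h[_ _ -> ->]; rewrite coefN.
Qed.

Lemma cone_slice_dom th : 0 < th < pi / 2 ->
  slice_cone th `<=` slice_dom (double_sector th : set cliff).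
Proof. by move=> h p cp J HJ; exact: cone_double_sector. Qed.

Lemma SHL_slice_data th f : 0 < th < pi / 2 -> SHL (double_sector th) f ->
  exists G0 G1, slice_data th f G0 G1.
Proof.
move=> h [f0 [f1 [sp fE]]]; exists f0, f1; have sD := cone_slice_dom h.
split.
- by move=> A; exact: slice_pair_polar sp.
- by case: sp => _ _ H p /sD/H[-> -> _ _].
- by move=> p J /sD; exact: fE.
Qed.

Lemma polar_holoZ D (k : R) u v : polar_holo D u v ->
  polar_holo D (fun p => k * u p) (fun p => k * v p).
Proof.
move=> /(polar_holoM (polar_holo_cst D k 0)); congr polar_holo; apply/funext => p; ring.
Qed.

(** Reversion turns a right slice function into a left one. *)
Lemma SHR_slice_data th f : 0 < th < pi / 2 -> SHR (double_sector th) f ->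
  exists G0 G1, slice_data th (fun s => crev (f s)) G0 G1.
Proof.
move=> h [f0 [f1 [sp fE]]]; exists (crev \o f0), (crev \o f1); have sD := cone_slice_dom h.
split.
- move=> A; have := polar_holoZ (revsgn A) (slice_pair_polar A sD sp).
  by congr polar_holo; apply/funext => p /=; rewrite coef_crev.
- by case: sp => _ _ H p /sD/H[h1 h2 _ _] /=; rewrite h1 h2 crevN.
- move=> p J /sD Dp HJ; rewrite fE// crevD crevM (crev_paravector (s := J))//.
  by case: HJ.
Qed.

Definition cpt p : R[i] := (p.1 +i* p.2)%C.

(** The regularizer on a complex slice. *)
Definition ereg m z : R[i] := z ^+ m * (1 + z ^+ 2)^-1 ^+ m.

(** Holomorphy of a complex function, as that of its real and imaginary parts. *)
Definition polar_cholo D (E : R[i] -> R[i]) :=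
  polar_holo D (fun p => Re (E (cpt (cart p)))) (fun p => Im (E (cpt (cart p)))).

Lemma polar_choloM D E E' : polar_cholo D E -> polar_cholo D E' -> polar_cholo D (fun z => E z * E' z).
Proof.
move=> h h'; have := polar_holoM h h'; rewrite /polar_cholo; congr polar_holo.
  by apply/funext => p; rewrite cReM.
by apply/funext => p; rewrite cImM.
Qed.

Lemma polar_cholo_cst D (c : R[i]) : polar_cholo D (fun=> c).
Proof. exact: polar_holo_cst. Qed.

Lemma polar_choloX D E m : polar_cholo D E -> polar_cholo D (fun z => E z ^+ m).
Proof.
move=> h; elim: m => [|m IH].
  by under eq_fun do rewrite expr0; exact: polar_cholo_cst.
by under eq_fun do rewrite exprS; exact: polar_choloM.
Qed.

Lemma polar_choloD D E E' : polar_cholo D E -> polar_cholo D E' -> polar_cholo D (fun z => E z + E' z).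
Proof.
move=> h h'; have := polar_holoD h h'; rewrite /polar_cholo; congr polar_holo.
  by apply/funext => p; case: (E _) (E' _) => [? ?] [? ?].
by apply/funext => p; case: (E _) (E' _) => [? ?] [? ?].
Qed.

Lemma polar_choloV D E : (forall p, D p -> E (cpt (cart p)) != 0) -> polar_cholo D E ->
  polar_cholo D (fun z => (E z)^-1).
Proof.
move=> E0 h; have N0 p : D p -> Re (E (cpt (cart p))) ^+ 2 + Im (E (cpt (cart p))) ^+ 2 != 0.
  by move=> Dp; exact: (lt0r_neq0 (sqnc_gt0 (E0 p Dp))).
have := polar_holoV N0 h; rewrite /polar_cholo.
by congr polar_holo; apply/funext => p; rewrite ?cReV ?cImV.
Qed.

Lemma polar_cholo_id D : polar_cholo D id.
Proof. exact: polar_holo_id. Qed.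

Lemma sqnc_1Dsqr (x y : R) :
  sqnc (1 + (x +i* y)%C ^+ 2) = (1 + (x ^+ 2 + y ^+ 2)) ^+ 2 - 4 * y ^+ 2.
Proof. by rewrite /sqnc expr2 /=; ring. Qed.

(** On the double sector s^2 stays away from the negative half axis, so |1 + s^2| is
    comparable to 1 + |s|^2. *)
Lemma sqnc_1Dsqr_ge th p : 0 < th < pi / 2 -> slice_cone th p ->
  cos th ^+ 2 * (1 + (p.1 ^+ 2 + p.2 ^+ 2)) ^+ 2 <= sqnc (1 + cpt p ^+ 2).
Proof.
move=> th2 cp; have c0 := cos_gt0' th2; rewrite sqnc_1Dsqr.
have t0 : 0 <= p.1 ^+ 2 + p.2 ^+ 2 by rewrite addr_ge0 ?sqr_ge0.
have c1 := cos_le1 th.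
have : cos th ^+ 2 * (p.1 ^+ 2 + p.2 ^+ 2) <= p.1 ^+ 2.
  rewrite -[X in _ * X]sqr_sqrtr// -exprMn -[leRHS]real_normK ?num_real//.
  have h : cos th * Num.sqrt (p.1 ^+ 2 + p.2 ^+ 2) <= `|p.1| := ltW cp.
  by rewrite ler_pXn2r ?nnegrE// mulr_ge0 ?sqrtr_ge0// ltW.
set x := p.1; set y := p.2; set c := cos th => h.
have c2 : c ^+ 2 <= 1 by rewrite expr_le1// ltW.
have hy : y ^+ 2 <= (1 - c ^+ 2) * (x ^+ 2 + y ^+ 2) by lra.
have T : 4 * (x ^+ 2 + y ^+ 2) <= (1 + (x ^+ 2 + y ^+ 2)) ^+ 2.
  rewrite -subr_ge0; have -> : (1 + (x ^+ 2 + y ^+ 2)) ^+ 2 - 4 * (x ^+ 2 + y ^+ 2) =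
    (1 - (x ^+ 2 + y ^+ 2)) ^+ 2 by ring.
  exact: sqr_ge0.
have : (1 - c ^+ 2) * (4 * (x ^+ 2 + y ^+ 2)) <= (1 - c ^+ 2) * (1 + (x ^+ 2 + y ^+ 2)) ^+ 2.
  by rewrite ler_wpM2l// subr_ge0.
lra.
Qed.

Lemma den_neq0 th p : 0 < th < pi / 2 -> slice_cone th p -> 1 + cpt p ^+ 2 != 0.
Proof.
move=> th2 cp; rewrite -sqnc_eq0 gt_eqF// (lt_le_trans _ (sqnc_1Dsqr_ge th2 cp))//.
by rewrite mulr_gt0 ?exprn_gt0 ?cos_gt0'// ltr_wpDr// addr_ge0 ?sqr_ge0.
Qed.

Lemma polar_cholo_ereg th m : 0 < th < pi / 2 -> polar_cholo (polar_set (slice_cone th)) (ereg m).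
Proof.
move=> th2; apply: polar_choloM; first exact/polar_choloX/polar_cholo_id.
apply: polar_choloX; apply: polar_choloV => [p [_ cp]|]; first exact: den_neq0 cp.
by apply: polar_choloD; [exact: polar_cholo_cst|exact/polar_choloX/polar_cholo_id].
Qed.

Lemma regularizer_cemb J m z : unit_sphere J ->
  regularizer m (cemb J z) = cemb J (ereg m z).
Proof.
move=> HJ; rewrite /regularizer /ereg -(cemb1 J) -!(cembX HJ) -cembD (pinv_cemb HJ).
by rewrite -!(cembX HJ) -(cembM HJ).
Qed.

Lemma ereg_conj m z : ereg m (z^*)%C = ((ereg m z)^*)%C.
Proof.
by rewrite /ereg rmorphM !rmorphXn fmorphV rmorphD rmorph1 rmorphXn.
Qed.

(** The regularizer has real components, hence multiplying by it amounts to a complex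
    multiplication of the pair (G0, G1). *)
Lemma slice_data_reg th m f G0 G1 : 0 < th < pi / 2 -> slice_data th f G0 G1 ->
  slice_data th (fun s => regularizer m s * f s)
    (fun p => Re (ereg m (cpt p)) *: G0 p - Im (ereg m (cpt p)) *: G1 p)
    (fun p => Re (ereg m (cpt p)) *: G1 p + Im (ereg m (cpt p)) *: G0 p).
Proof.
move=> th2 [h1 h2 h3]; split.
- move=> A; have := polar_holoM (polar_cholo_ereg m th2) (h1 A).
  congr polar_holo; apply/funext => p; first by rewrite coefB !coefZ.
  by rewrite coefD !coefZ.
- move=> p cp; have [-> ->] := h2 p cp.
  have -> : cpt (p.1, - p.2) = ((cpt p)^*)%C by [].
  rewrite ereg_conj; case: (ereg m (cpt p)) => a b /=.
  by rewrite scalerN scaleNr !opprK opprD scalerN scaleNr.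
- move=> p J cp HJ; rewrite h3// cemb_pair regularizer_cemb// -/(cpt p).
  set E := ereg m _; rewrite /cemb mulrDl !mulrDr -!scalerAl !mul1r mulrA.
  rewrite -!scalerAr unit_sphere_sqr// mulN1r scalerN.
  by rewrite [X in _ + X]addrC addrACA.
Qed.

End slice_functions.

(** * Growth of the regularized functions *)

Section kernel_bounds.
Context {R : realType} {d : nat}.
Local Notation cliff := (clifford R d).
Local Notation Re := (@complex.Re R).
Local Notation Im := (@complex.Im R).
Local Notation Mn := (Mnorm R d).
Implicit Types (p : R * R) (J s q : cliff) (z : R[i]).

(** With alpha < m, the m-th power of t / (1 + t^2) absorbs the growth t^alpha at
    infinity and t^(- alpha) at 0, and leaves the decay of t Theta'(t). *)
Lemma reg_bound_real (t alpha : R) (m : nat) : 0 < t -> 0 <= alpha -> alpha < m%:R ->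
  (t / (1 + t ^+ 2)) ^+ m * (t `^ alpha + t `^ (- alpha)) <=
  8 / (m%:R - alpha) * (t * dTheta (m%:R - alpha) t).
Proof.
move=> t0 a0 am; set de := m%:R - alpha; have d0 : 0 < de by rewrite subr_gt0.
set T := t `^ de; have T0 : 0 < T by exact: powR_gt0.
have tT : t * t `^ (de - 1) = T.
  by rewrite -{1}(powRr1 (ltW t0)) -powRD ?(gt_eqF t0) ?implybT// addrC subrK.
have -> : 8 / de * (t * dTheta de t) = 8 * T / (1 + T) ^+ 2.
  rewrite /dTheta -/T -tT; field.
  by rewrite !gt_eqF// ltr_wpDr// mulr_ge0 ?powR_ge0// ltW.
have t2 : 0 < 1 + t ^+ 2 by rewrite ltr_wpDr// sqr_ge0.
have x0 : 0 <= t / (1 + t ^+ 2) by rewrite divr_ge0// ltW.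
have TT : 0 < (1 + T) ^+ 2 by rewrite exprn_gt0// ltr_wpDr// ltW.
have mN : m%:R = de + alpha by rewrite /de subrK.
have [t1|t1] := lerP t 1.
  have h1 : (t / (1 + t ^+ 2)) ^+ m <= t `^ (de + alpha).
    rewrite -mN powR_mulrn ?(ltW t0)//; apply: lerXn2r; rewrite ?nnegrE ?(ltW t0)//.
    by rewrite ler_pdivrMr// ler_peMr ?lerDl ?sqr_ge0// (ltW t0).
  have t01 : 0 < t <= 1 by rewrite t0 t1.
  have h2 : t `^ alpha <= t `^ (- alpha).
    by apply: (ger_powR t01); rewrite (le_trans _ a0)// oppr_le0.
  apply: (@le_trans _ _ (t `^ (de + alpha) * (2 * t `^ (- alpha)))).
    by apply: ler_pM => //; [exact: exprn_ge0|rewrite addr_ge0 ?powR_ge0|lra].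
  have -> : t `^ (de + alpha) * (2 * t `^ (- alpha)) = 2 * T.
    rewrite mulrCA -powRD ?(gt_eqF t0) ?implybT// /T; congr (_ * powR _ _); lra.
  have T1 : T <= 1 by rewrite /T -(powRr0 t); apply: (ger_powR t01); exact: ltW.
  rewrite ler_pdivlMr//.
  have : (1 + T) ^+ 2 <= 2 ^+ 2.
    by rewrite ler_pXn2r ?nnegrE//; lra.
  move=> h; have : 2 * T * (1 + T) ^+ 2 <= 2 * T * 2 ^+ 2 by rewrite ler_pM2l ?mulr_gt0.
  lra.
have t1' : 1 <= t by exact: ltW.
have h1 : (t / (1 + t ^+ 2)) ^+ m <= t `^ (- (de + alpha)).
  rewrite -mN powR_invn ?(ltW t0)// -exprVn; apply: lerXn2r; rewrite ?nnegrE ?invr_ge0 ?(ltW t0)//.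
  by rewrite ler_pdivrMr// ler_pdivlMl// -expr2 lerDr.
have h2 : t `^ (- alpha) <= t `^ alpha.
  by apply: (ler_powR t1'); rewrite (le_trans _ a0)// oppr_le0.
apply: (@le_trans _ _ (t `^ (- (de + alpha)) * (2 * t `^ alpha))).
  by apply: ler_pM => //; [exact: exprn_ge0|rewrite addr_ge0 ?powR_ge0|lra].
have -> : t `^ (- (de + alpha)) * (2 * t `^ alpha) = 2 / T.
  rewrite mulrCA -powRD ?(gt_eqF t0) ?implybT// /T -powRN; congr (_ * powR _ _); lra.
have T1 : 1 <= T by rewrite /T -(powRr0 t); apply: (ler_powR t1'); exact: ltW.
rewrite ler_pdivlMr// mulrAC ler_pdivrMr//.
have : (1 + T) ^+ 2 <= (2 * T) ^+ 2.
  by rewrite ler_pXn2r ?nnegrE//; lra.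
rewrite !expr2; lra.
Qed.

Lemma norm_pow_le (x y c : R) m : 0 <= x -> 0 <= y -> 0 < c -> x ^+ 2 <= (c * y) ^+ 2 ->
  x ^+ m <= (c * y) ^+ m.
Proof.
move=> x0 y0 c0 h; apply: lerXn2r; rewrite ?nnegrE ?mulr_ge0 ?(ltW c0)//.
by rewrite -(@ler_pXn2r _ 2)// ?nnegrE ?mulr_ge0 ?(ltW c0).
Qed.

Lemma reg_growth th m (f : cliff -> cliff) (alpha : R) : 0 < th < pi / 2 -> 0 <= alpha ->
  alpha < m%:R -> poly_growth th alpha f ->
  exists2 C : R, 0 <= C & forall p J s, slice_cone th p -> unit_sphere J ->
    s = p.1%:A + p.2 *: J ->
    `|regularizer m s| * `|f s| <= C * (`|s| * dTheta (m%:R - alpha) `|s|).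
Proof.
move=> th2 a0 am [Cf Cf0 Hf]; have c0 := cos_gt0' th2.
have de0 : 0 < m%:R - alpha by rewrite subr_gt0.
exists ((cos th)^-1 ^+ m * Cf * (8 / (m%:R - alpha))).
  by rewrite !mulr_ge0// ?exprn_ge0 ?invr_ge0// ltW.
move=> p J s cp HJ sE; have := cone_double_sector th2 HJ cp; rewrite -sE => ds.
have s0 : 0 < `|s| by case: ds => _; rewrite normr_gt0.
have h1 : `|regularizer m s| <= ((cos th)^-1 * (`|s| / (1 + `|s| ^+ 2))) ^+ m.
  rewrite {1}sE cemb_pair (regularizer_cemb _ _ HJ) /ereg -exprMn (norm_cemb HJ).
  set w := _ / _; rewrite sqncX.
  have -> : Num.sqrt (sqnc w ^+ m) = Num.sqrt (sqnc w) ^+ m.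
    apply/eqP; rewrite -(@eqrXn2 _ 2)// ?exprn_ge0 ?sqrtr_ge0//.
    by rewrite -exprM mulnC exprM !sqr_sqrtr ?exprn_ge0 ?sqnc_ge0.
  apply: norm_pow_le; rewrite ?sqrtr_ge0 ?invr_gt0 ?divr_ge0 ?addr_ge0 ?sqr_ge0//.
  have dpos : 0 < sqnc (1 + cpt p ^+ 2) by rewrite sqnc_gt0// (den_neq0 th2 cp).
  rewrite sqr_sqrtr ?sqnc_ge0// /w sqncM sqncV.
  have -> : sqnc (p.1 +i* p.2)%C = `|s| ^+ 2 by rewrite sE cemb_pair (sqr_norm_cemb HJ).
  rewrite ler_pdivrMr//.
  have := sqnc_1Dsqr_ge th2 cp.
  have -> : p.1 ^+ 2 + p.2 ^+ 2 = `|s| ^+ 2 by rewrite sE cemb_pair (sqr_norm_cemb HJ).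
  move=> h; have q0 : 0 < (cos th)^-1 ^+ 2 * (`|s| / (1 + `|s| ^+ 2)) ^+ 2.
    by rewrite mulr_gt0// exprn_gt0 ?invr_gt0// divr_gt0// ltr_wpDr// sqr_ge0.
  rewrite exprMn -(ler_pM2l q0) in h *.
  apply: le_trans h; rewrite le_eqVlt; apply/orP; left; apply/eqP; field.
  by rewrite !gt_eqF// ltr_wpDr// sqr_ge0.
have h2 := Hf s ds.
apply: (@le_trans _ _ (((cos th)^-1 * (`|s| / (1 + `|s| ^+ 2))) ^+ m *
   (Cf * (`|s| `^ alpha + `|s| `^ (- alpha))))).
  by apply: ler_pM.
rewrite exprMn mulrACA -!mulrA ler_pM2l ?exprn_gt0 ?invr_gt0//.
by rewrite ler_wpM2l//; have := reg_bound_real s0 a0 am; rewrite -!mulrA.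
Qed.

End kernel_bounds.

(** * Estimates of the scalar S-resolvent *)

Section scalar_resolvent.
Context {R : realType} {d : nat}.
Local Notation cliff := (clifford R d).
Local Notation Re := (@complex.Re R).
Local Notation Im := (@complex.Im R).
Local Notation Mn := (Mnorm R d).
Implicit Types (p : R * R) (J s q : cliff) (z : R[i]).

(** The nonzero paravectors of the closed double sector of angle om. *)
Definition sector_pt (om : R) : set cliff :=
  [set q | [/\ paravector q, q != 0 & cos om * `|q| <= `|real_part q|]].

(** The left S-resolvent of the multiplication by q. *)
Definition S_resolvent_val s q : cliff := pinv (Qval s q) * conjc s - q * pinv (Qval s q).

Definition ray_pt (y t : R) : R[i] := (t * cos y +i* (t * sin y))%C.

(** The two roots of Q_s, for s = t e^{Jy}, are s and its conjugate. *)
Definition Q_slice (y t : R) z : R[i] := (z - ray_pt y t) * (z - ray_pt (- y) t).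

Lemma sector_pt_slice om q : (1 <= d)%N -> sector_pt om q -> exists J z,
  [/\ unit_sphere J, q = cemb J z, 0 < sqnc z, 0 <= Im z & cos om * Num.sqrt (sqnc z) <= `|Re z|].
Proof.
move=> d1 [pq q0 qc]; have [J [z [HJ qE Iz]]] := paravector_decomp d1 pq.
exists J, z; split => //.
  by rewrite sqnc_gt0// -(cemb_inj0 HJ) -qE.
by rewrite -(norm_cemb HJ) -(real_part_cemb HJ) -qE.
Qed.

Lemma Q_sliceE (y t : R) z :
  Q_slice y t z = z ^+ 2 - (2 * (t * cos y) +i* 0)%C * z + (t ^+ 2 +i* 0)%C.
Proof.
case: z => a b; have := polar_norm t y; rewrite /Q_slice /ray_pt cosN sinN.
set u := t * cos y; set v := t * sin y => <-; rewrite expr2 mulrN -/v.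
by apply/eqP; rewrite eq_complex /=; apply/andP; split; apply/eqP; ring.
Qed.

Lemma sqr_norm_ray J (y t : R) : unit_sphere J -> `|t *: expc J y| ^+ 2 = t ^+ 2.
Proof. by move=> HJ; rewrite scale_expc (sqr_norm_cemb HJ) /sqnc /= polar_norm. Qed.

Lemma norm_ray J (y t : R) : unit_sphere J -> 0 < t -> `|t *: expc J y| = t.
Proof.
move=> HJ t0; apply/eqP; rewrite -(@eqrXn2 _ 2)// ?(ltW t0)//.
by rewrite sqr_norm_ray.
Qed.

Lemma real_part_ray J (y t : R) : unit_sphere J -> real_part (t *: expc J y) = t * cos y.
Proof. by move=> HJ; rewrite scale_expc (real_part_cemb HJ). Qed.

Lemma Qval_cemb J I (y t : R) z : unit_sphere J -> unit_sphere I ->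
  Qval (t *: expc J y) (cemb I z) = cemb I (Q_slice y t z).
Proof.
move=> HJ HI; rewrite /Qval (real_part_ray _ _ HJ) (sqr_norm_ray _ _ HJ) Q_sliceE.
by rewrite cembD cembB cemb_real cembZ expr2 (cembM HI).
Qed.

Section angle.
Variables (om phi : R).
Hypothesis om0 : 0 < om.
Hypothesis omphi : om < phi.
Hypothesis phi2 : phi < pi / 2.

(** For z in the closed double sector of angle om and a boundary ray of angle phi,
    |z - t e^{iy}|^2 is at least this constant times t^2 + |z|^2. *)
Definition angle_gap : R := 1 - cos (phi - om).

Lemma angle_gap_gt0 : 0 < angle_gap.
Proof.
rewrite subr_gt0; apply: cos_lt1; have := @pi_gt0 R => pp.
move: om0 omphi phi2 => h1 h2 h3.
by rewrite gtr0_norm ?subr_gt0// h2/=; lra.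
Qed.

(** The inner product of z with the boundary direction is largest when arg z = om. *)
Lemma angle_bound (a b r : R) : 0 < r -> 0 <= a -> 0 <= b -> a ^+ 2 + b ^+ 2 = r ^+ 2 ->
  cos om * r <= a -> a * cos phi + b * sin phi <= r * cos (phi - om).
Proof.
move=> r0 a0 b0 abr ca; have pp := @pi_gt0 R.
move: om0 omphi phi2 => h1 h2 h3.
pose x := a / r; have x0 : 0 <= x by rewrite divr_ge0// ltW.
have xy : x ^+ 2 + (b / r) ^+ 2 = 1.
  by rewrite /x !expr_div_n -mulrDl abr divff// sqrf_eq0 gt_eqF.
have x1 : x <= 1.
  by rewrite -(@ler_pXn2r _ 2)// ?nnegrE// expr1n -xy lerDl sqr_ge0.
have xI : -1 <= x <= 1 by rewrite x1 andbT (le_trans _ x0)// lerN10.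
pose psi := acos x.
have psi0 : 0 <= psi by exact: acos_ge0.
have psipi : psi <= pi by exact: acos_lepi.
have cpsi : cos psi = x by apply: acosK; rewrite in_itv/=.
have spsi : sin psi = b / r.
  by rewrite sin_acos// -xy addrAC subrr add0r sqrtr_sqr ger0_norm// divr_ge0// ltW.
have omI : om \in `[0, pi] by rewrite in_itv/= (ltW h1)/=; lra.
have psiI : psi \in `[0, pi] by rewrite in_itv/= psi0.
have psiom : psi <= om.
  rewrite leNgt; apply/negP => h.
  have : cos psi < cos om by rewrite ltr_cos.
  by rewrite cpsi ltNge /x ler_pdivlMr// ca.
have I1 : phi - psi \in `[0, pi] by rewrite in_itv/=; apply/andP; split; lra.
have I2 : phi - om \in `[0, pi] by rewrite in_itv/=; apply/andP; split; lra.
have : cos (phi - psi) <= cos (phi - om).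
  rewrite leNgt; apply/negP; rewrite ltr_cos// => h; lra.
rewrite cosB cpsi spsi /x => h.
have -> : a * cos phi + b * sin phi = r * (cos phi * (a / r) + sin phi * (b / r)).
  by field; rewrite gt_eqF.
by rewrite ler_pM2l.
Qed.

Lemma dist_bound (y t : R) z : `|cos y| = cos phi -> `|sin y| = sin phi -> 0 < t ->
  0 < sqnc z -> cos om * Num.sqrt (sqnc z) <= `|Re z| ->
  angle_gap * (t ^+ 2 + sqnc z) <= sqnc (z - ray_pt y t).
Proof.
move=> cy sy t0 z0 cz; set r := Num.sqrt (sqnc z) in cz.
have r0 : 0 < r by rewrite sqrtr_gt0.
have r2 : r ^+ 2 = sqnc z by rewrite sqr_sqrtr// ltW.
have H := @angle_bound `|Re z| `|Im z| r r0 (normr_ge0 _) (normr_ge0 _).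
have {}H : `|Re z| * cos phi + `|Im z| * sin phi <= r * cos (phi - om).
  by apply: H => //; rewrite r2 /sqnc !real_normK ?num_real.
have E : sqnc (z - ray_pt y t) = t ^+ 2 + r ^+ 2 - 2 * t * (Re z * cos y + Im z * sin y).
  rewrite r2 -(polar_norm t y); case: z {cz r r0 r2 H z0} => a b.
  by rewrite /sqnc /ray_pt /=; ring.
have H2 : Re z * cos y + Im z * sin y <= r * cos (phi - om).
  apply: le_trans H; rewrite -cy -sy -!normrM.
  by rewrite lerD// ler_norm.
have c0 : 0 <= cos (phi - om).
  apply/ltW/cos_gt0_pihalf; move: om0 omphi phi2 => *; apply/andP; split; lra.
rewrite E -r2 /angle_gap; set c := cos _ in c0 H2 *; set w := Re z * _ + _ in H2 *.
have h1 : 2 * t * w <= 2 * t * (r * c) by rewrite ler_pM2l// mulr_gt0.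
have h2 : 0 <= c * (t - r) ^+ 2 by rewrite mulr_ge0// sqr_ge0.
have -> : (1 - c) * (t ^+ 2 + r ^+ 2) = t ^+ 2 + r ^+ 2 - (c * (t - r) ^+ 2 + 2 * t * (r * c)) by ring.
lra.
Qed.

Variables (J : cliff) (y : R).
Hypothesis HJ : unit_sphere J.
Hypothesis d1 : (1 <= d)%N.
Hypothesis cy : `|cos y| = cos phi.
Hypothesis sy : `|sin y| = sin phi.

Let w := expc J y.

Lemma Q_bound (t : R) z : 0 < t -> 0 < sqnc z -> cos om * Num.sqrt (sqnc z) <= `|Re z| ->
  (angle_gap * (t ^+ 2 + sqnc z)) ^+ 2 <= sqnc (Q_slice y t z).
Proof.
move=> t0 z0 cz; rewrite /Q_slice sqncM expr2; have k0 := angle_gap_gt0.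
have p0 : 0 <= angle_gap * (t ^+ 2 + sqnc z).
  by apply: mulr_ge0; [exact: ltW|rewrite addr_ge0 ?sqr_ge0 ?(ltW z0)].
by apply: ler_pM => //; apply: dist_bound => //; rewrite ?cosN ?sinN ?normrN.
Qed.

Lemma Q_slice_neq0 (t : R) z : 0 < t -> 0 < sqnc z -> cos om * Num.sqrt (sqnc z) <= `|Re z| ->
  Q_slice y t z != 0.
Proof.
move=> t0 z0 cz; rewrite -sqnc_eq0 gt_eqF// (lt_le_trans _ (Q_bound t0 z0 cz))//.
by rewrite exprn_gt0// mulr_gt0 ?angle_gap_gt0// addr_gt0// exprn_gt0.
Qed.

Lemma Qval_inv (t : R) q : 0 < t -> sector_pt om q ->
  Qval (t *: w) q * pinv (Qval (t *: w) q) = 1 /\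
  pinv (Qval (t *: w) q) * Qval (t *: w) q = 1.
Proof.
move=> t0 /(sector_pt_slice d1)[I [z [HI -> z0 Iz cz]]].
rewrite (Qval_cemb _ _ _ HJ HI) (pinv_cemb HI) -!(cembM HI).
by rewrite mulfV ?mulVf ?Q_slice_neq0// cemb1.
Qed.

Lemma norm_le_sqnc I z (c : R) : unit_sphere I -> 0 <= c -> sqnc z <= c ^+ 2 ->
  `|cemb I z : cliff| <= c.
Proof.
move=> HI c0 h; rewrite -(@ler_pXn2r _ 2)// ?nnegrE//.
by rewrite (sqr_norm_cemb HI).
Qed.

Lemma pinvQ_bound (t : R) q : 0 < t -> sector_pt om q ->
  `|pinv (Qval (t *: w) q)| <= (angle_gap * (t ^+ 2 + `|q| ^+ 2))^-1.
Proof.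
move=> t0 /(sector_pt_slice d1)[I [z [HI -> z0 Iz cz]]].
rewrite (Qval_cemb _ _ _ HJ HI) (pinv_cemb HI) (sqr_norm_cemb HI).
have p0 : 0 < angle_gap * (t ^+ 2 + sqnc z).
  by rewrite mulr_gt0 ?angle_gap_gt0// addr_gt0// exprn_gt0.
apply: norm_le_sqnc => //; first by rewrite invr_ge0 ltW.
rewrite sqncV exprVn lef_pV2 ?posrE ?exprn_gt0//; first exact: Q_bound.
by rewrite sqnc_gt0// Q_slice_neq0.
Qed.

Lemma norm_conjc_ray (t : R) : 0 < t -> `|conjc (t *: w)| = t.
Proof.
move=> t0; rewrite /w scale_expc (conjc_cemb HJ) -[RHS](norm_ray y HJ t0) scale_expc.
by rewrite !(norm_cemb HJ) /sqnc /= sqrrN.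
Qed.

(** Q_s(q)^{-1} is at most of order 1 / (t^2 + |q|^2), and it is multiplied by conj(s)
    and by q, of sizes t and |q|. *)
Lemma S_resolvent_val_bound (t : R) q : 0 < t -> sector_pt om q -> `|S_resolvent_val (t *: w) q| <= 2 * Mn / (angle_gap * t).
Proof.
move=> t0 Kq; rewrite /S_resolvent_val; have P := pinvQ_bound t0 Kq; have k0 := angle_gap_gt0.
set r := `|q| in P; set u := pinv _ in P *.
have r0 : 0 <= r := normr_ge0 _.
have M0 := @Mnorm_gt0 R d.
apply: (@le_trans _ _ (Mn * ((angle_gap * (t ^+ 2 + r ^+ 2))^-1 * (t + r)))).
  rewrite (le_trans (ler_normB _ _))// mulrDr mulrDr.
  apply: lerD; rewrite (le_trans (norm_mul _ _))// ler_pM2l//.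
    by rewrite norm_conjc_ray// ler_wpM2r// ltW.
  by rewrite mulrC ler_wpM2r.
have tr0 : 0 < t ^+ 2 + r ^+ 2 by rewrite ltr_wpDr ?sqr_ge0// exprn_gt0.
have -> : 2 * Mn / (angle_gap * t) = Mn * (2 / (angle_gap * t)) by ring.
rewrite ler_pM2l// mulrC ler_pdivrMr ?mulr_gt0//.
have -> : 2 / (angle_gap * t) * (angle_gap * (t ^+ 2 + r ^+ 2)) = 2 * (t ^+ 2 + r ^+ 2) / t.
  by field; rewrite !gt_eqF.
rewrite ler_pdivlMr//.
have : 0 <= (t - r) ^+ 2 by exact: sqr_ge0.
have := sqr_ge0 r; rewrite !expr2; nra.
Qed.

(** The bound does not depend on q: the difference of two values of Q_s(q)^{-1} carries
    the factor (b + |q|) / (a^2 + |q|^2)^2, which still decays after multiplication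
    by b + |q|. *)
Lemma S_resolvent_val_lip (a b t t' : R) q : 0 < a -> a <= t <= b -> a <= t' <= b -> sector_pt om q ->
  `|S_resolvent_val (t *: w) q - S_resolvent_val (t' *: w) q| <=
  Mn * (4 * b ^+ 2 / (angle_gap ^+ 2 * a ^+ 4) + (angle_gap * a ^+ 2)^-1) * `|t - t'|.
Proof.
move=> a0 /andP[at_ tb] /andP[at' t'b] Kq.
have k0 := angle_gap_gt0; have M0 := @Mnorm_gt0 R d.
have t0 : 0 < t by exact: lt_le_trans at_.
have t'0 : 0 < t' by exact: lt_le_trans at'.
have b0 : 0 < b by exact: lt_le_trans tb.
rewrite /S_resolvent_val; set u := pinv (Qval (t *: w) q); set u' := pinv (Qval (t' *: w) q).
set r := `|q|; have r0 : 0 <= r := normr_ge0 _.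
have D : `|u - u'| <= `|t - t'| * (2 * (b + r)) / (angle_gap * (a ^+ 2 + r ^+ 2)) ^+ 2.
  rewrite /u /u' /r; case: (sector_pt_slice d1 Kq) => I [z [HI -> z0 Iz cz]].
  rewrite !(Qval_cemb _ _ _ HJ HI) !(pinv_cemb HI) -cembB.
  have Q0 := Q_slice_neq0 t0 z0 cz; have Q'0 := Q_slice_neq0 t'0 z0 cz.
  set rz := `|cemb I z|; have rz2 : rz ^+ 2 = sqnc z by exact: (sqr_norm_cemb HI).
  have rz0 : 0 <= rz := normr_ge0 _.
  have az : 0 < angle_gap * (a ^+ 2 + rz ^+ 2).
    by apply: mulr_gt0 => //; rewrite ltr_wpDr ?sqr_ge0// exprn_gt0.
  apply: norm_le_sqnc => //.
    by rewrite divr_ge0 ?exprn_ge0 ?(ltW az)// !mulr_ge0// addr_ge0// ltW.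
  have -> : (Q_slice y t z)^-1 - (Q_slice y t' z)^-1 =
     ((t' - t) +i* 0)%C * (((t' + t) +i* 0)%C - (2 * cos y +i* 0)%C * z) * (Q_slice y t z * Q_slice y t' z)^-1.
    have -> : (Q_slice y t z)^-1 - (Q_slice y t' z)^-1 = (Q_slice y t' z - Q_slice y t z) * (Q_slice y t z * Q_slice y t' z)^-1.
      by field; rewrite Q0 Q'0.
    congr (_ * _); rewrite !Q_sliceE; case: (z) => A B.
    by apply/eqP; rewrite eq_complex /=; apply/andP; split; apply/eqP; ring.
  rewrite sqncM sqncV sqncM sqncM expr_div_n exprMn.
  have e1 : sqnc ((t' - t) +i* 0)%C = `|t - t'| ^+ 2.
    by rewrite /sqnc /= expr0n addr0 distrC real_normK ?num_real.
  rewrite e1; apply: ler_pM; rewrite ?mulr_ge0 ?invr_ge0 ?mulr_ge0 ?sqnc_ge0 ?sqr_ge0//.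
    rewrite ler_wpM2l ?sqr_ge0//.
    have -> : sqnc (((t' + t) +i* 0)%C - (2 * cos y +i* 0)%C * z) =
      (t' + t) ^+ 2 - 4 * (t' + t) * (cos y * Re z) + 4 * (cos y ^+ 2 * rz ^+ 2).
      by rewrite rz2; case: (z) => A B; rewrite /sqnc /=; ring.
    have cy1 : cos y ^+ 2 <= 1 by rewrite -(cos2Dsin2 y) lerDl sqr_ge0.
    have cz1 : `|cos y * Re z| <= rz.
      rewrite -(@ler_pXn2r _ 2)// ?nnegrE// real_normK ?num_real// exprMn.
      apply: (@le_trans _ _ (1 * Re z ^+ 2)); first by rewrite ler_wpM2r ?sqr_ge0.
      by rewrite mul1r rz2 /sqnc lerDl sqr_ge0.
    have {}cz1 : - (cos y * Re z) <= rz by rewrite (le_trans (ler_norm _))// normrN.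
    have h1 : (t' + t) * - (cos y * Re z) <= (t' + t) * rz by rewrite ler_pM2l// addr_gt0.
    have h2 : cos y ^+ 2 * rz ^+ 2 <= rz ^+ 2 by rewrite ler_piMl ?sqr_ge0.
    apply: (@le_trans _ _ ((t' + t + 2 * rz) ^+ 2)).
      have -> : (t' + t + 2 * rz) ^+ 2 = (t' + t) ^+ 2 + 4 * ((t' + t) * rz) + 4 * rz ^+ 2 by ring.
      lra.
    by rewrite ler_pXn2r ?nnegrE ?addr_ge0 ?mulr_ge0 ?addr_ge0 ?(ltW t0) ?(ltW t'0) ?(ltW b0)//; lra.
  have QQ0 : 0 < sqnc (Q_slice y t z) * sqnc (Q_slice y t' z) by rewrite mulr_gt0// sqnc_gt0.
  have AA0 : 0 < (angle_gap * (a ^+ 2 + rz ^+ 2)) ^+ 2 ^+ 2 by rewrite !exprn_gt0.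
  rewrite lef_pV2 ?posrE//.
  have qb (s : R) : a <= s -> (angle_gap * (a ^+ 2 + rz ^+ 2)) ^+ 2 <= sqnc (Q_slice y s z).
    move=> as_; have s0 := lt_le_trans a0 as_.
    apply: le_trans (Q_bound s0 z0 cz); rewrite -rz2.
    have sr : 0 < angle_gap * (s ^+ 2 + rz ^+ 2).
      by apply: mulr_gt0 => //; rewrite ltr_wpDr ?sqr_ge0// exprn_gt0.
    rewrite ler_pXn2r ?nnegrE ?(ltW az) ?(ltW sr)//.
    by rewrite ler_pM2l// lerD2r ler_pXn2r ?nnegrE ?(ltW a0) ?(ltW s0).
  rewrite [leLHS]expr2; apply: ler_pM; rewrite ?sqr_ge0//; exact: qb.
have P : `|u'| <= (angle_gap * a ^+ 2)^-1.
  apply: (le_trans (pinvQ_bound t'0 Kq)).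
  have a20 : 0 < angle_gap * a ^+ 2 by rewrite mulr_gt0// exprn_gt0.
  have a2r : 0 < angle_gap * (t' ^+ 2 + `|q| ^+ 2).
    by apply: mulr_gt0 => //; rewrite ltr_wpDr ?sqr_ge0// exprn_gt0.
  rewrite lef_pV2 ?posrE//.
  rewrite ler_pM2l// (@le_trans _ _ (t' ^+ 2))// ?lerDl ?sqr_ge0//.
  by rewrite ler_pXn2r ?nnegrE ?(ltW a0) ?(ltW t'0).
have cE : conjc (t *: w) - conjc (t' *: w) = (t - t') *: conjc w.
  by apply: coefP => A; rewrite coefB coefZ /coef !ffunE -!/(coef _ _) !coefZ; ring.
have cw : `|conjc w| = 1 by rewrite -(scale1r w) norm_conjc_ray.
clearbody u u'.
have -> : u * conjc (t *: w) - q * u - (u' * conjc (t' *: w) - q * u') =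
   (u - u') * conjc (t *: w) + u' * (conjc (t *: w) - conjc (t' *: w)) - q * (u - u').
  by rewrite !mulrBl !mulrBr !opprB !addrA subrK addrAC (addrAC (u * _)) addrAC.
set X := `|t - t'|; have X0 : 0 <= X := normr_ge0 _.
have nE : `|conjc (t *: w) - conjc (t' *: w)| = X.
  by rewrite cE normrZ -[RHS]mulr1; congr (_ * _).
set DD := X * _ / _ in D.
apply: (@le_trans _ _ (Mn * (DD * t) + Mn * ((angle_gap * a ^+ 2)^-1 * X) + Mn * (r * DD))).
  rewrite (le_trans (ler_normB _ _))//; apply: lerD; last first.
    by rewrite (le_trans (norm_mul _ _))// ler_pM2l// ler_wpM2l.
  rewrite (le_trans (ler_normD _ _))//; apply: lerD; rewrite (le_trans (norm_mul _ _))// ler_pM2l//.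
    by rewrite norm_conjc_ray// ler_wpM2r// ltW.
  by rewrite nE ler_wpM2r.
have -> : Mn * (DD * t) + Mn * ((angle_gap * a ^+ 2)^-1 * X) + Mn * (r * DD) =
  Mn * (DD * (t + r) + (angle_gap * a ^+ 2)^-1 * X) by ring.
rewrite -[leRHS]mulrA ler_pM2l// [leRHS]mulrDl lerD2r.
have DD0 : 0 <= DD.
  by rewrite /DD divr_ge0 ?sqr_ge0// !mulr_ge0// addr_ge0// ltW.
apply: (@le_trans _ _ (DD * (b + r))); first by rewrite ler_wpM2l// lerD2r.
rewrite /DD [leRHS]mulrC.
have -> : X * (2 * (b + r)) / (angle_gap * (a ^+ 2 + r ^+ 2)) ^+ 2 * (b + r) =
  X * (2 * (b + r) ^+ 2 / (angle_gap * (a ^+ 2 + r ^+ 2)) ^+ 2) by ring.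
rewrite ler_wpM2l//.
have ar0 : 0 < a ^+ 2 + r ^+ 2 by rewrite ltr_wpDr ?sqr_ge0// exprn_gt0.
rewrite ler_pdivrMr ?exprn_gt0 ?mulr_gt0// mulrAC ler_pdivlMr ?mulr_gt0 ?exprn_gt0//.
have ab : a <= b by exact: le_trans tb.
have ab2 : a ^+ 2 <= b ^+ 2 by rewrite ler_pXn2r ?nnegrE ?(ltW a0) ?(ltW b0).
have h1 : a ^+ 2 * (b ^+ 2 + r ^+ 2) <= b ^+ 2 * (a ^+ 2 + r ^+ 2).
  have : a ^+ 2 * r ^+ 2 <= b ^+ 2 * r ^+ 2 by rewrite ler_wpM2r ?sqr_ge0.
  by rewrite !mulrDr; lra.
have h2 : (b + r) ^+ 2 <= 2 * (b ^+ 2 + r ^+ 2).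
  rewrite -subr_ge0; have -> : 2 * (b ^+ 2 + r ^+ 2) - (b + r) ^+ 2 = (b - r) ^+ 2 by ring.
  exact: sqr_ge0.
have h3 : a ^+ 2 <= a ^+ 2 + r ^+ 2 by rewrite lerDl sqr_ge0.
have k2 : 0 < angle_gap ^+ 2 by rewrite exprn_gt0.
have -> : 4 * b ^+ 2 * (angle_gap * (a ^+ 2 + r ^+ 2)) ^+ 2 = angle_gap ^+ 2 * (4 * ((b ^+ 2 * (a ^+ 2 + r ^+ 2)) * (a ^+ 2 + r ^+ 2))) by ring.
have -> : 2 * (b + r) ^+ 2 * (angle_gap ^+ 2 * a ^+ 4) = angle_gap ^+ 2 * (4 * (a ^+ 2 * ((b + r) ^+ 2 / 2) * a ^+ 2)) by field.
rewrite ler_pM2l// ler_pM2l//.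
have a20 : 0 < a ^+ 2 by rewrite exprn_gt0.
have g0 : 0 <= a ^+ 2 * ((b + r) ^+ 2 / 2).
  by rewrite mulr_ge0 ?(ltW a20)// divr_ge0// sqr_ge0.
apply: ler_pM => //; first exact: ltW.
apply: le_trans h1; rewrite ler_pM2l//; lra.
Qed.

End angle.
End scalar_resolvent.

(** * The Cauchy formula in the double sector *)

Section double_sector_cauchy.
Context {R : realType}.
Implicit Types (p : R * R) (D : set (R * R)) (u v : R * R -> R).

Lemma polar_holo_shift D u v (beta : R) : polar_holo D u v ->
  polar_holo [set p | D (p.1, p.2 + beta)] (fun p => u (p.1, p.2 + beta))
    (fun p => v (p.1, p.2 + beta)).
Proof.
move=> [ut [vt h]]; exists (fun p => ut (p.1, p.2 + beta)), (fun p => vt (p.1, p.2 + beta)).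
move=> [t y] /= Dp; have [[h1 h2 h3 h4] [c1 c2 c3 c4]] := h _ Dp.
have ds : is_derive y (1 : R) (fun y => y + beta) 1.
  by have := is_deriveD (is_derive_id y 1) (is_derive_cst beta y 1); rewrite addr0; apply.
have cs : {for (t, y), continuous (fun p : R * R => (p.1, p.2 + beta))}.
  have c_2 : {for (t, y), continuous (fun p : R * R => p.2 + beta)}.
    by apply: continuousD; [exact: cvg_snd|exact: cst_continuous].
  exact: (cvg_pair (@cvg_fst _ _ _ _ _ ) c_2).
have comp w : {for (t, y + beta), continuous w} ->
    {for (t, y), continuous (fun p : R * R => w (p.1, p.2 + beta) : R)}.
  by move=> cw; exact: (@continuous_comp _ _ _ (fun p : R * R => (p.1, p.2 + beta)) w _ cs cw).
split; last by split; [exact: comp c1|exact: comp c2|exact: comp c3|exact: comp c4].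
split => //=.
- have := is_derive1_comp (f := fun y => u (t, y)) (g := fun y => y + beta) h3 ds.
  by rewrite /GRing.scale/= mulr1; apply.
- have := is_derive1_comp (f := fun y => v (t, y)) (g := fun y => y + beta) h4 ds.
  by rewrite /GRing.scale/= mulr1; apply.
Qed.

Lemma cos_gtN1 (x : R) : `|x| < pi -> -1 < cos x.
Proof.
move=> xpi; have -> : cos x = cos `|x| by case: (ger0P x) => //; rewrite cosN.
rewrite -cospi ltr_cos ?in_itv//= ?pi_ge0 ?lexx// normr_ge0/=; exact: ltW.
Qed.

Lemma cos_norm_lt (x y : R) : `|x| < y -> y < pi -> cos y < cos x.
Proof.
move=> xy ypi; have -> : cos x = cos `|x| by case: (ger0P x) => //; rewrite cosN.
have y0 : 0 < y by apply: le_lt_trans xy.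
have x0 := normr_ge0 x.
by rewrite ltr_cos ?in_itv//= ?x0 ?(ltW y0) ?(ltW ypi)//= (ltW (lt_trans xy ypi)).
Qed.

Lemma cos_norm_le (x y : R) : `|x| <= y -> y < pi -> cos y <= cos x.
Proof.
rewrite le_eqVlt => /predU1P[<- _|xy ypi]; last exact/ltW/cos_norm_lt.
by case: (ger0P x) => //; rewrite ?cosN.
Qed.

Section total.
Variables (th om phi r psi : R) (u v : R * R -> R) (Xi : R -> R).
Hypothesis om0 : 0 < om.
Hypothesis omphi : om < phi.
Hypothesis phith : phi < th.
Hypothesis th2 : th < pi / 2.
Hypothesis huv : polar_holo (polar_set (slice_cone th)) u v.
Hypothesis decay : forall p, 0 < p.1 -> cos phi <= `|cos p.2| -> `|u p| + `|v p| <= Xi p.1.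
Hypothesis r0 : 0 < r.

Definition kernel_rint (beta y a b : R) : R := rint a b (fun t =>
  (kerRe r psi (t, y + beta) * u (t, y + beta) -
   kerIm r psi (t, y + beta) * v (t, y + beta)) / t).

Let e1 : R := (th - phi) / 2.

Let facts : [/\ 0 < phi, 0 < e1, phi + e1 < pi / 2, phi + e1 < th & 0 < pi :> R].
Proof.
have pp := @pi_gt0 R; rewrite /e1; move: om0 omphi phith th2 => *; split => //; lra.
Qed.

Let HintE beta y a b : kernel_rint beta y a b = rint a b (fun t =>
  (kerRe r (psi - beta) (t, y) * u (t, y + beta) -
   kerIm r (psi - beta) (t, y) * v (t, y + beta)) / t).
Proof.
apply: rint_eq => t _; rewrite /kerRe /kerIm /ker_den /=.
by have -> : y + beta - psi = y - (psi - beta) by ring.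
Qed.

Let hshift beta : `|cos beta| = 1 -> sin beta = 0 -> forall p, 0 < p.1 -> `|p.2| <= phi + e1 ->
  [set p | polar_set (slice_cone th) (p.1, p.2 + beta)] p.
Proof.
move=> cb sb [t y] /= t0 hy; have [? ? ? ? ?] := facts.
apply/polar_set_cone => //; rewrite cosD sb mulr0 subr0 normrM cb mulr1.
rewrite (lt_le_trans _ (ler_norm _))//; apply: cos_norm_lt; first lra.
move: th2; lra.
Qed.

Let dshift beta : `|cos beta| = 1 -> sin beta = 0 -> forall p, 0 < p.1 -> `|p.2| <= phi ->
  `|u (p.1, p.2 + beta)| + `|v (p.1, p.2 + beta)| <= Xi p.1.
Proof.
move=> cb sb [t y] /= t0 hy; have [? ? ? ? ?] := facts.
apply: (@decay (t, y + beta)) => //=.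
rewrite cosD sb mulr0 subr0 normrM cb mulr1.
rewrite (le_trans _ (ler_norm _))//; apply: cos_norm_le => //; lra.
Qed.

Lemma pole_inside beta a b : `|cos beta| = 1 -> sin beta = 0 -> 0 < a -> 2 * a <= r ->
  2 * r <= b -> `|psi - beta| < phi ->
  `|kernel_rint beta phi a b - kernel_rint beta (- phi) a b - 2 * pi * v (r, psi)| <=
  8 * phi * (Xi a + Xi b).
Proof.
move=> cb sb a0 ar rb ps; have [p0 e0 pe1 pe2 pp] := facts.
have := sector_cauchy_inside (polar_holo_shift beta huv) p0 e0 pe1 (hshift cb sb)
  (dshift cb sb) r0 a0 ar rb ps.
by rewrite !HintE subrK.
Qed.

Lemma pole_outside beta a b : `|cos beta| = 1 -> sin beta = 0 -> 0 < a -> 2 * a <= r ->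
  2 * r <= b -> (forall y, `|y| <= phi + e1 -> cos (y - (psi - beta)) < 1) ->
  `|kernel_rint beta phi a b - kernel_rint beta (- phi) a b| <= 8 * phi * (Xi a + Xi b).
Proof.
move=> cb sb a0 ar rb ps; have [p0 e0 pe1 pe2 pp] := facts.
have := sector_cauchy_outside (polar_holo_shift beta huv) p0 e0 (hshift cb sb)
  (dshift cb sb) r0 a0 ar rb ps.
by rewrite !HintE.
Qed.

(** The double sector is the union of a sector around the angle 0 and of one around pi.
    The pole lies in exactly one of them, and the other contributes only arcs. *)
Lemma double_sector_cauchy a b : 0 < a -> 2 * a <= r -> 2 * r <= b ->
  0 <= psi <= pi -> cos om <= `|cos psi| ->
  `|(kernel_rint 0 phi a b - kernel_rint 0 (- phi) a b) + (kernel_rint pi phi a b - kernel_rint pi (- phi) a b)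
     - 2 * pi * v (r, psi)| <= 16 * phi * (Xi a + Xi b).
Proof.
move=> a0 ar rb /andP[ps0 pspi] cps; have [p0 e0 pe1 pe2 pp] := facts.
have c0 : `|cos (0 : R)| = 1 by rewrite cos0 normr1.
have cpi : `|cos (pi : R)| = 1 by rewrite cospi normrN1.
have s0 := @sin0 R; have spi := @sinpi R.
have cmp (x : R) : 0 <= x <= pi -> cos om <= cos x -> x <= om.
  move=> /andP[x0 xpi] h; rewrite leNgt; apply/negP => omx.
  have : cos x < cos om.
    by rewrite ltr_cos// in_itv/= ?x0// (ltW om0)/=; move: omphi phith th2; lra.
  by rewrite ltNge h.
have -> : 16 * phi * (Xi a + Xi b) = 8 * phi * (Xi a + Xi b) + 8 * phi * (Xi a + Xi b) by ring.
have [cp|cn] := lerP 0 (cos psi).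
  have pso : psi <= om by apply: cmp; [rewrite ps0|rewrite -[leRHS]ger0_norm].
  have H1 := @pole_inside 0 a b c0 s0 a0 ar rb.
  have {}H1 := H1 ltac:(by rewrite subr0 ger0_norm//; exact: le_lt_trans omphi).
  have H2 := @pole_outside pi a b cpi spi a0 ar rb.
  have {}H2 : `|kernel_rint pi phi a b - kernel_rint pi (- phi) a b| <= 8 * phi * (Xi a + Xi b).
    apply: H2 => y hy; have -> : y - (psi - pi) = (y - psi) + pi by ring.
    rewrite cosDpi; have : -1 < cos (y - psi).
      apply: cos_gtN1; rewrite (le_lt_trans (ler_normB _ _))// [`|psi|]ger0_norm//.
      by move: omphi; lra.
    by lra.
  rewrite addrAC (le_trans (ler_normD _ _))//; exact: lerD.
have pso : pi - psi <= om.
  apply: cmp; first by apply/andP; split; lra.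
  by rewrite addrC cosDpi cosN -ltr0_norm.
have H1 := @pole_inside pi a b cpi spi a0 ar rb.
have {}H1 := H1 ltac:(by rewrite ler0_norm; [move: omphi; lra|lra]).
have H2 := @pole_outside 0 a b c0 s0 a0 ar rb.
have {}H2 : `|kernel_rint 0 phi a b - kernel_rint 0 (- phi) a b| <= 8 * phi * (Xi a + Xi b).
  apply: H2 => y hy; rewrite subr0; have -> : y - psi = - ((psi - pi - y) + pi) by ring.
  rewrite cosN cosDpi; have : -1 < cos (psi - pi - y).
    apply: cos_gtN1; rewrite (le_lt_trans (ler_normB _ _))// [`|psi - pi|]ler0_norm; last lra.
    by move: omphi; lra.
  by lra.
rewrite -addrA (le_trans (ler_normD _ _))//; exact: lerD.
Qed.

End total.
End double_sector_cauchy.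

(** * The Cauchy formula for slice functions *)

Section slice_kernel.
Context {R : realType} {d : nat}.
Local Notation cliff := (clifford R d).
Local Notation Re := (@complex.Re R).
Local Notation Im := (@complex.Im R).
Local Notation Mn := (Mnorm R d).
Implicit Types (p : R * R) (J I s q : cliff) (z : R[i]).

Lemma ray_cart J (t y : R) :
  t *: expc J y = (cart (t, y)).1%:A + (cart (t, y)).2 *: J :> cliff.
Proof. by rewrite scale_expc. Qed.

Lemma loc_lip_coefs (F : R -> cliff) :
  (forall A a b, 0 < a -> a <= b -> exists2 L, 0 <= L &
    forall t t', a <= t <= b -> a <= t' <= b -> `|coef (F t) A - coef (F t') A| <= L * `|t - t'|) ->
  loc_lip F.
Proof.
move=> H a b a0 ab.
have /boolp.choice[L HL] A : exists L, 0 <= L /\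
    forall t t', a <= t <= b -> a <= t' <= b -> `|coef (F t) A - coef (F t') A| <= L * `|t - t'|.
  by have [L L0 HL] := H A a b a0 ab; exists L.
exists (\sum_A L A) => [|t t' tI t'I].
  by apply: sumr_ge0 => A _; case: (HL A).
rewrite (le_trans (norm_le_sum _))// mulr_suml; apply: ler_sum => A _.
by rewrite coefB; case: (HL A) => _; exact.
Qed.

Lemma loc_lip_mull (c : cliff) F : loc_lip F -> loc_lip (fun t => c * F t).
Proof.
move=> lF a b a0 ab; have [L L0 HL] := lF a b a0 ab.
have M0 := @Mnorm_gt0 R d.
exists (Mn * (`|c| * L)) => [|t t' tI t'I].
  by apply: mulr_ge0; [exact: ltW|exact: mulr_ge0].
rewrite -mulrBr (le_trans (norm_mul _ _))// -[leRHS]mulrA ler_pM2l// -mulrA.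
by apply: ler_pM => //; exact: HL.
Qed.

Lemma loc_lipD (F G : R -> cliff) : loc_lip F -> loc_lip G -> loc_lip (fun t => F t + G t).
Proof.
move=> lF lG a b a0 ab; have [L L0 HL] := lF a b a0 ab; have [K K0 HK] := lG a b a0 ab.
exists (L + K) => [|t t' tI t'I]; first exact: addr_ge0.
rewrite opprD addrACA (le_trans (ler_normD _ _))// mulrDl; apply: lerD; [exact: HL|exact: HK].
Qed.

Lemma loc_lip_eq (F G : R -> cliff) : (forall t, 0 < t -> F t = G t) -> loc_lip F -> loc_lip G.
Proof.
move=> FG lF a b a0 ab; have [L L0 HL] := lF a b a0 ab; exists L => // t t' tI t'I.
have t0 : 0 < t by case/andP: tI => + _; exact: lt_le_trans.
have t'0 : 0 < t' by case/andP: t'I => + _; exact: lt_le_trans.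
by rewrite -!FG//; exact: HL.
Qed.

Lemma polar_holo_lip D (u v : R * R -> R) (y a b : R) : polar_holo D u v ->
  (forall t, a <= t <= b -> D (t, y)) -> exists2 L, 0 <= L &
    forall t t', a <= t <= b -> a <= t' <= b -> `|u (t, y) - u (t', y)| <= L * `|t - t'|.
Proof.
move=> [ut [vt h]] aD.
have [M M0 HM] : exists2 M : R, 0 < M & forall p, rect a b y y p -> `|ut p| <= M.
  apply: rect_bounded => -[t y'] [/= tI yI].
  have -> : y' = y by apply/le_anti; rewrite andbC.
  by have [_ []] := h _ (aD _ tI).
exists M => [|t t' /andP[ta tb] /andP[t'a t'b]]; first exact: ltW.
have I c : Num.min t' t <= c <= Num.max t' t -> a <= c <= b.
  move=> /andP[c1 c2]; rewrite (le_trans _ c1) ?le_min ?ta ?t'a//=.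
  by rewrite (le_trans c2)// ge_max tb t'b.
have [c cI ->] := @MVT_any R (fun t => u (t, y)) (fun t => ut (t, y)) t' t
  ltac:(by move=> c /I cI; have [[]] := h _ (aD _ cI)).
rewrite normrM ler_wpM2r//; apply: HM; split => //=; last by rewrite lexx.
exact: I.
Qed.

(** The two factors are small near 0 and near infinity respectively. *)
Lemma dTheta_Theta (de t : R) : 0 < de -> 0 < t ->
  t * dTheta de t = de * (Theta de t * Theta de t^-1).
Proof.
move=> de0 t0; rewrite ThetaV//; set T := t `^ de; have T0 : 0 < T by exact: powR_gt0.
have tT : t * t `^ (de - 1) = T.
  by rewrite -{1}(powRr1 (ltW t0)) -powRD ?(gt_eqF t0) ?implybT// addrC subrK.
rewrite /dTheta /Theta -/T.
have -> : t * (de * t `^ (de - 1) / (1 + T) ^+ 2) = de * (t * t `^ (de - 1)) / (1 + T) ^+ 2 by ring.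
rewrite tT; field; rewrite gt_eqF//; exact: powR_den_gt0.
Qed.

(** The two rays of the left sector are conjugate to each other too. *)
Lemma expc_opp_pi J (phi : R) : expc J (pi - phi) = expc J (- (pi + phi)).
Proof.
have c1 (x : R) : cos (pi + x) = - cos x by rewrite addrC cosDpi.
have s1 (x : R) : sin (pi + x) = - sin x by rewrite addrC sinDpi.
by rewrite /expc cosN sinN !c1 !s1 cosN sinN !opprK.
Qed.

(** The factor of S_L^{-1}(s, T) in the integrand along the ray s = t e^{Jy}. *)
Definition ray_density g J (y t : R) : cliff := - J * expc J y * g (t *: expc J y).

Definition ray_kernel g J (y t : R) q : cliff := S_resolvent_val (t *: expc J y) q * ray_density g J y t.

Section fixed.
Variables (om phi th de Cg : R) (g : cliff -> cliff) (G0 G1 : R * R -> cliff).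
Hypothesis d1 : (1 <= d)%N.
Hypothesis om0 : 0 < om.
Hypothesis omphi : om < phi.
Hypothesis phith : phi < th.
Hypothesis th2 : th < pi / 2.
Hypothesis de0 : 0 < de.
Hypothesis Cg0 : 0 <= Cg.
Hypothesis hg : slice_data th g G0 G1.
Hypothesis growth : forall p J s, slice_cone th p -> unit_sphere J -> s = p.1%:A + p.2 *: J ->
  `|g s| <= Cg * (`|s| * dTheta de `|s|).

(** The angles of the four rays bounding the double sector of angle phi. *)
Definition boundary_angle (y : R) := `|cos y| = cos phi /\ `|sin y| = sin phi.

Let phi2 : phi < pi / 2. Proof. exact: lt_trans th2. Qed.

Let cos_th_phi : cos th < cos phi.
Proof.
apply: cos_norm_lt; first by rewrite gtr0_norm// (lt_trans om0).
by have := @pi_gt0 R; move: th2; lra.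
Qed.

Lemma cone_cart (t y : R) : 0 < t -> cos phi <= `|cos y| -> slice_cone th (cart (t, y)).
Proof.
move=> t0 cy; have /(polar_set_cone th y t0)[] : cos th < `|cos y| by exact: lt_le_trans cy.
by [].
Qed.

Let polar_cone (t y : R) : 0 < t -> cos phi <= `|cos y| -> polar_set (slice_cone th) (t, y).
Proof. by move=> t0 cy; split => //; exact: cone_cart. Qed.

Section ray.
Variables (J : cliff) (y : R).
Hypothesis HJ : unit_sphere J.
Hypothesis gy : boundary_angle y.

Let cy : cos phi <= `|cos y|. Proof. by case: gy => ->. Qed.

Lemma slice_ray (t : R) : 0 < t ->
  g (t *: expc J y) = G0 (cart (t, y)) + J * G1 (cart (t, y)).
Proof. by move=> t0; rewrite ray_cart; case: hg => _ _ -> //; exact: cone_cart. Qed.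

Lemma ray_density_lip : loc_lip (ray_density g J y).
Proof.
apply: loc_lip_mull.
apply: (@loc_lip_eq (fun t => G0 (cart (t, y)) + J * G1 (cart (t, y)))).
  by move=> t t0; rewrite slice_ray.
case: hg => holo _ _.
have D t a b : 0 < a -> a <= t <= b -> polar_set (slice_cone th) (t, y).
  by move=> a0 /andP[/(lt_le_trans a0) t0 _]; exact: polar_cone.
apply: loc_lipD; last apply: loc_lip_mull; apply: loc_lip_coefs => A a b a0 ab.
  by apply: (polar_holo_lip (holo A)) => t; exact: D.
by apply: (polar_holo_lip (polar_holoNi (holo A))) => t; exact: D.
Qed.

Lemma ray_density_bound (t : R) : 0 < t -> `|ray_density g J y t| <= Mn ^+ 2 * Cg * (t * dTheta de t).
Proof.
move=> t0; have M0 := @Mnorm_gt0 R d.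
have h := @growth (cart (t, y)) J _ (cone_cart t0 cy) HJ erefl.
rewrite -ray_cart (norm_ray y HJ t0) in h.
have nJ : `|J| = 1 by case: HJ.
have nw : `|expc J y| = 1 by rewrite -[expc J y]scale1r norm_ray.
rewrite /ray_density (le_trans (norm_mul _ _))//.
have -> : Mn ^+ 2 * Cg * (t * dTheta de t) = Mn * (Mn * (Cg * (t * dTheta de t))) by ring.
rewrite ler_pM2l//; apply: ler_pM => //.
by rewrite (le_trans (norm_mul _ _))// normrN nJ nw !mulr1.
Qed.

Definition ray_kernel_cst : R := 2 * Mn ^+ 4 * Cg / angle_gap om phi.

Lemma ray_kernel_cst_ge0 : 0 <= ray_kernel_cst.
Proof.
have M0 := @Mnorm_gt0 R d; have k0 := angle_gap_gt0 om0 omphi phi2.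
by rewrite /ray_kernel_cst divr_ge0 ?(ltW k0)// !mulr_ge0 ?exprn_ge0 ?(ltW M0).
Qed.

Lemma ray_kernel_bound (t : R) q : 0 < t -> sector_pt om q -> `|ray_kernel g J y t q| <= ray_kernel_cst * dTheta de t.
Proof.
move=> t0 Kq; have M0 := @Mnorm_gt0 R d; have k0 := angle_gap_gt0 om0 omphi phi2.
case: gy => c1 s1.
rewrite /ray_kernel (le_trans (norm_mul _ _))//.
have := S_resolvent_val_bound om0 omphi phi2 HJ d1 c1 s1 t0 Kq; have := ray_density_bound t0.
set A := `|ray_density _ _ _ _|; set B := `|S_resolvent_val _ _| => hA hB.
apply: (@le_trans _ _ (Mn * ((2 * Mn / (angle_gap om phi * t)) * (Mn ^+ 2 * Cg * (t * dTheta de t))))).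
  by rewrite ler_pM2l// ler_pM// /A /B.
rewrite le_eqVlt; apply/orP; left; apply/eqP; rewrite /ray_kernel_cst; field.
by rewrite (gt_eqF t0) (gt_eqF k0).
Qed.

Lemma ray_kernel_lip (a b : R) : 0 < a -> a <= b -> exists2 L, 0 <= L &
  forall q, sector_pt om q -> lip_on a b L (fun t => ray_kernel g J y t q).
Proof.
move=> a0 ab; have M0 := @Mnorm_gt0 R d; have k0 := angle_gap_gt0 om0 omphi phi2.
case: gy => c1 s1; have b0 := lt_le_trans a0 ab.
have [L L0 HL] := ray_density_lip a0 ab.
pose S := Mn * (4 * b ^+ 2 / (angle_gap om phi ^+ 2 * a ^+ 4) + (angle_gap om phi * a ^+ 2)^-1).
have S0 : 0 <= S.
  apply: mulr_ge0; first exact: ltW.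
  by rewrite addr_ge0 ?invr_ge0 ?divr_ge0 ?mulr_ge0 ?exprn_ge0 ?(ltW k0) ?(ltW a0) ?(ltW b0).
pose B := 2 * Mn / (angle_gap om phi * a).
have B0 : 0 <= B by rewrite divr_ge0 ?mulr_ge0 ?(ltW M0) ?(ltW k0) ?(ltW a0).
pose C := Mn ^+ 2 * Cg * de.
have C0 : 0 <= C by rewrite !mulr_ge0 ?exprn_ge0 ?(ltW M0)// ltW.
exists (Mn * (S * C) + Mn * (B * L)) => [|q Kq t t' tI t'I].
  by rewrite addr_ge0// mulr_ge0 ?(ltW M0)// mulr_ge0.
have t0 : 0 < t by case/andP: tI => + _; exact: lt_le_trans.
have t'0 : 0 < t' by case/andP: t'I => + _; exact: lt_le_trans.
rewrite /ray_kernel; have h1 := S_resolvent_val_lip om0 omphi phi2 HJ d1 c1 s1 a0 tI t'I Kq.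
have h2 := HL _ _ tI t'I.
have h3 := S_resolvent_val_bound om0 omphi phi2 HJ d1 c1 s1 t'0 Kq; have h4 := ray_density_bound t0.
set x := S_resolvent_val _ _ in h1 *; set x' := S_resolvent_val (t' *: _) _ in h1 h3 *.
set v := ray_density _ _ _ t in h2 h4 *; set v' := ray_density _ _ _ t' in h2 *.
clearbody x x' v v'.
have -> : x * v - x' * v' = (x - x') * v + x' * (v - v').
  by rewrite mulrBl mulrBr addrA subrK.
have hC : `|v| <= C.
  apply: (le_trans h4); rewrite /C ler_wpM2l//; first by rewrite mulr_ge0 ?exprn_ge0 ?(ltW M0).
  rewrite dTheta_Theta// ler_piMr ?(ltW de0)//.
  by apply: mulr_ile1; rewrite ?Theta_ge0 ?Theta_le1.
have hB : `|x'| <= B.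
  apply: (le_trans h3); rewrite ler_wpM2l ?mulr_ge0 ?(ltW M0)//.
  rewrite lef_pV2 ?posrE ?mulr_gt0// ler_pM2l//; by case/andP: t'I.
rewrite (le_trans (ler_normD _ _))// [leRHS]mulrDl; apply: lerD; rewrite (le_trans (norm_mul _ _))// -[leRHS]mulrA ler_pM2l//.
  by rewrite mulrAC; apply: ler_pM.
by rewrite -mulrA; apply: ler_pM.
Qed.

Lemma ray_kernel_measurable (disp : measure_display) (X : measurableType disp) (h : X -> cliff) (t : R) :
  cmeasurable h -> cmeasurable (fun x => ray_kernel g J y t (h x)).
Proof.
move=> mh; apply: cmeasurableM; last exact: cmeasurable_cst.
have mS (k k' : X -> cliff) : cmeasurable k -> cmeasurable k' -> cmeasurable (fun x => k x - k' x).
  move=> mk mk'; apply: cmeasurableD' => //; under eq_fun do rewrite -scaleN1r.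
  by apply: cmeasurable_scale => //; exact: measurable_cst.
by apply: mS; apply: cmeasurableM => //; exact: cmeasurable_pinvQ.
Qed.

End ray.

(* Identities between linear combinations hold coordinatewise. *)
Local Ltac clin := apply: coefP => ?; rewrite ?(coefD, coefN, coefZ); ring.

(** Since conj(s) (- J w) = - t J, the integrand becomes a combination of U, V, J U and
    J V in which only U and V have coefficients odd under conjugation. *)
Lemma ray_kernelE J (y t : R) q : unit_sphere J ->
  let Qi := pinv (q * q - (2 * (t * cos y)) *: q + (t ^+ 2)%:A) in
  let U := G0 (cart (t, y)) in let V := G1 (cart (t, y)) in
  0 < t -> boundary_angle y ->
  ray_kernel g J y t q = Qi * (t *: V - t *: (J * U)) -
    q * Qi * ((sin y *: U + cos y *: V) + (sin y *: (J * V) - cos y *: (J * U))).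
Proof.
move=> HJ Qi U V t0 gy.
have QE : Qval (t *: expc J y) q = q * q - (2 * (t * cos y)) *: q + (t ^+ 2)%:A.
  by rewrite /Qval real_part_ray// sqr_norm_ray.
have JJ := unit_sphere_sqr HJ.
have wE : - J * expc J y = (sin y)%:A - cos y *: J.
  by rewrite mulNr /expc mulrDr -!scalerAr mulr1 JJ; clin.
have cwE : conjc (t *: expc J y) * (- J * expc J y) = - (t *: J).
  rewrite wE scale_expc (conjc_cemb HJ) /cemb /=.
  rewrite mulrDl !mulrBr -!scalerAl -!scalerAr !mul1r mulr1 JJ.
  have := cos2Dsin2 y; rewrite !expr2 => h.
  apply: coefP => A; rewrite ?(coefD, coefN, coefZ).
  transitivity (- (t * (cos y * cos y + sin y * sin y) * coef J A)); first ring.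
  by rewrite h mulr1.
rewrite /ray_kernel /S_resolvent_val /ray_density QE -/Qi slice_ray// -/U -/V mulrBl.
set m := - J * expc J y in wE cwE *; set c := conjc _ in cwE *; clearbody m c.
rewrite -!mulrA; congr (Qi * _ - q * (Qi * _)).
  by rewrite mulrA cwE mulNr -scalerAl mulrDr mulrA JJ mulN1r; clin.
by rewrite wE mulrBl -!scalerAl mul1r !mulrDr mulrA JJ mulN1r; clin.
Qed.

Lemma boundary_angle_opp (y : R) : boundary_angle y -> boundary_angle (- y).
Proof. by case=> h1 h2; split; rewrite ?cosN ?sinN ?normrN. Qed.

(** Under y |-> - y, V and sin y change sign while U and cos y do not: the terms with J
    cancel in the difference. *)
Lemma ray_kernel_conj_diff J (y t : R) q : unit_sphere J -> 0 < t -> boundary_angle y ->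
  let Qi := pinv (q * q - (2 * (t * cos y)) *: q + (t ^+ 2)%:A) in
  let U := G0 (cart (t, y)) in let V := G1 (cart (t, y)) in
  ray_kernel g J (- y) t q - ray_kernel g J y t q =
    q * Qi * (2 *: (sin y *: U + cos y *: V)) - Qi * (2 *: (t *: V)).
Proof.
move=> HJ t0 gy Qi U V.
rewrite (ray_kernelE _ HJ t0 gy) (ray_kernelE _ HJ t0 (boundary_angle_opp gy)).
have cE : cart (t, - y) = ((cart (t, y)).1, - (cart (t, y)).2).
  by rewrite /cart /= cosN sinN mulrN.
have [e0 e1] : G0 (cart (t, - y)) = U /\ G1 (cart (t, - y)) = - V.
  by rewrite cE; case: hg => _ + _; apply; apply: cone_cart => //; case: gy => ->.
rewrite e0 e1 cosN sinN -/Qi -/U -/V mulrN.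
set A := J * U; set B := J * V; clearbody A B Qi U V.
rewrite !(mulrDr, mulrN, scalerN, opprK, scalerDr) -!scalerAr.
set x := Qi * V; set y' := Qi * A; set qA := q * Qi * A; set qB := q * Qi * B.
set qU := q * Qi * U; set qV := q * Qi * V; clin.
Qed.

Lemma ray_kernel_conj_indep J I (y t : R) q : unit_sphere J -> unit_sphere I -> 0 < t -> boundary_angle y ->
  ray_kernel g J (- y) t q - ray_kernel g J y t q = ray_kernel g I (- y) t q - ray_kernel g I y t q.
Proof. by move=> HJ HI t0 gy; rewrite !ray_kernel_conj_diff. Qed.

Lemma boundary_angle_phi : boundary_angle phi.
Proof.
have pp := @pi_gt0 R; have p0 : 0 < phi by exact: lt_trans omphi.
split; rewrite ger0_norm//.
  by apply/ltW/cos_gt0_pihalf; apply/andP; split; [move: p0; lra|].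
by apply: sin_ge0_pi; rewrite (ltW p0)/=; move: phi2; lra.
Qed.

Lemma boundary_angleDpi (y : R) : boundary_angle y -> boundary_angle (y + pi).
Proof. by case=> h1 h2; split; rewrite ?cosDpi ?sinDpi normrN. Qed.

Lemma polar_holo_ccont D (u v : R * R -> R) (y a b : R) : polar_holo D u v ->
  (forall t, a <= t <= b -> D (t, y)) -> ccont a b (fun t => u (t, y)).
Proof. by move=> [ut [vt h]] aD t /aD/h[/polar_CR_continuous1[]]. Qed.

Lemma ker_den_sqnc (r psi t y : R) : ker_den r psi (t, y) = sqnc (ray_pt y t - ray_pt psi r).
Proof.
rewrite ker_denE /sqnc /ray_pt /= cosB sinB.
have := cos2Dsin2 psi; have := cos2Dsin2 y; rewrite !expr2.
set c := cos y; set s := sin y; set c' := cos psi; set s' := sin psi => h h'.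
transitivity (t * t * (c * c + s * s) - 2 * t * r * (c * c' + s * s') + r * r * (c' * c' + s' * s')).
  rewrite h h'; transitivity (t * t - 2 * t * r * (c * c' + s * s') + r * r * ((c * c + s * s) * (c' * c' + s' * s'))).
    ring.
  by rewrite h h'; ring.
by ring.
Qed.

(** The kernel of the previous parts in complex notation. *)
Lemma ker_complex (r psi t y : R) :
  ray_pt y t / (ray_pt y t - ray_pt psi r) = (kerRe r psi (t, y) +i* kerIm r psi (t, y))%C.
Proof.
have E (z w : R[i]) : Re z = Re w -> Im z = Im w -> z = w by case: z w => ? ? [? ?] /= -> ->.
have h := cos2Dsin2 y.
apply: E; rewrite ?cReM ?cImM cReV cImV -ker_den_sqnc /kerRe /kerIm /= ?cosB ?sinB.
  rewrite !mulrA -mulrBl; congr (_ / _).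
  transitivity (t * (t * (cos y ^+ 2 + sin y ^+ 2) - r * (cos y * cos psi + sin y * sin psi))).
    ring.
  by rewrite h; ring.
by rewrite !mulrA -mulrDl; congr (_ / _); ring.
Qed.

(** The two components of the integrand on the slice of q: products of the kernel with
    (U, V), written without J. Their integrals are those of the plane Cauchy formula
    for (V, - U) and (U, V). *)
Definition slice_real_part (r psi y t : R) : cliff :=
  t^-1 *: (kerIm r psi (t, y) *: G0 (cart (t, y)) + kerRe r psi (t, y) *: G1 (cart (t, y))).

Definition slice_imag_part (r psi y t : R) : cliff :=
  t^-1 *: (kerRe r psi (t, y) *: G0 (cart (t, y)) - kerIm r psi (t, y) *: G1 (cart (t, y))).

Section slice_cauchy.
Variables (I : cliff) (r psi : R).
Hypothesis HI : unit_sphere I.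
Hypothesis r0 : 0 < r.
Hypothesis psiI : 0 <= psi <= pi.
Hypothesis cpsi : cos om <= `|cos psi|.

Let zr0 : 0 < sqnc (ray_pt psi r).
Proof. by rewrite /sqnc /= polar_norm exprn_gt0. Qed.

Let zrc : cos om * Num.sqrt (sqnc (ray_pt psi r)) <= `|Re (ray_pt psi r)|.
Proof.
rewrite /sqnc /= polar_norm sqrtr_sqr normrM mulrC ger0_norm ?(ltW r0)//.
by rewrite ler_pM2l.
Qed.

Let dist0 (t y : R) : 0 < t -> boundary_angle y -> ray_pt y t - ray_pt psi r != 0.
Proof.
move=> t0 [c1 s1]; have := dist_bound om0 omphi phi2 c1 s1 t0 zr0 zrc.
move=> h; rewrite -opprB oppr_eq0 -sqnc_eq0 gt_eqF// (lt_le_trans _ h)//.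
by rewrite mulr_gt0 ?(angle_gap_gt0 om0 omphi phi2)// addr_gt0// exprn_gt0.
Qed.

(** On the slice of q the factor conj(s) - q cancels against Q_s(q), which leaves
    1 / (s - q). *)
Lemma ray_kernel_slice (y t : R) : 0 < t -> boundary_angle y ->
  ray_kernel g I y t (r *: expc I psi) = slice_real_part r psi y t - I * slice_imag_part r psi y t.
Proof.
move=> t0 gy; have D0 := dist0 t0 gy; have D1 := dist0 t0 (boundary_angle_opp gy).
have t0' : (t +i* 0)%C != 0 :> R[i].
  by rewrite eq_complex /= (gt_eqF t0).
have tV : (t^-1 +i* 0)%C * (t +i* 0)%C = 1 :> R[i].
  by apply/eqP; rewrite eq_complex /= !mulr0 mul0r subr0 addr0 mulVf ?(gt_eqF t0) ?eqxx.
have K := ker_complex r psi t y.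
have zE : ray_pt y t = (t +i* 0)%C * (cos y +i* sin y)%C by rewrite /ray_pt; simpc.
have ccE : (ray_pt y t)^*%C = ray_pt (- y) t by rewrite /ray_pt cosN sinN mulrN.
rewrite /ray_kernel /S_resolvent_val /ray_density slice_ray// (scale_expc I r psi) -/(ray_pt psi r) (Qval_cemb _ _ _ HI HI) (pinv_cemb HI).
have -> : - I * expc I y = cemb I (- 'i%C * (cos y +i* sin y)%C).
  by rewrite (cembM HI) cembN cemb_i.
rewrite scale_expc (conjc_cemb HI) -/(ray_pt y t) ccE.
rewrite -!(cembM HI) -cembB mulrA -(cembM HI).
have -> : ((Q_slice y t (ray_pt psi r))^-1 * ray_pt (- y) t - ray_pt psi r * (Q_slice y t (ray_pt psi r))^-1) *
   (- 'i%C * (cos y +i* sin y)%C) = - 'i%C * ((t^-1 +i* 0)%C * (kerRe r psi (t, y) +i* kerIm r psi (t, y))%C).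
  rewrite -K /Q_slice zE; move: D0 D1; rewrite zE.
  set e := (cos y +i* sin y)%C; set s' := ray_pt (- y) t; set z := ray_pt psi r; set T := (t +i* 0)%C in t0' tV *.
  move=> D0 D1.
  have -> : (t^-1 +i* 0)%C = T^-1 by rewrite -[LHS]mulr1 -(mulfV t0') mulrA tV mul1r.
  have D0' : z - T * e != 0 by rewrite -opprB oppr_eq0.
  have D1' : z - s' != 0 by rewrite -opprB oppr_eq0.
  by field; rewrite D0 t0' D0' D1'.
set a := kerRe _ _ _; set b := kerIm _ _ _; set U := G0 _; set V := G1 _.
have -> : - 'i%C * ((t^-1 +i* 0)%C * (a +i* b)%C) = (t^-1 * b +i* - (t^-1 * a))%C.
  by simpc.
rewrite /cemb /= /slice_real_part /slice_imag_part -/a -/b -/U -/V; clearbody a b U V; rewrite mulrDl !mulrDr -!scalerAl !mul1r.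
have -> : I * (I * V) = - V by rewrite mulrA unit_sphere_sqr// mulN1r.
rewrite -!scalerAr mulrBr -!scalerAr; clin.
Qed.

Definition Xi (t : R) : R := (1 + Mn) * Cg * (t * dTheta de t).

(** U and V are recovered from the values of g at a point and at its conjugate. *)
Lemma slice_decay A p : 0 < p.1 -> cos phi <= `|cos p.2| ->
  `|coef (G0 (cart p)) A| + `|coef (G1 (cart p)) A| <= Xi p.1.
Proof.
case: p => t y /= t0 cy; have M0 := @Mnorm_gt0 R d.
have c1 := cone_cart t0 cy.
have c2 : slice_cone th (cart (t, - y)) by apply: cone_cart; rewrite ?cosN.
have cE : cart (t, - y) = ((cart (t, y)).1, - (cart (t, y)).2).
  by rewrite /cart /= cosN sinN mulrN.
have g1 := growth c1 HI erefl; have g2 := growth c2 HI erefl.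
case: hg => _ /(_ _ c1)[e0 e1] sl.
rewrite sl// -ray_cart norm_ray// in g1; rewrite sl// -ray_cart norm_ray// cE e0 e1 in g2.
set U := G0 (cart (t, y)) in e0 g1 g2 *; set V := G1 (cart (t, y)) in e1 g1 g2 *; set B := Cg * _ in g1 g2.
have hU : `|U| <= B.
  have -> : U = 2^-1 *: ((U + I * V) + (U + I * - V)).
    by rewrite mulrN; set W := I * V; apply: coefP => ?; rewrite ?(coefD, coefN, coefZ); field.
  rewrite normrZ ger0_norm ?invr_ge0// ler_pdivrMl//.
  by rewrite (le_trans (ler_normD _ _))// (_ : 2 * B = B + B); [exact: lerD|ring].
have hV : `|V| <= Mn * B.
  have -> : V = - I * (2^-1 *: ((U + I * V) - (U + I * - V))).
    rewrite -scalerAr mulrN !mulrDr !mulrN !mulrDr !mulrN !mulNr mulrA unit_sphere_sqr// mulN1r.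
    by set W := I * U; apply: coefP => ?; rewrite ?(coefD, coefN, coefZ); field.
  have nI : `|I| = 1 by case: HI.
  rewrite (le_trans (norm_mul _ _))// ler_pM2l// normrN nI mul1r.
  rewrite normrZ ger0_norm ?invr_ge0// ler_pdivrMl//.
  by rewrite (le_trans (ler_normB _ _))// (_ : 2 * B = B + B); [exact: lerD|ring].
have -> : Xi t = B + Mn * B by rewrite /Xi /B; ring.
by apply: lerD; exact: le_trans (coef_le_norm _ _) _.
Qed.

Let DK : set (R * R) := [set p | polar_set (slice_cone th) p /\ ker_den r psi p != 0].

Let DK_good (t y : R) : 0 < t -> boundary_angle y -> DK (t, y).
Proof.
move=> t0 gy; split; first by apply: polar_cone => //; case: gy => ->.
by rewrite ker_den_sqnc sqnc_eq0; exact: dist0.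
Qed.

Let holoK A : polar_holo DK
  (fun p => kerRe r psi p * coef (G0 (cart p)) A - kerIm r psi p * coef (G1 (cart p)) A)
  (fun p => kerRe r psi p * coef (G1 (cart p)) A + kerIm r psi p * coef (G0 (cart p)) A).
Proof.
apply: polar_holoM; first by apply: polar_holo_ker => p [].
by case: hg => holo _ _; apply: polar_holoS (holo A) => p [].
Qed.

Let ccont_slice (y a b : R) : 0 < a -> boundary_angle y ->
  ccontc a b (slice_real_part r psi y) /\ ccontc a b (slice_imag_part r psi y).
Proof.
move=> a0 gy; have D t : a <= t <= b -> DK (t, y).
  by move=> /andP[/(lt_le_trans a0) t0 _]; exact: DK_good.
split=> A.
  under eq_fun do rewrite coefZ coefD !coefZ mulrC.
  apply: ccont_divt => //.
  have := polar_holo_ccont (polar_holoNi (holoK A)) D.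
  by congr ccont; apply/funext => t /=; rewrite addrC.
under eq_fun do rewrite coefZ coefD coefN !coefZ mulrC.
by apply: ccont_divt => //; exact: polar_holo_ccont (holoK A) D.
Qed.

Let q := r *: expc I psi.
Let K a b y := cint a b (fun t => ray_kernel g I y t q).

(** The formula on the slice of q, coordinatewise from the formula in the double
    sector. *)
Lemma cauchy_slice (a b : R) : 0 < a -> 2 * a <= r -> 2 * r <= b ->
  `|K a b (- phi) + K a b (- phi + pi) - (K a b phi + K a b (phi + pi)) - (2 * pi) *: g q| <=
  (1 + Mn) * (#|{set 'I_d}|%:R * (16 * phi * (Xi a + Xi b))).
Proof.
move=> a0 ar rb; have M0 := @Mnorm_gt0 R d.
have ab : a <= b by move: r0; lra.
have [NN EN] : {NN | forall y, NN y = cint a b (slice_imag_part r psi y)}.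
  exact: (exist _ (fun y => cint a b (slice_imag_part r psi y)) (fun=> erefl)).
have [PP EP] : {PP | forall y, PP y = cint a b (slice_real_part r psi y)}.
  exact: (exist _ (fun y => cint a b (slice_real_part r psi y)) (fun=> erefl)).
have KE y : boundary_angle y -> K a b y = PP y - I * NN y.
  move=> gy; rewrite (EP y) (EN y); have [cP cN] := ccont_slice b a0 gy.
  rewrite /K (cint_eq (G := fun t => slice_real_part r psi y t - I * slice_imag_part r psi y t)) => [|t /andP[/(lt_le_trans a0) t0 _]].
    by rewrite cintB ?cint_mull//; exact: ccontc_mull.
  exact: ray_kernel_slice.
have gp := boundary_angle_phi; have gn := boundary_angle_opp gp.
have gpp := boundary_angleDpi gp; have gnp := boundary_angleDpi gn.
rewrite !KE//.
have HN beta y A : coef (NN (y + beta)) A =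
    kernel_rint r psi (fun p => coef (G0 (cart p)) A) (fun p => coef (G1 (cart p)) A) beta y a b.
  by rewrite EN coef_cint; apply: rint_eq => t _; rewrite coefZ coefD coefN !coefZ mulrC.
have HP beta y A : coef (PP (y + beta)) A =
    kernel_rint r psi (fun p => coef (G1 (cart p)) A) (fun p => - coef (G0 (cart p)) A) beta y a b.
  rewrite EP coef_cint; apply: rint_eq => t _; rewrite coefZ coefD !coefZ mulrC.
  by congr (_ / _); ring.
have HN0 y A := HN 0 y A; have HP0 y A := HP 0 y A.
have {}HN0 y A := etrans (congr1 (fun y => coef (NN y) A) (esym (addr0 y))) (HN0 y A).
have {}HP0 y A := etrans (congr1 (fun y => coef (PP y) A) (esym (addr0 y))) (HP0 y A).
case: (hg) => holo _ sl.
pose DP := (PP phi - PP (- phi)) +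
           (PP (phi + pi) - PP (- phi + pi)).
pose DN := (NN phi - NN (- phi)) +
           (NN (phi + pi) - NN (- phi + pi)).
have quad (x x' z z' v : cliff) (c : R) A : coef ((x - x') + (z - z') - c *: v) A =
    (coef x A - coef x' A) + (coef z A - coef z' A) - c * coef v A.
  by rewrite coefB coefZ coefD !coefB.
set U := G0 (cart (r, psi)); set V := G1 (cart (r, psi)).
have hN : `|DN - (2 * pi) *: V| <= #|{set 'I_d}|%:R * (16 * phi * (Xi a + Xi b)).
  apply: norm_le_coefs => A.
  rewrite /DN quad (HN pi phi) (HN pi (- phi)) (HN0 phi) (HN0 (- phi)).
  exact: (double_sector_cauchy om0 omphi phith th2 (holo A) (@slice_decay A) r0 a0 ar rb psiI cpsi).
have hP : `|DP - (2 * pi) *: - U| <= #|{set 'I_d}|%:R * (16 * phi * (Xi a + Xi b)).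
  apply: norm_le_coefs => A.
  rewrite /DP quad (HP pi phi) (HP pi (- phi)) (HP0 phi) (HP0 (- phi)) coefN.
  apply: (double_sector_cauchy om0 omphi phith th2 (polar_holoNi (holo A)) _ r0 a0 ar rb psiI cpsi).
  by move=> p p0 cp; rewrite addrC normrN; exact: slice_decay.
have qE : g q = U + I * V.
  rewrite /q ray_cart sl//; apply: cone_cart => //; apply: le_trans cpsi.
  by apply/ltW/cos_norm_lt; rewrite ?gtr0_norm//; move: phi2 (@pi_gt0 R); lra.
rewrite qE.
set LHS := (X in `|X|).
have -> : LHS = I * (DN - (2 * pi) *: V) - (DP - (2 * pi) *: - U).
  rewrite /LHS /DN /DP !(mulrDr, mulrN) -!scalerAr; clin.
have nI : `|I| = 1 by case: HI.
set B := _ * (16 * _ * _) in hN hP *; have -> : (1 + Mn) * B = Mn * B + B by ring.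
rewrite (le_trans (ler_normB _ _))//; apply: lerD => //.
by rewrite (le_trans (norm_mul _ _))// nI mul1r ler_pM2l.
Qed.

End slice_cauchy.

Lemma sector_pt_polar q : sector_pt om q -> exists I r psi, [/\ unit_sphere I, 0 < r,
  0 <= psi <= pi, cos om <= `|cos psi| & q = r *: expc I psi].
Proof.
move=> /(sector_pt_slice d1)[I [z [HI -> z0 Iz cz]]].
set r := Num.sqrt (sqnc z) in cz; have r0 : 0 < r by rewrite sqrtr_gt0.
have r2 : r ^+ 2 = sqnc z by rewrite sqr_sqrtr// ltW.
have xy : (Re z / r) ^+ 2 + (Im z / r) ^+ 2 = 1.
  by rewrite !expr_div_n -mulrDl r2 /sqnc divff// gt_eqF.
have x1 : -1 <= Re z / r <= 1.
  by rewrite -ler_norml -(@ler_pXn2r _ 2)// ?nnegrE// expr1n real_normK ?num_real// -xy lerDl sqr_ge0.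
have cpsi : cos (acos (Re z / r)) = Re z / r by apply: acosK; rewrite in_itv/=.
have spsi : sin (acos (Re z / r)) = Im z / r.
  by rewrite sin_acos// -xy addrAC subrr add0r sqrtr_sqr ger0_norm// divr_ge0// ltW.
exists I, r, (acos (Re z / r)); split => //.
- by rewrite acos_ge0// acos_lepi.
- by rewrite cpsi normrM normfV [`|r|]gtr0_norm// ler_pdivlMr.
rewrite scale_expc cpsi spsi; congr cemb.
by rewrite !(mulrCA r) mulfV ?gt_eqF// !mulr1; case: (z).
Qed.

Definition ray_kernel_int J y q : cliff := cray (fun t => ray_kernel g J y t q).

Lemma ray_kernel_loc_lip J (y : R) q : unit_sphere J -> boundary_angle y -> sector_pt om q ->
  loc_lip (fun t => ray_kernel g J y t q).
Proof.
move=> HJ gy Kq a b a0 ab; have [L L0 HL] := ray_kernel_lip HJ gy a0 ab.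
by exists L => //; exact: HL.
Qed.

(** The difference of both sides is at most a constant times Theta(a) for all small a,
    where the rays are truncated to [a, 1 / a]. *)
Lemma kernel_cauchy J q : unit_sphere J -> sector_pt om q ->
  ray_kernel_int J (- phi) q + ray_kernel_int J (pi - phi) q - (ray_kernel_int J phi q + ray_kernel_int J (pi + phi) q) =
  (2 * pi) *: g q.
Proof.
move=> HJ Kq; have [I [r [psi [HI r0 psiI cpsi qE]]]] := sector_pt_polar Kq.
have gp := boundary_angle_phi; have gn := boundary_angle_opp gp.
have gpp := boundary_angleDpi gp; have gnp := boundary_angleDpi gn.
(* The angles of the left sector as translates by pi of those of the right one. *)
rewrite [pi - phi]addrC [pi + phi]addrC.
pose nd : R := #|{set 'I_d}|%:R.
(* Four tails of rays, and the two arcs of each sector. *)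
pose K := 4 * (nd * (ray_kernel_cst * 2)) + (1 + Mn) * (nd * (16 * phi * ((1 + Mn) * Cg * de * 2))).
have M0 := @Mnorm_gt0 R d; have k0 := ray_kernel_cst_ge0.
have p0 : 0 < phi by exact: lt_trans omphi.
have nd0 : 0 <= nd by exact: ler0n.
have K0 : 0 <= K.
  have M0' := ltW M0; have p0' := ltW p0; have de0' := ltW de0.
  by rewrite /K; repeat (done || apply: mulr_ge0 || apply: addr_ge0).
suff H a : 0 < a -> a <= 1 -> 2 * a <= r -> 2 * r <= a^-1 ->
  `|ray_kernel_int J (- phi) q + ray_kernel_int J (- phi + pi) q - (ray_kernel_int J phi q + ray_kernel_int J (phi + pi) q)
    - (2 * pi) *: g q| <= K * Theta de a.
  apply/eqP; rewrite -subr_eq0 -normr_eq0 eq_le normr_ge0 andbT.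
  apply/ler_addgt0Pl => e e0; rewrite addr0.
  have K1 : 0 < K + 1 by rewrite ltr_wpDl.
  have [s s0 Hs] := Theta_lim0 de0 (divr_gt0 e0 K1).
  (* With a = m, the pole lies well inside the annulus a <= |z| <= 1 / a. *)
  pose m := Num.min (Num.min (s / 2) 1) (Num.min (r / 2) (2 * r)^-1).
  have m0 : 0 < m by rewrite /m !lt_min !divr_gt0//= ltr01 invr_gt0 mulr_gt0.
  have [m1 m2 m3 m4] : [/\ m <= s / 2, m <= 1, m <= r / 2 & m <= (2 * r)^-1].
    by split; rewrite /m !ge_min lexx ?orbT.
  apply: le_trans (H m m0 m2 _ _) _; first by lra.
    by rewrite -[leLHS]invrK lef_pV2 ?posrE ?invr_gt0 ?mulr_gt0.
  apply: (@le_trans _ _ (K * (e / (K + 1)))); first by rewrite ler_wpM2l// Hs//; lra.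
  by rewrite mulrCA ger_pMr// ler_pdivrMr// mul1r; lra.
move=> a0 a1 ar rb; set b := a^-1 in rb *.
have b0 : 0 < b by rewrite invr_gt0.
have ab : a <= b by move: r0; lra.
have [C EC] : {C | forall I y, C I y = cint a b (fun t => ray_kernel g I y t q)}.
  exact: (exist _ (fun I y => cint a b (fun t => ray_kernel g I y t q)) (fun _ _ => erefl)).
have TE : Theta de b^-1 = Theta de a by rewrite invrK.
have A y : boundary_angle y -> `|ray_kernel_int J y q - C J y| <= nd * (ray_kernel_cst * 2) * Theta de a.
  move=> gy; have := cray_approx de0 k0 (ray_kernel_loc_lip HJ gy Kq)
    (fun t t0 => ray_kernel_bound HJ gy t0 Kq) a0 ab.
  by rewrite TE (EC J y) => /le_trans; apply; rewrite le_eqVlt; apply/orP; left; apply/eqP; rewrite /nd; ring.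
have CE y : boundary_angle y -> C J (- y) - C J y = C I (- y) - C I y.
  move=> gy; have cc I' y' : unit_sphere I' -> boundary_angle y' -> ccontc a b (fun t => ray_kernel g I' y' t q).
    by move=> HI' gy'; apply: lip_on_ccontc => //; exact: ray_kernel_loc_lip.
  have gy' := boundary_angle_opp gy.
  have e I' : unit_sphere I' ->
      C I' (- y) - C I' y = cint a b (fun t => ray_kernel g I' (- y) t q - ray_kernel g I' y t q).
    move=> HI'; rewrite (EC I' (- y)) (EC I' y).
    exact: (esym (cintB (cc _ _ HI' gy') (cc _ _ HI' gy))).
  rewrite (e _ HJ) (e _ HI).
  by apply: cint_eq => t /andP[/(lt_le_trans a0) t0 _]; exact: ray_kernel_conj_indep.
have CO I' : C I' (- phi + pi) = C I' (- (phi + pi)).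
  by rewrite !EC; apply: cint_eq => t _; rewrite /ray_kernel /ray_density addrC expc_opp_pi addrC.
have S : `|C J (- phi) + C J (- phi + pi) - (C J phi + C J (phi + pi)) - (2 * pi) *: g q| <=
   (1 + Mn) * (nd * (16 * phi * ((1 + Mn) * Cg * de * 2))) * Theta de a.
  have [t1 t2 t3] : [/\ 0 <= Theta de a, Theta de a <= 1 & Theta de b = 1 - Theta de a].
    by rewrite -ThetaV// Theta_ge0 Theta_le1.
  have Xa : Xi a <= (1 + Mn) * Cg * de * Theta de a.
    rewrite /Xi dTheta_Theta// -[leRHS]mulrA ler_wpM2l//; first by rewrite mulr_ge0// addr_ge0// ltW.
    by rewrite ler_pM2l// ler_piMr// Theta_le1.
  have Xb : Xi b <= (1 + Mn) * Cg * de * Theta de a.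
    rewrite /Xi dTheta_Theta// TE -[leRHS]mulrA ler_wpM2l//; first by rewrite mulr_ge0// addr_ge0// ltW.
    by rewrite ler_pM2l// ler_piMl// Theta_le1.
  have h : `|C I (- phi) + C I (- phi + pi) - (C I phi + C I (phi + pi)) - (2 * pi) *: g q| <=
      (1 + Mn) * (nd * (16 * phi * (Xi a + Xi b))).
    rewrite (EC I (- phi)) (EC I (- phi + pi)) (EC I phi) (EC I (phi + pi)).
    by have := cauchy_slice HI r0 psiI cpsi a0 ar rb; rewrite -qE.
  have -> : C J (- phi) + C J (- phi + pi) - (C J phi + C J (phi + pi)) =
            C I (- phi) + C I (- phi + pi) - (C I phi + C I (phi + pi)).
    have e1 := CE _ gp; have e2 := CE _ gpp; rewrite -!CO in e2.
    have rr (x y z w : cliff) : x + y - (z + w) = (x - z) + (y - w) by clin.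
    by rewrite !rr e1 e2.
  apply: (le_trans h).
  have -> : (1 + Mn) * (nd * (16 * phi * ((1 + Mn) * Cg * de * 2))) * Theta de a =
    (1 + Mn) * (nd * (16 * phi * ((1 + Mn) * Cg * de * Theta de a + (1 + Mn) * Cg * de * Theta de a))) by ring.
  rewrite ler_wpM2l ?addr_ge0 ?(ltW M0)// ler_wpM2l// ler_wpM2l ?mulr_ge0 ?(ltW p0)//.
  exact: lerD.
set T := Theta de a in S A *; set X := nd * (ray_kernel_cst * 2) in A *.
have -> : ray_kernel_int J (- phi) q + ray_kernel_int J (- phi + pi) q - (ray_kernel_int J phi q + ray_kernel_int J (phi + pi) q) - (2 * pi) *: g q =
  ((ray_kernel_int J (- phi) q - C J (- phi)) + (ray_kernel_int J (- phi + pi) q - C J (- phi + pi))) -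
  ((ray_kernel_int J phi q - C J phi) + (ray_kernel_int J (phi + pi) q - C J (phi + pi))) +
  (C J (- phi) + C J (- phi + pi) - (C J phi + C J (phi + pi)) - (2 * pi) *: g q).
  by move: (ray_kernel_int _ _ _) (ray_kernel_int _ _ _) (ray_kernel_int _ _ _) (ray_kernel_int _ _ _) (C _ _) (C _ _) (C _ _) (C _ _) => x1 x2 x3 x4 y1 y2 y3 y4; clin.
have -> : K * T = ((X * T + X * T) + (X * T + X * T)) +
  (1 + Mn) * (nd * (16 * phi * ((1 + Mn) * Cg * de * 2))) * T by rewrite /K -/X; ring.
apply: (le_trans (ler_normD _ _)); apply: lerD; last exact: S.
apply: (le_trans (ler_normB _ _)); apply: lerD;
  apply: (le_trans (ler_normD _ _)); apply: lerD; exact: A.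
Qed.

End fixed.
End slice_kernel.

(** * The functional calculi of a multiplication operator *)

Section rays.
Context {R : realType} {d : nat} {disp : measure_display}
  {X : measurableType disp} {mu : {measure set X -> \bar R}}.
Local Notation cliff := (clifford R d).
Local Notation Mn := (Mnorm R d).
Local Notation Re := (@complex.Re R).
Local Notation Im := (@complex.Im R).
Implicit Types (F G : R -> @operator R d disp X mu) (J s q w : cliff) (g f : cliff -> cliff).

Lemma riemann_sum_ext F G a b e n (x xi : nat -> R) : 0 < a ->
  (forall t, 0 < t -> F t = G t) -> tagged_partition a b e n x xi ->
  riemann_sum F n x xi = riemann_sum G n x xi.
Proof.
move=> a0 FG tag; apply: eq_bigr => i _.
by rewrite FG//; exact: tagged_partition_gt0 tag _ _.
Qed.

Lemma is_riemann_int_ext F G a b A : 0 < a -> (forall t, 0 < t -> F t = G t) ->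
  is_riemann_int F a b A -> is_riemann_int G a b A.
Proof.
move=> a0 FG [h1 h2 h3]; split => //.
  move=> t tI; rewrite -FG; first exact: h1.
  by case/andP: tI => + _; exact: lt_le_trans.
move=> e e0; have [dl dl0 H] := h3 e e0; exists dl => // n x xi tag.
by rewrite -(riemann_sum_ext a0 FG tag); exact: H.
Qed.

(** Integrals over (0, +oo) do not see the values at t <= 0, where the integrands of
    the calculus are not multiplication operators. *)
Lemma improper_int_ext F G : (forall t, 0 < t -> F t = G t) -> improper_int F = improper_int G.
Proof.
have W F' G' A : (forall t, 0 < t -> F' t = G' t) -> is_improper_int F' A -> is_improper_int G' A.
  move=> FG [bA H]; split => // e e0; have [r r0 Hr] := H e e0; exists r => // a b a0 ar rb ab.
  by have [B hB AB] := Hr a b a0 ar rb ab; exists B => //; exact: is_riemann_int_ext hB.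
move=> FG; congr xget; apply/seteqP; split => A; apply: W => // t t0.
by rewrite FG.
Qed.

Section fixed_h.
Variables (om th : R) (h : X -> cliff).
Hypothesis d1 : (1 <= d)%N.
Hypothesis om0 : 0 < om.
Hypothesis omth : om < th.
Hypothesis th2 : th < pi / 2.
Hypothesis mh : cmeasurable h.
Hypothesis hK : forall x, sector_pt om (h x).

Section fixed_phi.
Variable phi : R.
Hypothesis omphi : om < phi.
Hypothesis phith : phi < th.

Let phi2 : phi < pi / 2. Proof. exact: lt_trans th2. Qed.

Section ray.
Variables (J : cliff) (y t : R).
Hypothesis HJ : unit_sphere J.
Hypothesis gy : boundary_angle phi y.
Hypothesis t0 : 0 < t.

Let s := t *: expc J y.
Let qi x := pinv (Qval s (h x)).

Let Qqi x : Qval s (h x) * qi x = 1.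
Proof. by case: gy => c1 s1; have [] := Qval_inv om0 omphi phi2 HJ d1 c1 s1 t0 (hK x). Qed.

Let qiQ x : qi x * Qval s (h x) = 1.
Proof. by case: gy => c1 s1; have [] := Qval_inv om0 omphi phi2 HJ d1 c1 s1 t0 (hK x). Qed.

Let qi_bound x : `|qi x| <= (angle_gap om phi * (t ^+ 2 + `|h x| ^+ 2))^-1.
Proof. by case: gy => c1 s1; exact: (pinvQ_bound om0 omphi phi2 HJ d1 c1 s1 t0 (hK x)). Qed.

Let mqi : cmeasurable qi. Proof. exact: cmeasurable_pinvQ. Qed.
Let k0 : 0 < angle_gap om phi. Proof. exact: angle_gap_gt0 om0 omphi phi2. Qed.
Let M0 : 0 < Mn. Proof. exact: Mnorm_gt0. Qed.
Let tr x : 0 < t ^+ 2 + `|h x| ^+ 2.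
Proof. by rewrite ltr_wpDr ?sqr_ge0// exprn_gt0. Qed.

Let bqi : bmult qi.
Proof.
split => //; exists (angle_gap om phi * t ^+ 2)^-1 => [|x].
  by rewrite invr_ge0 mulr_ge0 ?sqr_ge0// ltW.
apply: (le_trans (qi_bound x)); rewrite lef_pV2 ?posrE ?mulr_gt0 ?exprn_gt0//.
by rewrite ler_pM2l// lerDl sqr_ge0.
Qed.

Let bhqi : bmult (fun x => h x * qi x).
Proof.
split; first exact: cmeasurableM.
exists (Mn * (angle_gap om phi * t)^-1) => [|x].
  by rewrite mulr_ge0 ?invr_ge0 ?mulr_ge0// ltW.
rewrite (le_trans (norm_mul _ _))// ler_pM2l//.
apply: (@le_trans _ _ (`|h x| * (angle_gap om phi * (t ^+ 2 + `|h x| ^+ 2))^-1)).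
  by rewrite ler_wpM2l.
rewrite ler_pdivrMr ?mulr_gt0//.
have -> : (angle_gap om phi * t)^-1 * (angle_gap om phi * (t ^+ 2 + `|h x| ^+ 2)) = (t ^+ 2 + `|h x| ^+ 2) / t.
  by field; rewrite (gt_eqF t0) (gt_eqF k0).
rewrite ler_pdivlMr//; set r := `|h x|.
by have := sqr_ge0 (t - r); have := sqr_ge0 t; have := sqr_ge0 r; rewrite !expr2; lra.
Qed.

Let bhhqi : bmult (fun x => h x * (h x * qi x)).
Proof.
split; first by apply: cmeasurableM => //; exact: cmeasurableM.
exists (Mn * (Mn * (angle_gap om phi)^-1)) => [|x].
  by rewrite !mulr_ge0 ?invr_ge0// ltW.
rewrite (le_trans (norm_mul _ _))// ler_pM2l//.
apply: (@le_trans _ _ (`|h x| * (Mn * (`|h x| * (angle_gap om phi * (t ^+ 2 + `|h x| ^+ 2))^-1)))).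
  rewrite ler_wpM2l// (le_trans (norm_mul _ _))// ler_pM2l// ler_wpM2l//.
rewrite mulrCA ler_pM2l// mulrA ler_pdivrMr ?mulr_gt0// mulrA mulVf ?gt_eqF// mul1r -expr2.
by rewrite lerDr sqr_ge0.
Qed.

Lemma ray_opL g : op_comp (S_resolventL s (mul_op mu h)) (op_cliff (- J * expc J y * g s)) =
  mul_op mu (fun x => ray_kernel g J y t (h x)).
Proof.
rewrite (S_resolventL_mul Qqi qiQ bqi bhqi bhhqi) op_cliffE op_comp_mul//.
exact: bmult_cst.
Qed.

(** Q_s(q)^{-1} lies in the slice of q and commutes with q, so the right integrand is
    the reversion of the left integrand of the reversed function. *)
Lemma ray_opR g : op_comp (op_cliff (g s * (- J * expc J y))) (S_resolventR s (mul_op mu h)) =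
  mul_op mu (fun x => crev (ray_kernel (crev \o g) J y t (h x))).
Proof.
rewrite (S_resolventR_mul Qqi qiQ bqi bhqi bhhqi) op_cliffE op_comp_mul; last first.
  under eq_fun do rewrite mulrBl; apply: bmultB => //.
  by apply: bmultM => //; exact: bmult_cst.
congr mul_op; apply/funext => x.
rewrite /ray_kernel /ray_density crevM crevM /= crevK -/s; congr (g s * _ * _).
  rewrite crevM; have -> : crev (- J) = - J.
    by rewrite crevN crev_paravector//; case: HJ.
  have -> : crev (expc J y) = expc J y.
    by rewrite crev_paravector// expcE; exact: paravector_cemb.
  by rewrite mulrN mulNr /expc mulrDl mulrDr -!scalerAl -!scalerAr mul1r mulr1.
have [I [z [HI qE z0 Iz cz]]] := sector_pt_slice d1 (hK x).
have [zz QE] : exists zz, pinv (Qval s (h x)) = cemb I zz.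
  by rewrite qE (Qval_cemb _ _ _ HJ HI) (pinv_cemb HI); eexists.
have rc u : crev (cemb I u) = cemb I u by rewrite crev_paravector//; exact: paravector_cemb.
rewrite /S_resolvent_val crevB !crevM /qi QE qE !rc mulrBl; congr (_ * _ - _); last exact: cembC.
rewrite crev_paravector// /s scale_expc (conjc_cemb HJ); exact: paravector_cemb.
Qed.

End ray.

Section decaying.
Variables (de Cg : R) (g : cliff -> cliff) (G0 G1 : R * R -> cliff).
Hypothesis de0 : 0 < de.
Hypothesis Cg0 : 0 <= Cg.
Hypothesis hg : slice_data th g G0 G1.
Hypothesis growth : forall p J s, slice_cone th p -> unit_sphere J -> s = p.1%:A + p.2 *: J ->
  `|g s| <= Cg * (`|s| * dTheta de `|s|).

Section ray_y.
Local Notation KC := (@ray_kernel_cst R d om phi Cg).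
Variables (J : cliff) (y : R).
Hypothesis HJ : unit_sphere J.
Hypothesis gy : boundary_angle phi y.

Let F (t : R) (x : X) : cliff := ray_kernel g J y t (h x).

Let C0 : 0 <= KC.
Proof. exact: (ray_kernel_cst_ge0 om0 omphi phith th2 Cg0). Qed.

Let mF (t : R) : 0 < t -> cmeasurable (F t).
Proof. by move=> _; exact: ray_kernel_measurable. Qed.

Let lF (a b : R) : 0 < a -> a <= b -> exists2 L, 0 <= L & forall x, lip_on a b L (F ^~ x).
Proof.
move=> a0 ab; have [L L0 HL] := ray_kernel_lip d1 om0 omphi phith th2 de0 Cg0 hg growth HJ gy a0 ab.
by exists L => // x; exact: HL.
Qed.

Let bF (t : R) x : 0 < t -> `|F t x| <= KC * dTheta de t.
Proof. by move=> t0; exact: (ray_kernel_bound d1 om0 omphi phith th2 growth HJ gy t0 (hK x)). Qed.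

Lemma ray_kernel_int_bmult : bmult (fun x => ray_kernel_int g J y (h x)).
Proof. exact: (rayX_bmult de0 C0 mF lF bF). Qed.

Lemma ray_intL_mul : ray_intL J (expc J y) (mul_op mu h) g = mul_op mu (fun x => ray_kernel_int g J y (h x)).
Proof.
rewrite /ray_intL -(improper_int_mul (mu := mu) de0 C0 mF lF bF).
by apply: improper_int_ext => t t0; exact: ray_opL.
Qed.

Lemma cray_crev (K : R -> cliff) C : 0 <= C -> loc_lip K ->
  (forall t, 0 < t -> `|K t| <= C * dTheta de t) ->
  cray (fun t => crev (K t)) = crev (cray K).
Proof.
move=> C1 lK bK; apply: coefP => A; rewrite coef_crev /cray /coef !ffunE.
have -> : ray_int_seq (fun t => crev (K t)) A = (fun n => revsgn A * ray_int_seq K A n).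
  apply/funext => n; rewrite /ray_int_seq -rintZ; last by apply: lip_on_ccontc; rewrite ?invr_gt0.
  by apply: rint_eq => t _; rewrite coef_crev.
apply/cvg_lim => //; apply: cvgMr.
exact: (ray_int_seq_cvg de0 C1 lK bK).
Qed.

Let F' (t : R) (x : X) : cliff := crev (F t x).

Let mF' (t : R) : 0 < t -> cmeasurable (F' t).
Proof.
move=> t0 A; under eq_fun do rewrite coef_crev.
by apply: measurable_funM => //; exact: mF.
Qed.

Let lF' (a b : R) : 0 < a -> a <= b -> exists2 L, 0 <= L & forall x, lip_on a b L (F' ^~ x).
Proof.
move=> a0 ab; have [L L0 HL] := lF a0 ab; exists L => // x t t' tI t'I.
by rewrite -crevB norm_crev; exact: HL.
Qed.

Let bF' (t : R) x : 0 < t -> `|F' t x| <= KC * dTheta de t.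
Proof. by move=> t0; rewrite norm_crev; exact: bF. Qed.

Let rayE : rayX F' = fun x => crev (ray_kernel_int g J y (h x)).
Proof.
apply/funext => x; apply: (@cray_crev (F ^~ x) _ C0) => [a b a0 ab|t]; last exact: bF.
by have [L L0 HL] := lF a0 ab; exists L => //; exact: HL.
Qed.

Lemma crev_ray_kernel_int_bmult : bmult (fun x => crev (ray_kernel_int g J y (h x))).
Proof. rewrite -rayE; exact: (rayX_bmult de0 C0 mF' lF' bF'). Qed.

Lemma ray_intR_mul : ray_intR J (expc J y) (mul_op mu h) (crev \o g) =
  mul_op mu (fun x => crev (ray_kernel_int g J y (h x))).
Proof.
rewrite /ray_intR -rayE -(improper_int_mul (mu := mu) de0 C0 mF' lF' bF').
apply: improper_int_ext => t t0; rewrite ray_opR//.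
by have -> : crev \o (crev \o g) = g by apply/funext => s /=; rewrite crevK.
Qed.

End ray_y.

Let boundary_angles : [/\ boundary_angle phi (- phi), boundary_angle phi (pi - phi), boundary_angle phi phi & boundary_angle phi (pi + phi)].
Proof.
have gp := boundary_angle_phi om0 omphi phith th2; have gn := boundary_angle_opp gp.
by split => //; rewrite addrC; exact: boundary_angleDpi.
Qed.

Lemma boundary_int_mul (ray : cliff -> @operator R d disp X mu) (k : R -> X -> cliff) J :
  (forall y, boundary_angle phi y -> ray (expc J y) = mul_op mu (k y)) ->
  (forall y, boundary_angle phi y -> bmult (k y)) ->
  boundary_int ray J phi =
  mul_op mu (fun x => k (- phi) x + k (pi - phi) x - (k phi x + k (pi + phi) x)).
Proof.
move=> rk bk; have [a1 a2 a3 a4] := boundary_angles; rewrite /boundary_int !rk//.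
rewrite op_add_mul ?op_add_mul ?op_sub_mul//; last exact: bk.
- by apply: bmultD; exact: bk.
- exact: bk.
Qed.

Section contour.
Variable J : cliff.
Hypothesis HJ : unit_sphere J.

Let kE x : (2 * pi)^-1 *: (ray_kernel_int g J (- phi) (h x) + ray_kernel_int g J (pi - phi) (h x) -
  (ray_kernel_int g J phi (h x) + ray_kernel_int g J (pi + phi) (h x))) = g (h x).
Proof.
rewrite (kernel_cauchy d1 om0 omphi phith th2 de0 Cg0 hg growth HJ (hK x)).
by rewrite scalerA mulVf ?scale1r// gt_eqF// mulr_gt0// pi_gt0.
Qed.

Let bk : bmult (fun x => ray_kernel_int g J (- phi) (h x) + ray_kernel_int g J (pi - phi) (h x) -
  (ray_kernel_int g J phi (h x) + ray_kernel_int g J (pi + phi) (h x))).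
Proof.
have [a1 a2 a3 a4] := boundary_angles.
by apply: bmultB; apply: bmultD; exact: ray_kernel_int_bmult.
Qed.

Lemma slice_bmult : bmult (g \o h).
Proof.
have -> : g \o h = fun x => (2 * pi)^-1 *: (ray_kernel_int g J (- phi) (h x) + ray_kernel_int g J (pi - phi) (h x) -
  (ray_kernel_int g J phi (h x) + ray_kernel_int g J (pi + phi) (h x))) by apply/funext => x; rewrite kE.
exact: bmultZ.
Qed.

Lemma contour_intL_mul : contour_intL J phi (mul_op mu h) g = mul_op mu (g \o h).
Proof.
rewrite /contour_intL (boundary_int_mul (k := fun y x => ray_kernel_int g J y (h x))).
- by rewrite op_scale_bmult//; congr mul_op; apply/funext => x; rewrite kE.
- by move=> y gy; exact: ray_intL_mul.
- by move=> y gy; exact: ray_kernel_int_bmult.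
Qed.

Lemma contour_intR_mul : contour_intR J phi (mul_op mu h) (crev \o g) = mul_op mu (crev \o g \o h).
Proof.
have E : (fun x => crev (ray_kernel_int g J (- phi) (h x)) + crev (ray_kernel_int g J (pi - phi) (h x)) -
  (crev (ray_kernel_int g J phi (h x)) + crev (ray_kernel_int g J (pi + phi) (h x)))) = fun x => crev ((2 * pi) *: g (h x)).
  apply/funext => x; have := kernel_cauchy d1 om0 omphi phith th2 de0 Cg0 hg growth HJ (hK x).
  move: (ray_kernel_int g J (- phi) _) (ray_kernel_int g J (pi - phi) _) (ray_kernel_int g J phi _) (ray_kernel_int g J (pi + phi) _).
  by move=> k1 k2 k3 k4 <-; rewrite crevB !crevD.
rewrite /contour_intR (boundary_int_mul (k := fun y x => crev (ray_kernel_int g J y (h x)))).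
- rewrite op_scale_mul; last by rewrite invr_eq0 gt_eqF// mulr_gt0// pi_gt0.
  congr mul_op; apply/funext => x /=; have /= -> := congr1 (@^~ x) E.
  by rewrite crevZ scalerA mulVf ?scale1r// gt_eqF// mulr_gt0// pi_gt0.
- by move=> y gy; exact: ray_intR_mul.
- by move=> y gy; exact: crev_ray_kernel_int_bmult.
Qed.

End contour.
End decaying.
End fixed_phi.

(** The functions to which the Cauchy formula applies; compared with the class SH^0,
    the decay is quantitative. *)
Definition decaying (g : cliff -> cliff) := exists (de Cg : R) (G0 G1 : R * R -> cliff),
  [/\ 0 < de, 0 <= Cg, slice_data th g G0 G1 &
      forall p J s, slice_cone th p -> unit_sphere J -> s = p.1%:A + p.2 *: J ->
        `|g s| <= Cg * (`|s| * dTheta de `|s|)].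

Let exists_contour : exists J phi, [/\ @unit_sphere R d J, om < phi & phi < th].
Proof.
have [J HJ] := @unit_sphere_nonempty R d d1; exists J, ((om + th) / 2); split => //; move: omth; lra.
Qed.

Lemma decaying_bmult g : decaying g -> bmult (g \o h).
Proof.
move=> [de [Cg [G0 [G1 [de0 Cg0 hg gr]]]]]; have [J [phi [HJ h1 h2]]] := exists_contour.
exact: (slice_bmult h1 h2 de0 Cg0 hg gr HJ).
Qed.

Lemma omega_calcL_mul g : decaying g -> omega_calcL om th (mul_op mu h) g = mul_op mu (g \o h).
Proof.
move=> [de [Cg [G0 [G1 [de0 Cg0 hg gr]]]]].
have P J phi : unit_sphere J -> om < phi < th -> contour_intL J phi (mul_op mu h) g = mul_op mu (g \o h).
  by move=> HJ /andP[h1 h2]; exact: (contour_intL_mul h1 h2 de0 Cg0 hg gr HJ).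
have [J [phi [HJ h1 h2]]] := exists_contour.
apply: xget_unique => [//|A HA].
by rewrite -(P J phi HJ) ?h1// HA// h1.
Qed.

Lemma omega_calcR_mul g : decaying (crev \o g) ->
  omega_calcR om th (mul_op mu h) g = mul_op mu (g \o h).
Proof.
move=> [de [Cg [G0 [G1 [de0 Cg0 hg gr]]]]].
have gE : g = crev \o (crev \o g) by apply/funext => s /=; rewrite crevK.
have P J phi : unit_sphere J -> om < phi < th -> contour_intR J phi (mul_op mu h) g = mul_op mu (g \o h).
  move=> HJ /andP[h1 h2]; have := contour_intR_mul h1 h2 de0 Cg0 hg gr HJ.
  by rewrite -gE.
have [J [phi [HJ h1 h2]]] := exists_contour.
apply: xget_unique => [//|A HA].
by rewrite -(P J phi HJ) ?h1// HA// h1.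
Qed.

Let thI : 0 < th < pi / 2. Proof. by rewrite th2 andbT (lt_trans om0). Qed.

Lemma decaying_ext g g' : (forall p J, slice_cone th p -> unit_sphere J ->
    g (p.1%:A + p.2 *: J) = g' (p.1%:A + p.2 *: J)) -> decaying g -> decaying g'.
Proof.
move=> gg [de [Cg [G0 [G1 [de0 Cg0 [h1 h2 h3] gr]]]]]; exists de, Cg, G0, G1; split => //.
  by split => // p J cp HJ; rewrite -gg// h3.
by move=> p J s cp HJ sE; rewrite sE -gg// -sE; exact: gr sE.
Qed.

Lemma decaying_reg f (G0 G1 : R * R -> cliff) m (alpha : R) : slice_data th f G0 G1 -> 0 <= alpha ->
  alpha < m%:R -> poly_growth th alpha f -> decaying (fun s => regularizer m s * f s).
Proof.
move=> hf a0 am gf; have [C C0 HC] := reg_growth thI a0 am gf.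
exists (m%:R - alpha), (Mn * C); eexists; eexists; split.
- by rewrite subr_gt0.
- by rewrite mulr_ge0// ltW// Mnorm_gt0.
- exact: slice_data_reg thI hf.
move=> p J s cp HJ sE; rewrite (le_trans (norm_mul _ _))// -[leRHS]mulrA ler_pM2l ?Mnorm_gt0//.
exact: HC sE.
Qed.

Lemma decaying_regularizer m : (0 < m)%N -> decaying (regularizer m).
Proof.
move=> m0; have -> : regularizer m = (fun s => regularizer m s * 1) :> (cliff -> cliff).
  by apply/funext => s; rewrite mulr1.
apply: (@decaying_reg (fun=> 1) (fun=> 1) (fun=> 0) m 0) => //.
- split.
  + by move=> A; exact: polar_holo_cst.
  + by move=> p _; rewrite oppr0.
  + by move=> p J _ _; rewrite mulr0 addr0.
- by rewrite ltr0n.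
exists `|1 : cliff| => // s _; rewrite oppr0 powRr0.
by rewrite ler_peMr// lerDl.
Qed.

Lemma crev_regularizer m p J : unit_sphere J ->
  crev (regularizer m (p.1%:A + p.2 *: J)) = regularizer m (p.1%:A + p.2 *: J) :> cliff.
Proof.
move=> HJ; rewrite cemb_pair regularizer_cemb// crev_paravector//; exact: paravector_cemb.
Qed.

Lemma decaying_crev_regularizer m : (0 < m)%N -> decaying (crev \o regularizer m).
Proof.
move=> m0; apply: decaying_ext (decaying_regularizer m0) => p J _ HJ /=.
by rewrite crev_regularizer.
Qed.

(** The inverse of the regularizer at a nonzero point. *)
Definition reg_inv m q : cliff := (1 + q ^+ 2) ^+ m * pinv q ^+ m.

Lemma reg_invP m q : sector_pt om q -> reg_inv m q * regularizer m q = 1 /\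
  regularizer m q * reg_inv m q = 1.
Proof.
move=> /(sector_pt_slice d1)[I [z [HI -> z0 Iz cz]]].
have zn : z != 0 by rewrite -sqnc_eq0 gt_eqF.
have pp := @pi_gt0 R.
have cp : slice_cone th (Re z, Im z).
  rewrite /slice_cone /= -/(sqnc z); apply: lt_le_trans cz; rewrite ltr_pM2r ?sqrtr_gt0//.
  by apply: cos_norm_lt; [rewrite gtr0_norm|move: th2; lra].
have z1 : 1 + z ^+ 2 != 0 by have := den_neq0 thI cp; rewrite /cpt /=; case: (z).
have E : reg_inv m (cemb I z) = cemb I ((1 + z ^+ 2) ^+ m * z^-1 ^+ m).
  by rewrite /reg_inv (pinv_cemb HI) -(cemb1 I) -!(cembX HI) -cembD -(cembX HI) -(cembM HI).
rewrite E (regularizer_cemb _ _ HI) -!(cembM HI) /ereg.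
split; rewrite -(cemb1 I); congr cemb; rewrite !exprVn; field;
  by rewrite !expf_neq0.
Qed.

Lemma regularizer_bmult m : (0 < m)%N -> bmult (regularizer m \o h).
Proof. by move=> m0; exact/decaying_bmult/decaying_regularizer. Qed.

Lemma reg_inv_measurable m : cmeasurable (reg_inv m \o h).
Proof.
have mX (k : X -> cliff) n : cmeasurable k -> cmeasurable (fun x => k x ^+ n).
  move=> mk; elim: n => [|n IH]; first by under eq_fun do rewrite expr0; exact: cmeasurable_cst.
  by under eq_fun do rewrite exprS; exact: cmeasurableM.
apply: cmeasurableM; apply: (mX); last exact: cmeasurable_pinv.
by apply: cmeasurableD'; [exact: cmeasurable_cst|exact: (mX)].
Qed.

Lemma exists_regularizing f (alpha : R) : 0 <= alpha -> poly_growth th alpha f ->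
  exists m, regularizing th f m.
Proof.
move=> a0 gf; exists (Num.truncn alpha).+1, alpha; split => //; exact: truncnS_gt.
Qed.

Lemma Hinf_calcL_mul f : SHL_poly th f ->
  Hinf_calcL om th (mul_op mu h) f = mul_op mu (f \o h).
Proof.
move=> [/(SHL_slice_data thI)[G0 [G1 hf]] [alpha a0 gf]].
have P m : regularizing th f m -> regularizedL om th m (mul_op mu h) f = mul_op mu (f \o h).
  move=> [be [b0 gb bm]]; have m0 : (0 < m)%N by rewrite -(ltr0n R) (le_lt_trans b0).
  rewrite /regularizedL !omega_calcL_mul//; last exact: decaying_regularizer.
    apply: (@regularized_left _ _ _ _ _ _ (reg_inv m \o h)); first exact: regularizer_bmult.
    by move=> x; have [] := reg_invP m (hK x).
  exact: decaying_reg hf b0 bm gb.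
have [m Hm] := exists_regularizing a0 gf.
by apply: xget_unique => [//|A HA]; rewrite -(P m)// HA.
Qed.

Lemma Hinf_calcR_mul f : SHR_poly th f ->
  Hinf_calcR om th (mul_op mu h) f = mul_op mu (f \o h).
Proof.
move=> [/(SHR_slice_data thI)[G0 [G1 hf]] [alpha a0 gf]].
have P m : regularizing th f m -> regularizedR om th m (mul_op mu h) f = mul_op mu (f \o h).
  move=> [be [b0 gb bm]]; have m0 : (0 < m)%N by rewrite -(ltr0n R) (le_lt_trans b0).
  have gb' : poly_growth th be (crev \o f).
    by case: gb => C C0 HC; exists C => // s hs /=; rewrite norm_crev; exact: HC.
  have dfe : decaying (crev \o (fun s => f s * regularizer m s)).
    apply: decaying_ext (decaying_reg hf b0 bm gb') => p J cp HJ /=.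
    by rewrite crevM crev_regularizer.
  have [ee' e'e] : (forall x, reg_inv m (h x) * regularizer m (h x) = 1) /\
      (forall x, regularizer m (h x) * reg_inv m (h x) = 1).
    by split => x; have [] := reg_invP m (hK x).
  rewrite /regularizedR !omega_calcR_mul//; last exact: decaying_crev_regularizer.
  apply: (@regularized_right _ _ _ _ _ _ (reg_inv m \o h)) => //.
    exact: reg_inv_measurable.
  have [mfe _] := decaying_bmult dfe.
  rewrite [X in cmeasurable X](_ : _ = fun x =>
      crev (crev (f (h x) * regularizer m (h x))) * reg_inv m (h x)); last first.
    by apply/funext => x; rewrite crevK -mulrA e'e mulr1.
  apply: cmeasurableM; last exact: reg_inv_measurable.
  move=> A; under eq_fun do rewrite coef_crev.
  by apply: measurable_funM => //; exact: mfe.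
have [m Hm] := exists_regularizing a0 gf.
by apply: xget_unique => [//|A HA]; rewrite -(P m)// HA.
Qed.

End fixed_h.
End rays.

(** * The essential range *)

Section essential_range.
Context {R : realType} {d : nat} {disp : measure_display}
  {X : measurableType disp} {mu : {measure set X -> \bar R}}.
Local Notation cliff := (clifford R d).
Implicit Types (s q : cliff).

Definition ratc (c : {ffun {set 'I_d} -> rat}) : cliff := [ffun A => ratr (c A)].

Lemma ratc_dense s (e : R) : 0 < e -> exists c, `|s - ratc c| < e.
Proof.
move=> e0; set n : R := #|{set 'I_d}|%:R.
have n0 : 0 < n by rewrite (lt_le_trans ltr01)// /n card_sets_ge1.
have e'0 : 0 < e / (2 * n) by rewrite divr_gt0 ?mulr_gt0.
have /boolp.choice[r Hr] A : exists r : rat, `|coef s A - ratr r| <= e / (2 * n).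
  have [r] := @rat_in_itvoo R (coef s A) (coef s A + e / (2 * n)) ltac:(by rewrite ltrDl).
  rewrite in_itv/= => /andP[h1 h2]; exists r.
  rewrite ler_norml; apply/andP; split; lra.
exists [ffun A => r A]; apply: (@le_lt_trans _ _ (n * (e / (2 * n)))).
  by apply: norm_le_coefs => A; rewrite coefB /ratc {2}/coef !ffunE.
have -> : n * (e / (2 * n)) = e / 2 by field; rewrite gt_eqF.
lra.
Qed.

Lemma measurable_ball_preimage (h : X -> cliff) s (e : R) : cmeasurable h ->
  measurable [set x | `|h x - s| < e].
Proof.
move=> mh; have mB : cmeasurable (fun x => h x - s).
  by apply: cmeasurableD' => //; exact: cmeasurable_cst.
have := cmeasurable_norm mB => /(_ measurableT `]-oo, e[%classic (measurable_itv _)).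
by rewrite setTI; congr measurable; apply/seteqP; split => x /=; rewrite in_itv.
Qed.

(** If h(x) is outside the essential range, then h(x) has a null neighbourhood, which
    may be taken in a countable base; so all such x are in a countable union of null
    sets. *)
Lemma essran_ae (h : X -> cliff) : cmeasurable h -> (forall x, paravector (h x)) ->
  {ae mu, forall x, essran mu h (h x)}.
Proof.
move=> mh ph.
pose B (p : {ffun {set 'I_d} -> rat} * nat) := [set y | `|h y - ratc p.1| < p.2.+1%:R^-1].
pose N (n : nat) : set X := if unpickle n is Some p then
  if mu (B p) == 0%E then B p else set0 else set0.
apply: (@negligibleS _ _ _ mu (\bigcup_n N n)); last first.
  apply: negligible_bigcup => n; rewrite /N; case: (unpickle n) => [p|]; last exact: negligible_set0.
  case: eqP => [B0|_]; last exact: negligible_set0.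
  by apply/negligibleP => //; exact: measurable_ball_preimage.
move=> x /= hx.
have [e [e0 S0]] : exists e : R, 0 < e /\ mu [set y | `|h y - h x| < e] = 0%E.
  apply: contrapT => H; apply: hx; split => // e e0.
  by rewrite lt_neqAle measure_ge0 andbT; apply/eqP => S; apply: H; exists e.
pose k := Num.truncn (2 / e).
have k0 : (k.+1%:R^-1 : R) < e / 2.
  rewrite invf_plt ?posrE ?divr_gt0//; apply: le_lt_trans (truncnS_gt _).
  by rewrite invf_div.
have [c hc] := ratc_dense (h x) (e := k.+1%:R^-1) ltac:(by rewrite invr_gt0).
exists (pickle (c, k)) => //; rewrite /N pickleK.
suff -> : mu (B (c, k)) == 0%E by [].
rewrite -measure_le0 -S0; apply: le_measure; rewrite ?inE.
- exact: measurable_ball_preimage.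
- exact: measurable_ball_preimage.
move=> y /= hy; have -> : h y - h x = (h y - ratc c) - (h x - ratc c).
  by rewrite opprB addrA subrK.
apply: (le_lt_trans (ler_normB _ _)); apply: (lt_trans (ltrD hy hc)).
by rewrite [e]splitr; exact: ltrD.
Qed.

Lemma cnorm1 : `|1 : cliff| = 1.
Proof.
apply/eqP; rewrite -(@eqrXn2 _ 2)// sqr_cnorm (bigD1 finset.set0)//= big1 => [|A /negbTE A0].
  by rewrite addr0 coef_one eqxx.
by rewrite coef_one A0 expr0n.
Qed.

(** Changing h on a null set changes neither M_h nor M_{f o h}. *)
Lemma sector_pt_replace om (h : X -> cliff) : cmeasurable h -> (forall x, paravector (h x)) ->
  {ae mu, forall x, sector_pt om (h x)} ->
  exists h', [/\ cmeasurable h', forall x, sector_pt om (h' x) & {ae mu, forall x, h x = h' x}].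
Proof.
move=> mh ph aeK.
pose b x := (0 < `|h x|) && (cos om * `|h x| <= `|real_part (h x)|).
have bE x : b x -> sector_pt om (h x).
  by move=> /andP[h0 hc]; split => //; rewrite -normr_gt0.
exists (fun x => if b x then h x else 1); split.
- move=> A; have -> : (fun x => coef (if b x then h x else 1) A) =
    (fun x => if b x then coef (h x) A else coef (1 : cliff) A).
    by apply/funext => x; case: (b x).
  have mn := cmeasurable_norm mh.
  apply: measurable_fun_ifT => //; apply: measurable_and.
    by apply: measurable_fun_ltr.
  apply: measurable_fun_ler; first exact: measurable_funM.
  by apply: measurableT_comp => //; exact: mh.
- move=> x; case: ifP => [/bE//|_]; split.
  + move=> A A1; rewrite coef_one; case: eqP A1 => // ->; by rewrite cards0.
  + exact: oner_neq0.
  + rewrite cnorm1 real_partE coef_one eqxx normr1 mulr1; exact: cos_le1.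
apply: filterS aeK => x [_ h0 hc]; by rewrite /b normr_gt0 h0 hc.
Qed.

End essential_range.

Theorem theorem5p11 (R : realType) (d : nat) (d_ge1 : (1 <= d)%N)
    (disp : measure_display) (X : measurableType disp)
    (mu : {sigma_finite_measure set X -> \bar R})
    (h : X -> clifford R d) (omega : R)
    (omega_itv : 0 < omega < pi / 2)
    (h_paravector : forall x, paravector (h x))
    (h_measurable : cmeasurable h)
    (h_essran : essran mu h `<=` closure (double_sector omega))
    (h_neq0 : {ae mu, forall x, h x != 0})
    (theta : R) (theta_itv : omega < theta < pi / 2)
    (f : clifford R d -> clifford R d) :
  (SHL_poly theta f ->
    Hinf_calcL omega theta (mul_op mu h) f = mul_op mu (f \o h)) /\
  (SHR_poly theta f ->
    Hinf_calcR omega theta (mul_op mu h) f = mul_op mu (f \o h)).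
Proof.
have [om0 om2] := andP omega_itv; have [omth th2] := andP theta_itv.
have aeK : {ae mu, forall x, sector_pt omega (h x)}.
  apply: filterS2 (essran_ae h_measurable h_paravector) h_neq0 => x hx hx0.
  by have [ph hc] := closure_double_sector omega_itv (h_essran _ hx).
have [h' [mh' hK hh']] := sector_pt_replace h_measurable h_paravector aeK.
have -> : mul_op mu (f \o h) = mul_op mu (f \o h').
  by apply: mul_op_ae; apply: filterS hh' => x /= ->.
rewrite (mul_op_ae hh'); split => hf.
  exact: Hinf_calcL_mul.
exact: Hinf_calcR_mul.
Qed.
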